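(* The space $\Lambda$ endowed with the smash product $\#$ and the coproduct $\Delta$ is a connected Hopf algebra. It is commutative and cocommutative.
   Context: Work over a field $\Bbbk$ of characteristic $0$ and let $\Lambda=\bigoplus_{n\ge 0}\operatorname{Rep}(S_n)$ (direct sum of Grothendieck groups of the symmetric groups). For $\sigma\in S_p$, $\tau\in S_q$, let $\sigma\times\tau\in S_{p+q}$ act as $\sigma$ on $\{1,\ldots,p\}$ and as $i\mapsto\tau(i-p)+p$ on $\{p+1,\ldots,p+q\}$. For $\max(p,q)\le n\le p+q$, let $S_p\times_n S_q:=S_{n-q}\times S_{p+q-n}\times S_{n-p}$, embedded in $S_n$ via $(\sigma,\rho,\tau)\mapsto\sigma\times\rho\times\tau$ and in $S_p\times S_q$ via $(\sigma,\rho,\tau)\mapsto(\sigma\times\rho,\rho\times\tau)$. The smash product of a representation $V$ of $S_p$ and $W$ of $S_q$ is $V\# W:=\bigoplus_{n=\max(p,q)}^{p+q}\operatorname{Ind}_{S_p\times_n S_q}^{S_n}\operatorname{Res}^{S_p\times S_q}_{S_p\times_n S_q}(V\otimes W)$. The coproduct is defined, identifying $\operatorname{Rep}(S_p\times S_q)=\operatorname{Rep}(S_p)\otimes\operatorname{Rep}(S_q)$, by $\Delta(V)=\sum_{p+q=n}\operatorname{Res}^{S_n}_{S_p\times S_q}(V)$ for $V\in\operatorname{Rep}(S_n)$, restriction along the parabolic embedding $(\sigma,\tau)\mapsto\sigma\times\tau$. *)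

(* Defs.v *)
From HB Require Import structures.
From mathcomp Require Import all_boot all_order all_algebra.
From mathcomp Require Import all_fingroup all_solvable all_field all_character.
From mathcomp Require Import generic_quotient boolp zify.
From mathcomp.multinomials Require Import freeg.

Set Implicit Arguments.
Unset Strict Implicit.
Unset Printing Implicit Defensive.

Import GroupScope GRing.Theory.
Local Open Scope ring_scope.
Local Open Scope quotient_scope.

(* The basis element of the free module attached to s.  {classic S} is S,     *)
(* equipped with the choice structure that freeg requires.                    *)
Definition fgen (R : comNzRingType) (S : Type) (s : S) : {freeg {classic S} / R} :=
  << 1 *g (s : {classic S}) >>.

HB.instance Definition _ (R : comNzRingType) (M : lmodType R) (K : choiceType)
    (f : K -> M) :=
  GRing.isAdditive.Build {freeg K / R} M (fglift f) (lift_is_additive f).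

(* Modules given by generators and relations: the quotient of the free        *)
(* R-module on S by the submodule spanned by rel.                             *)
Section Presented.
Variables (R : comNzRingType) (S : Type).
Local Notation F := {freeg {classic S} / R}.
Variable rel : F -> Prop.

Definition submodule_pred (M : lmodType R) (P : M -> Prop) :=
  P 0 /\ forall a x y, P x -> P y -> P (a *: x + y).

Definition relspan (x : F) : Prop :=
  forall P : F -> Prop,
    submodule_pred P -> (forall y, rel y -> P y) -> P x.

Lemma relspan_rel x : rel x -> relspan x.
Proof. by move=> rx P _; apply. Qed.

Lemma relspan0 : relspan 0.
Proof. by move=> P [P0 _] _. Qed.

Lemma relspanP a x y : relspan x -> relspan y -> relspan (a *: x + y).
Proof.
by move=> hx hy P sP rP; have [_ PP] := sP; apply: PP; [exact: hx|exact: hy].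
Qed.

Lemma relspanN x : relspan x -> relspan (- x).
Proof.
by move=> hx; rewrite -[- x]addr0 -scaleN1r; apply: relspanP hx relspan0.
Qed.

Lemma relspanD x y : relspan x -> relspan y -> relspan (x + y).
Proof. by move=> hx hy; rewrite -[x]scale1r; apply: relspanP. Qed.

Lemma relspanZ a x : relspan x -> relspan (a *: x).
Proof. by move=> hx; rewrite -[_ *: _]addr0; apply: relspanP hx relspan0. Qed.

Definition releqv (x y : F) := `[< relspan (x - y) >].

Lemma releqv_refl : reflexive releqv.
Proof. by move=> x; apply/asboolP; rewrite subrr; exact: relspan0. Qed.
Lemma releqv_sym : symmetric releqv.
Proof.
by move=> x y; apply/asboolP/asboolP => /relspanN; rewrite opprB.
Qed.
Lemma releqv_trans : transitive releqv.
Proof.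
move=> y x z /asboolP xy /asboolP yz; apply/asboolP.
by have := relspanD xy yz; rewrite addrA subrK.
Qed.

Canonical releqv_equiv := EquivRel releqv releqv_refl releqv_sym releqv_trans.
Canonical releqv_encModRel := defaultEncModRel releqv.

Definition presented := {eq_quot releqv}.
HB.instance Definition _ := Choice.on presented.
HB.instance Definition _ := EqQuotient.on presented.

Definition pclass (x : F) : presented := \pi x.

Lemma pclassK (x : presented) : pclass (repr x) = x.
Proof. exact: reprK. Qed.

Lemma pclassP x y : pclass x = pclass y <-> relspan (x - y).
Proof. by split=> [/eqmodP/asboolP|h]; [|apply/eqmodP/asboolP]. Qed.

Lemma repr_pclass x : relspan (repr (pclass x) - x).
Proof. by apply/pclassP; rewrite pclassK. Qed.

Definition presented_add (x y : presented) := pclass (repr x + repr y).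
Definition presented_opp (x : presented) := pclass (- repr x).
Definition presented_scale (a : R) (x : presented) := pclass (a *: repr x).

Local Notation padd := presented_add.
Local Notation popp := presented_opp.
Local Notation pscale := presented_scale.

Fact paddE x y : padd (pclass x) (pclass y) = pclass (x + y).
Proof.
apply/pclassP; rewrite opprD addrACA.
by apply: relspanD; exact: repr_pclass.
Qed.
Fact poppE x : popp (pclass x) = pclass (- x).
Proof. by apply/pclassP; rewrite -opprD; apply: relspanN; exact: repr_pclass. Qed.
Fact pscaleE a x : pscale a (pclass x) = pclass (a *: x).
Proof.
by apply/pclassP; rewrite -scalerBr; apply: relspanZ; exact: repr_pclass.
Qed.

Fact presented_elim (P : presented -> Prop) :
  (forall x, P (pclass x)) -> forall x, P x.
Proof. by move=> h x; rewrite -[x]pclassK. Qed.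

Fact paddA : associative padd.
Proof.
move=> x y z; elim/presented_elim: x => x; elim/presented_elim: y => y.
by elim/presented_elim: z => z; rewrite !paddE addrA.
Qed.
Fact paddC : commutative padd.
Proof.
move=> x y; elim/presented_elim: x => x; elim/presented_elim: y => y.
by rewrite !paddE addrC.
Qed.
Fact padd0 : left_id (pclass 0) padd.
Proof. by elim/presented_elim=> x; rewrite paddE add0r. Qed.
Fact paddN : left_inverse (pclass 0) popp padd.
Proof. by elim/presented_elim=> x; rewrite poppE paddE addNr. Qed.

HB.instance Definition _ :=
  GRing.isZmodule.Build presented paddA paddC padd0 paddN.

Fact pscaleA a b x : pscale a (pscale b x) = pscale (a * b) x.
Proof. by elim/presented_elim: x => x; rewrite !pscaleE scalerA. Qed.
Fact pscale1 : left_id 1 pscale.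
Proof. by elim/presented_elim=> x; rewrite pscaleE scale1r. Qed.
Fact pscaleDr : right_distributive pscale +%R.
Proof.
move=> a x y; elim/presented_elim: x => x; elim/presented_elim: y => y.
by rewrite [X in pscale _ X]paddE !pscaleE [RHS]paddE scalerDr.
Qed.
Fact pscaleDl x : {morph pscale^~ x : a b / a + b}.
Proof.
move=> a b; elim/presented_elim: x => x.
by rewrite !pscaleE [RHS]paddE scalerDl.
Qed.

HB.instance Definition _ := GRing.Zmodule_isLmodule.Build R presented
  pscaleA pscale1 pscaleDr pscaleDl.

Lemma pclass_linear : linear pclass.
Proof. by move=> a x y; rewrite [_ *: pclass x]pscaleE [RHS]paddE. Qed.

Definition pgen (s : S) : presented := pclass (fgen R s).

Lemma presented_ind (P : presented -> Prop) :
  P 0 -> (forall a s x, P x -> P (a *: pgen s + x)) -> forall x, P x.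
Proof.
move=> P_0 PS; elim/presented_elim=> D.
rewrite -[D]freeg_sumE; elim: (dom D) => [|s r IH].
  by rewrite big_nil.
rewrite big_cons.
have -> : << coeff s D *g s >> = coeff s D *: fgen R (s : S) :> F.
  by apply/eqP/freeg_eqP => z; rewrite coeffZ !coeffU mul1r.
by rewrite pclass_linear; exact: PS.
Qed.

Variables (M : lmodType R).

(* The R-linear map sending pgen s to f s.  This is meaningful when f kills   *)
(* the relations; see plift_linear and plift_gen.                             *)
Definition plift (f : S -> M) (x : presented) : M :=
  fglift (f : {classic S} -> M) (repr x).

Section Lift.
Variable f : S -> M.
Hypothesis f_rel : forall y, rel y -> fglift (f : {classic S} -> M) y = 0.

Let fgl_linear : linear (fglift (f : {classic S} -> M)).
Proof.
move=> a x y; rewrite raddfD /=; congr (_ + _).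
rewrite -[x]freeg_sumE scaler_sumr !raddf_sum /=.
apply: eq_bigr => s _.
have -> : a *: << coeff s x *g s >> = << a * coeff s x *g s >> :> F.
  by apply/eqP/freeg_eqP => z; rewrite coeffZ !coeffU mulrA.
by rewrite !liftU scalerA.
Qed.

Lemma plift_class x : plift f (pclass x) = fglift (f : {classic S} -> M) x.
Proof.
apply/eqP; rewrite -subr_eq0 -raddfB /=; apply/eqP.
move: (repr_pclass x) => h; apply: (h (fun z => fglift _ z = 0)) => //.
by split=> [|a u v hu hv]; rewrite ?raddf0 // fgl_linear hu hv scaler0 addr0.
Qed.

Lemma plift_linear : linear (plift f).
Proof.
move=> a x y; elim/presented_elim: x => x; elim/presented_elim: y => y.
by rewrite -pclass_linear !plift_class fgl_linear.
Qed.

Lemma plift_gen s : plift f (pgen s) = f s.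
Proof. by rewrite plift_class liftU scale1r. Qed.
End Lift.

End Presented.

Definition bilinear_map (R : comNzRingType) (M N P : lmodType R)
    (f : M -> N -> P) :=
  (forall y, linear (f^~ y)) /\ (forall x, linear (f x)).

Section Tensor.
Variable R : comNzRingType.

Inductive tensor_rel (M N : lmodType R) : {freeg {classic M * N} / R} -> Prop :=
| TensorRelL a (x x' : M) (y : N) : tensor_rel
    (fgen R (a *: x + x', y) - (a *: fgen R (x, y) + fgen R (x', y)))
| TensorRelR a (x : M) (y y' : N) : tensor_rel
    (fgen R (x, a *: y + y') - (a *: fgen R (x, y) + fgen R (x, y'))).

Definition tensor (M N : lmodType R) := presented (@tensor_rel M N).

Definition tens (M N : lmodType R) (x : M) (y : N) : tensor M N :=
  pgen (@tensor_rel M N) (x, y).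

(* The linear map induced by f, for bilinear f.                               *)
Definition tlift (M N P : lmodType R) (f : M -> N -> P) : tensor M N -> P :=
  plift (fun xy : M * N => f xy.1 xy.2).

Section TensorLift.
Variables (M N P : lmodType R) (f : M -> N -> P).
Hypothesis f_bilin : bilinear_map f.

Fact tlift_rel y :
  @tensor_rel M N y ->
  fglift ((fun xy : M * N => f xy.1 xy.2) : {classic M * N} -> P) y = 0.
Proof.
have [fl fr] := f_bilin.
have fgZ b z : fglift ((fun xy : M * N => f xy.1 xy.2) : {classic M * N} -> P)
    (b *: fgen R z) = b *: f z.1 z.2.
  have -> : b *: fgen R z = << b *g (z : {classic M * N}) >>.
    by apply/eqP/freeg_eqP => t; rewrite coeffZ !coeffU mul1r.
  by rewrite liftU.
have fg z := fgZ 1 z.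
case=> a u v w; rewrite raddfB raddfD /= fgZ.
  rewrite -[fgen R _]scale1r -[fgen R (v, w)]scale1r !fg !scale1r /=.
  by rewrite (fl w a u v) subrr.
rewrite -[fgen R _]scale1r -[fgen R (u, w)]scale1r !fg !scale1r /=.
by rewrite (fr u a v w) subrr.
Qed.

Lemma tlift_linear : linear (tlift f).
Proof. exact: plift_linear tlift_rel. Qed.

Lemma tlift_tens x y : tlift f (tens x y) = f x y.
Proof. exact: plift_gen tlift_rel (x, y). Qed.
End TensorLift.

Lemma tens_bilinear (M N : lmodType R) : bilinear_map (@tens M N).
Proof.
split=> [y a x x'|x a y y']; rewrite -pclass_linear; apply/pclassP.
  by apply: relspan_rel; constructor.
by apply: relspan_rel; constructor.
Qed.

Definition tmap (M M' N N' : lmodType R) (f : M -> M') (g : N -> N') :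
    tensor M N -> tensor M' N' :=
  tlift (fun x y => tens (f x) (g y)).

Definition tassoc (M N P : lmodType R) :
    tensor (tensor M N) P -> tensor M (tensor N P) :=
  tlift (fun t z => tlift (fun x y => tens x (tens y z)) t).

Definition tswap (M N : lmodType R) : tensor M N -> tensor N M :=
  tlift (fun x y => tens y x).

End Tensor.

(* The direct sum of a sequence of modules, generated by the symbols dinj n x *)
(* with x in T n.                                                             *)
Section DirectSum.
Variables (R : comNzRingType) (T : nat -> lmodType R).

Inductive dsum_rel : {freeg {classic {n : nat & T n}} / R} -> Prop :=
| DsumRel n a (x y : T n) : dsum_rel
    (fgen R (existT T n (a *: x + y))
       - (a *: fgen R (existT T n x) + fgen R (existT T n y))).

Definition dsum := presented dsum_rel.
Definition dinj n (x : T n) : dsum := pgen dsum_rel (existT T n x).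

Lemma dinj_linear n : linear (@dinj n).
Proof.
move=> a x y; rewrite -pclass_linear; apply/pclassP.
by apply: relspan_rel; constructor.
Qed.
End DirectSum.
Arguments dinj {R} T n x.

Section HopfAlgebra.
Variables (R : comNzRingType) (H : lmodType R).
Variables (mul : H -> H -> H) (one : H).
Variables (Delta : H -> tensor H H) (eps : H -> R).

Definition is_algebra :=
  [/\ bilinear_map mul, associative mul, left_id one mul & right_id one mul].

Definition is_coalgebra :=
  [/\ linear Delta, scalar eps,
      forall x, tassoc (tmap Delta id (Delta x)) = tmap id Delta (Delta x),
      forall x, tlift (fun y z => eps y *: z) (Delta x) = x
    & forall x, tlift (fun y z => eps z *: y) (Delta x) = x].

(* The product of the algebra H (x) H.                                        *)
Definition tmul (s t : tensor H H) : tensor H H :=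
  tlift (fun a b => tlift (fun c d => tens (mul a c) (mul b d)) t) s.

Definition is_bialgebra :=
  [/\ is_algebra, is_coalgebra,
      (forall x y, Delta (mul x y) = tmul (Delta x) (Delta y)) /\
        Delta one = tens one one
    & (forall x y, eps (mul x y) = eps x * eps y) /\ eps one = 1].

Definition is_antipode (S : H -> H) :=
  [/\ linear S,
      forall x, tlift (fun y z => mul (S y) z) (Delta x) = eps x *: one
    & forall x, tlift (fun y z => mul y (S z)) (Delta x) = eps x *: one].

Definition is_hopf_algebra := is_bialgebra /\ exists S, is_antipode S.

Definition cocommutative := forall x, tswap (Delta x) = Delta x.

End HopfAlgebra.

(* A coalgebra graded by H = (+)_n T n is connected when T 0 = R 1.  Only the *)
(* coalgebra structure is required to be graded: the smash product is not     *)
(* homogeneous for the degree.                                                *)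
Section Connected.
Variables (R : comNzRingType) (T : nat -> lmodType R).
Local Notation H := (dsum T).
Local Notation iota := (dinj T).
Variables (one : H) (Delta : H -> tensor H H) (eps : H -> R).

Definition graded_coalgebra :=
  (forall n (x : T n), exists t : forall i : 'I_n.+1, tensor (T i) (T (n - i)%N),
     Delta (iota n x) = \sum_(i < n.+1) tmap (iota i) (iota (n - i)%N) (t i)) /\
  (forall n (x : T n), (0 < n)%N -> eps (iota n x) = 0).

Definition connected :=
  graded_coalgebra /\
  exists u : T 0%N,
    one = iota 0%N u /\ forall x : T 0%N, exists! a : R, x = a *: u.

End Connected.

Definition rep (k : fieldType) (gT : finGroupType) :=
  @representation k gT [set: gT]%G.

(* The Grothendieck group of the representations of gT over k, with scalars   *)
(* extended to R: the Grothendieck group itself is the case R = int.          *)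
Section Grothendieck.
Variables (R : comNzRingType) (k : fieldType) (gT : finGroupType).

Inductive groth_rel : {freeg {classic rep k gT} / R} -> Prop :=
| GrothRel (V U W : rep k gT) of mx_rsim V (dadd_grepr U W) :
    groth_rel (fgen R V - (fgen R U + fgen R W)).

Definition groth := presented groth_rel.
Definition cls (V : rep k gT) : groth := pgen groth_rel V.
End Grothendieck.
Arguments cls R {k gT} V.

Section Restriction.
Variables (k : fieldType) (gT hT : finGroupType).
Variables (f : {morphism [set: hT] >-> gT}) (V : rep k gT).

Fact res_mx_repr : mx_repr [set: hT] (fun h => V (f h)).
Proof.
split=> [|x y _ _]; first by rewrite morph1 repr_mx1.
by rewrite morphM ?inE // repr_mxM ?inE.
Qed.

Definition res : rep k hT :=
  @Representation k hT [set: hT]%G _ (MxRepresentation res_mx_repr).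
End Restriction.

Section Outer.
Variables (k : fieldType) (gT hT : finGroupType) (V : rep k gT) (W : rep k hT).

Fact outer_mx_repr :
  mx_repr [set: gT * hT] (fun x => tprod (V x.1) (W x.2)).
Proof.
split=> [|x y _ _]; first by rewrite !repr_mx1 tprod1.
by rewrite !repr_mxM ?inE // tprodE.
Qed.

Definition outer : rep k (gT * hT)%type :=
  @Representation k _ [set: gT * hT]%G _ (MxRepresentation outer_mx_repr).
End Outer.

(* Induction along an injective morphism f : hT -> gT.  With representatives  *)
(* t_i of the right cosets of the image of f, the block (i, j) of g in the    *)
(* induced representation is W h if t_i g t_j^-1 = f h, and 0 if there is no  *)
(* such h.                                                                    *)
Section Induction.
Variables (k : fieldType) (gT hT : finGroupType).
Variables (f : {morphism [set: hT] >-> gT}) (injf : 'injm f) (W : rep k hT).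

Local Notation cosets := (rcosets (f @* [set: hT]) [set: gT]).
Definition coset_rep (i : 'I_#|cosets|) : gT := fingroup.repr (enum_val i).
Local Notation t := coset_rep.

Definition ind_block g i j : 'M[k]_(rdegree W) :=
  \sum_(h | f h == (t i * g * (t j)^-1)%g) W h.

Definition ind_mx g : 'M[k]_(\sum_(i < #|cosets|) rdegree W) :=
  \mxblock_(i < #|cosets|, j < #|cosets|) ind_block g i j.

Fact coset_repE i : enum_val i = (f @* [set: hT] :* t i)%g.
Proof.
have /rcosetsP[x _ Ei] := enum_valP i.
by rewrite /t Ei rcoset_repr.
Qed.

Fact f_inj : injective f.
Proof. by move=> x y /(injmP injf); apply; rewrite inE. Qed.

Fact coset_rep_ex g : exists i h, f h = (g * (t i)^-1)%g.
Proof.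
have Hg : (f @* [set: hT] :* g)%g \in cosets by apply/rcosetsP; exists g; rewrite ?inE.
exists (enum_rank_in Hg (f @* [set: hT] :* g)%g).
set i := enum_rank_in _ _.
have Ei : enum_val i = (f @* [set: hT] :* g)%g by rewrite enum_rankK_in.
have : g \in (f @* [set: hT] :* t i)%g by rewrite -coset_repE Ei rcoset_refl.
by rewrite mem_rcoset => /morphimP[h _ _ ->]; exists h.
Qed.

Fact coset_rep_uniq g i j h h' :
  f h = (g * (t i)^-1)%g -> f h' = (g * (t j)^-1)%g -> i = j.
Proof.
move=> Eh Eh'; apply: enum_val_inj; rewrite !coset_repE.
have img z : f z \in f @* [set: hT] by apply: mem_morphim; rewrite inE.
apply/rcoset_eqP; rewrite mem_rcoset.
have -> : (t i * (t j)^-1 = f (h^-1 * h'))%g.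
  by rewrite morphM ?morphV ?inE // Eh Eh' invMg invgK mulgA mulgKV.
exact: img.
Qed.

Fact ind_blockE g i j h : f h = (t i * g * (t j)^-1)%g -> ind_block g i j = W h.
Proof.
move=> Eh; rewrite /ind_block (big_pred1 h) // => h'.
by rewrite -Eh (inj_eq f_inj).
Qed.

Fact ind_block0 g i j :
  (forall h, f h <> (t i * g * (t j)^-1)%g) -> ind_block g i j = 0.
Proof. by move=> nh; rewrite /ind_block big1 // => h /eqP /nh. Qed.

Fact ind_block_row x i : exists j h, f h = (t i * x * (t j)^-1)%g /\
  forall j', j' != j -> ind_block x i j' = 0.
Proof.
have [j [h Eh]] := coset_rep_ex (t i * x)%g; exists j, h; split=> // j' nj.
by apply: ind_block0 => h' /coset_rep_uniq/(_ Eh) /eqP; apply/negP.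
Qed.

Fact ind_mx_repr : mx_repr [set: gT] ind_mx.
Proof.
split=> [|x y _ _].
  rewrite -mxdiagZ; apply: eq_mxblock => i j.
  have E1 : f 1%g = (t i * 1 * (t i)^-1)%g by rewrite morph1 mulg1 mulgV.
  case: eqVneq => [<-|/eqP nij]; first by rewrite (ind_blockE E1) repr_mx1 conform_mx_id.
  by apply: ind_block0 => h /coset_rep_uniq/(_ E1) /esym.
rewrite /ind_mx mul_mxblock; apply: eq_mxblock => i j.
have [l [h [Eh l0]]] := ind_block_row x i.
rewrite (bigD1 l) //= big1 ?addr0 => [|l' /l0 ->]; last by rewrite mul0mx.
rewrite (ind_blockE Eh).
rewrite /ind_block mulmx_sumr (reindex_inj (mulgI h)) /=.
apply: eq_big => [h'|h' _]; last by rewrite repr_mxM ?inE.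
rewrite morphM ?inE // Eh -!mulgA (inj_eq (mulgI _)) (inj_eq (mulgI _)).
by rewrite -(inj_eq (mulgI (t l))) mulKVg.
Qed.

Definition ind : rep k gT :=
  @Representation k gT [set: gT]%G _ (MxRepresentation ind_mx_repr).

End Induction.

Section BlockPermutation.
Variables (p q : nat).

Definition block_fun (s : 'S_p) (t : 'S_q) (i : 'I_(p + q)) : 'I_(p + q) :=
  match split i with
  | inl j => lshift q (s j)
  | inr j => rshift p (t j)
  end.

Fact block_fun_lshift s t j : block_fun s t (lshift q j) = lshift q (s j).
Proof. by rewrite /block_fun (unsplitK (inl j)). Qed.

Fact block_fun_rshift s t j : block_fun s t (rshift p j) = rshift p (t j).
Proof. by rewrite /block_fun (unsplitK (inr j)). Qed.

Fact block_fun_inj s t : injective (block_fun s t).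
Proof.
apply: (can_inj (g := block_fun s^-1%g t^-1%g)) => i.
by case: (split_ordP i) => j ->;
  rewrite ?block_fun_lshift ?block_fun_rshift permK.
Qed.

(* The product of 'S_n composes from left to right, and representations act   *)
(* on row vectors on the right, so these are modules over the usual S_n up to *)
(* the isomorphism s |-> s^-1 of S_n with its opposite.                       *)
Definition block_perm s t : 'S_(p + q) := perm (@block_fun_inj s t).

Fact block_permM s s' t t' :
  block_perm (s * s')%g (t * t')%g = (block_perm s t * block_perm s' t')%g.
Proof.
apply/permP=> i; rewrite permM !permE.
by case: (split_ordP i) => j ->;
  rewrite !(block_fun_lshift, block_fun_rshift) permM.
Qed.

Fact block_perm_inj s s' t t' :
  block_perm s t = block_perm s' t' -> s = s' /\ t = t'.
Proof.
move/permP=> E; split; apply/permP=> j.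
  have := E (lshift q j); rewrite !permE !block_fun_lshift.
  exact: lshift_inj.
have := E (rshift p j); rewrite !permE !block_fun_rshift.
exact: rshift_inj.
Qed.
End BlockPermutation.

Fact cast_permM m n (e : m = n) s t :
  cast_perm e (s * t)%g = (cast_perm e s * cast_perm e t)%g.
Proof. by subst n; rewrite !cast_perm_id. Qed.

Fact cast_perm_injective m n (e : m = n) : injective (cast_perm e).
Proof. by subst n; move=> s t; rewrite !cast_perm_id. Qed.

Section Parabolic.
Variables (p q n : nat) (e : (p + q)%N = n).

Definition parabolic (x : 'S_p * 'S_q) : 'S_n := cast_perm e (block_perm x.1 x.2).

Fact parabolicM :
  {in [set: 'S_p * 'S_q] &, {morph parabolic : x y / (x * y)%g}}.
Proof. by move=> x y _ _; rewrite /parabolic block_permM cast_permM. Qed.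
Canonical parabolic_morphism := Morphism parabolicM.
End Parabolic.

(* The two embeddings of S_a x S_b x S_c, with a = n - q, b = p + q - n and   *)
(* c = n - p for the component of degree n of the smash product.              *)
Section SmashComponent.
Variables (a b c p q n : nat).
Hypotheses (ep : (a + b)%N = p) (eq : (b + c)%N = q) (en : (a + b + c)%N = n).
Local Notation K := ('S_a * 'S_b * 'S_c)%type.

Definition smash_emb (x : K) : 'S_n :=
  cast_perm en (block_perm (block_perm x.1.1 x.1.2) x.2).

Definition smash_diag (x : K) : 'S_p * 'S_q :=
  (cast_perm ep (block_perm x.1.1 x.1.2), cast_perm eq (block_perm x.1.2 x.2)).

Fact smash_embM : {in [set: K] &, {morph smash_emb : x y / (x * y)%g}}.
Proof. by move=> x y _ _; rewrite /smash_emb !block_permM cast_permM. Qed.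
Canonical smash_emb_morphism := Morphism smash_embM.

Fact smash_diagM : {in [set: K] &, {morph smash_diag : x y / (x * y)%g}}.
Proof. by move=> x y _ _; rewrite /smash_diag !block_permM !cast_permM. Qed.
Canonical smash_diag_morphism := Morphism smash_diagM.

Fact smash_emb_injm : 'injm smash_emb.
Proof.
apply/injmP=> -[[r s] t] [[r' s'] t'] _ _ /cast_perm_injective.
by move=> /block_perm_inj[/block_perm_inj[/= -> ->] /= ->].
Qed.

Definition smash_component (k : fieldType) (V : rep k 'S_p) (W : rep k 'S_q) :
    rep k 'S_n :=
  ind smash_emb_injm (res smash_diag_morphism (outer V W)).
End SmashComponent.

Definition smash_range p q := {n : 'I_(p + q).+1 | (maxn p q <= n)%N}.

Section SmashRange.
Variables (p q : nat) (n : smash_range p q).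
Let n' : nat := \val (\val n).

Fact smash_bounds : (maxn p q <= n')%N && (n' <= p + q)%N.
Proof. by rewrite (valP n) -ltnS ltn_ord. Qed.

Fact smash_eqp : (n' - q + (p + q - n'))%N = p.
Proof. by have := smash_bounds; lia. Qed.
Fact smash_eqq : (p + q - n' + (n' - p))%N = q.
Proof. by have := smash_bounds; lia. Qed.
Fact smash_eqn : (n' - q + (p + q - n') + (n' - p))%N = n'.
Proof. by have := smash_bounds; lia. Qed.

Definition smash_rep (k : fieldType) (V : rep k 'S_p) (W : rep k 'S_q) :
    rep k 'S_n' :=
  smash_component smash_eqp smash_eqq smash_eqn V W.
End SmashRange.

Section Lambda.
Variables (R : comNzRingType) (k : fieldType).

Definition RepS n : lmodType R := groth R k 'S_n.
Definition RepSS p q : lmodType R := groth R k ('S_p * 'S_q)%type.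
Definition Lambda : lmodType R := dsum RepS.
Local Notation iota := (dinj RepS).

Definition is_smash_product (mul : Lambda -> Lambda -> Lambda) :=
  bilinear_map mul /\
  forall p q (V : rep k 'S_p) (W : rep k 'S_q),
    mul (iota p (cls R V)) (iota q (cls R W)) =
    \sum_(n : smash_range p q) iota (\val (\val n)) (cls R (smash_rep n V W)).

(* The identification of Rep(S_p x S_q) with Rep(S_p) (x) Rep(S_q).           *)
Definition is_identification
    (phi : forall p q, RepSS p q -> tensor (RepS p) (RepS q)) :=
  forall p q,
  [/\ linear (phi p q), bijective (phi p q)
    & forall (V : rep k 'S_p) (W : rep k 'S_q),
        phi p q (cls R (outer V W)) = tens (cls R V : RepS p) (cls R W : RepS q)].

Fact split_eq n (i : 'I_n.+1) : (i + (n - i))%N = n.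
Proof. by rewrite subnKC // -ltnS. Qed.

Definition is_restriction_coproduct
    (phi : forall p q, RepSS p q -> tensor (RepS p) (RepS q))
    (Delta : Lambda -> tensor Lambda Lambda) :=
  linear Delta /\
  forall n (V : rep k 'S_n),
    Delta (iota n (cls R V)) =
    \sum_(i < n.+1) tmap (iota i) (iota (n - i)%N)
      (phi i (n - i)%N (cls R (res (parabolic_morphism (split_eq i)) V))).

End Lambda.

(* Main.v *)
From HB Require Import structures.
Require Import Defs.
From mathcomp.multinomials Require Import freeg.
From mathcomp Require Import all_boot all_order all_algebra.
From mathcomp Require Import all_fingroup all_solvable all_field all_character.
From mathcomp Require Import generic_quotient boolp zify.
Set Implicit Arguments.
Unset Strict Implicit.
Unset Printing Implicit Defensive.
Import GroupScope GRing.Theory.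
Local Open Scope ring_scope.

(* Evaluate a class function [f] of S_n at a permutation [g] of an arbitrary  *)
(* finite set T by summing [f] of the restriction of [g] to A over the        *)
(* g-stable subsets A of T with n elements.  This turns the smash product     *)
(* into the pointwise product of functions of [g] (sum over the pairs A, B of *)
(* stable subsets instead of over their union), the coproduct into the map    *)
(* induced by disjoint union, and the counit into evaluation at the empty     *)
(* permutation, so all the bialgebra axioms but the antipode become obvious.  *)
(* Evaluation is injective on N-combinations of classes because k has         *)
(* characteristic 0 and it is unitriangular in n; working with N-combinations *)
(* of generators transfers the identities to any ring of scalars R.           *)
(*                                                                            *)
(* Rep(S_p x S_q) = Rep(S_p) (x) Rep(S_q) holds over every k of               *)
(* characteristic 0 because irreducible representations of S_n have scalar    *)
(* commutants.  Indeed g is conjugate to its powers of exponent prime to its  *)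
(* order, so the characters over k span the class functions (induce from      *)
(* cyclic subgroups); hence for d in the commutant of an irreducible V,       *)
(* tr(d g) is a multiple of the character of V.  By induction on n a matrix   *)
(* unit e of an S_(n-1)-constituent of V is available, and e A e is           *)
(* commutative for the enveloping algebra A, because g is conjugate to its    *)
(* inverse under S_(n-1); this forces d to be scalar.                         *)
(*                                                                            *)
(* The antipode exists because the coalgebra is graded and connected: it is   *)
(* the sum of the (-1)^j J^j, for J the identity minus unit o counit and its  *)
(* convolution powers, which is finite in each degree.                        *)

(** * Characters and Grothendieck groups *)

(** A class function of S_n is extended to all finite permutations by summing it over the invariant
    subsets with n elements ([ev]). In the smash product, a pair of invariant subsets [A], [B] with
    p and q elements contributes to the component of degree [#|A :|: B|]: inducing from S_(n-q) x
    S_(p+q-n) x S_(n-p) amounts to labelling [A :\: B], [A :&: B] and [B :\: A]. Summing over n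
    gives the pointwise product ([ev_smash_rep]). An invariant subset of a disjoint sum is a pair of
    invariant subsets, so restriction to the S_p x S_q becomes evaluation at a disjoint sum
    ([ev_psum]). Associativity and commutativity are then those of k, coassociativity and
    cocommutativity those of disjoint sums up to bijection, and [Delta] is multiplicative because
    both sides are pointwise products.

    These identities of functions must be brought back to Lambda, for any ring R. Elements are
    paired with their evaluations through N-combinations of classes ([form1], [form2], [form3]). The
    evaluation determines the element ([based_inj]): irreducible characters evaluate to independent
    functions ([sym_irr_free]), and natural multiplicities can be read off in characteristic 0. By
    multilinearity, testing on classes of representations is enough.

    The identification [phi] needs every irreducible representation of S_p x S_q to be an outer
    product over k itself ([irr_outer]). This follows from [sym_scalar_commutant], an induction on n
    resting on [class_function_span] and [scalar_commutant_ext], with no classification of the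
    representations.

    For the antipode, write the identity as the convolution unit plus J. Connectedness makes J
    vanish in degree 0, hence J is locally nilpotent for convolution ([redpow_vanish]) and a
    geometric series inverts the identity ([antipodeP]). *)

Definition chi (k : fieldType) (gT : finGroupType) (V : rep k gT) (g : gT) : k :=
  \tr (V g).

Section Cls.
Variables (R : comNzRingType) (k : fieldType) (gT : finGroupType).
Implicit Types V U W : rep k gT.

Lemma chi_rsim V W g : mx_rsim V W -> chi V g = chi W g.
Proof. by move=> VW; apply: (mxtrace_rsim VW); rewrite inE. Qed.

Lemma chi_dadd U W g : chi (dadd_grepr U W) g = chi U g + chi W g.
Proof. exact: mxtrace_block. Qed.

Lemma chi1 V : chi V 1%g = (rdegree V)%:R.
Proof. by rewrite /chi repr_mx1 mxtrace1. Qed.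

Lemma chiM V (x y : gT) : chi V (x * y)%g = chi V (y * x)%g.
Proof. by rewrite /chi !repr_mxM ?inE // mxtrace_mulC. Qed.

Lemma chiJ V (x y : gT) : chi V (x ^ y)%g = chi V x.
Proof. by rewrite conjgE chiM mulgK. Qed.

Lemma cls_sum V U W : mx_rsim V (dadd_grepr U W) -> cls R V = cls R U + cls R W.
Proof.
move=> VUW.
have := @pclass_linear R _ (@groth_rel R k gT) 1 (fgen R U) (fgen R W).
rewrite !scale1r => <-; apply/pclassP.
by apply: relspan_rel; constructor.
Qed.

Lemma cls0 : cls R (grepr0 : rep k gT) = 0.
Proof.
apply: (addrI (cls R (grepr0 : rep k gT))); rewrite addr0; symmetry.
apply: cls_sum; exists 0 => // [|x _]; last by rewrite mulmx0 mul0mx.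
by rewrite /row_free mxrank0.
Qed.

Lemma dadd_rsim0 V : mx_rsim (dadd_grepr V grepr0) V.
Proof.
exists (col_mx 1%:M 0) => [/=|/=|x _ /=]; first by rewrite addn0.
  rewrite /row_free -addsmxE addsmx0 mxrank1 addn0 //.
by rewrite mul_block_col !mulmx0 !mul0mx !addr0 mul_col_mx mul0mx mulmx1 mul1mx.
Qed.

Lemma cls_rsim V W : mx_rsim V W -> cls R V = cls R W.
Proof.
move=> VW; rewrite (@cls_sum V W grepr0) ?cls0 ?addr0 //.
exact: mx_rsim_trans VW (mx_rsim_sym (dadd_rsim0 W)).
Qed.

Lemma cls_big (I : Type) (r : seq I) (P : pred I) (V : I -> rep k gT) :
  cls R (\big[dadd_grepr/grepr0]_(i <- r | P i) V i) = \sum_(i <- r | P i) cls R (V i).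
Proof.
by apply: (big_morph _ _ cls0) => U W; apply: cls_sum; apply: mx_rsim_refl.
Qed.

Lemma chi_big (I : Type) (r : seq I) (P : pred I) (V : I -> rep k gT) g :
  chi (\big[dadd_grepr/grepr0]_(i <- r | P i) V i) g = \sum_(i <- r | P i) chi (V i) g.
Proof.
rewrite (big_morph (fun V => chi V g) (id1 := 0) (op1 := +%R)) // => [U W|].
  exact: chi_dadd.
by rewrite /chi mxtrace1.
Qed.

End Cls.

(** * Complete systems of irreducible representations *)

Section IrrSystem.
Variables (k : fieldType) (k0 : [pchar k] =i pred0) (gT : finGroupType).

(* The second clause says that [e] acts as a central idempotent of the group  *)
(* algebra cutting out the isotypic component of [b i].                       *)
Definition irr_system (I : finType) (b : I -> rep k gT) : Prop :=
  [/\ forall i, mx_irreducible (b i),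
      forall i, exists e : gT -> k, forall j,
        \sum_g e g *: b j g = (i == j)%:R%:M,
      forall V : rep k gT, mx_irreducible V -> exists i, mx_rsim V (b i)
    & forall V : rep k gT, exists m : I -> nat,
        (forall R, cls R V = \sum_i cls R (b i) *+ m i) /\
        (forall g, chi V g = \sum_i chi (b i) g *+ m i)].

Lemma char0_pgroup : [pchar k]^'.-group [set: gT].
Proof. by rewrite /pgroup /pnat cardG_gt0; apply/allP => p _; rewrite inE /= k0. Qed.

(** The simple components of the regular representation, separated by their Wedderburn idempotents.
    By Maschke every representation is the sum of its socle components, which gives the
    multiplicities. *)
Lemma exists_irr_system : exists (I : finType) (b : I -> rep k gT), irr_system b.
Proof.
have kG := char0_pgroup.
(* [socle_exists] is only a classical existence, so the socle is extracted by contradiction. *)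
have [sG] : inhabited (irrType k [set: gT]%G).
  apply: contrapT => nsG; apply: notF.
  by apply: (socle_exists (regular_repr k [set: gT]%G)) => sG; case: nsG.
exists sG, (fun i => Representation (irr_repr i)); split=> [i|i|V irrV|V].
- exact: socle_irr.
- have : (Wedderburn_id i \in group_ring k [set: gT])%MS.
    by rewrite -(Wedderburn_sum_pchar sG kG) (sumsmx_sup i) ?Wedderburn_id_mem.
  case/envelop_mxP=> e def_e; exists e => j.
  have -> : \sum_g e g *: irr_repr j g = gring_op (irr_repr j) (Wedderburn_id i).
    rewrite def_e !linear_sum; apply: eq_big => [g|g _]; first by rewrite inE.
    by rewrite linearZ /= gring_opG ?inE.
  case: eqVneq => [->|nij]; first by rewrite op_Wedderburn_id_pchar.
  rewrite -scalemx1 scale0r.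
  by rewrite (irr_repr'_op0_pchar kG nij) ?Wedderburn_id_mem.
- by exists (irr_comp sG V); apply: rsim_irr_comp_pchar.
have [sV] : inhabited (socleType V).
  by apply: contrapT => nsG; apply: notF; apply: (socle_exists V) => s; case: nsG.
pose c (W : sV) := irr_comp sG (socle_repr W).
pose rU (W : sV) : rep k gT := muln_grepr (Representation (irr_repr (c W))) (socle_mult W).
exists (fun i => \sum_(W : sV | c W == i) socle_mult W)%N.
have rsV : mx_rsim V (\big[dadd_grepr/grepr0]_W rU W).
  apply: mx_rsim_trans (mx_rsim_sym (rsim_submod1 (mxmodule1 V) _)) _ => //.
  have S1 : Socle sV = 1%:M := reducible_Socle1 sV (mx_Maschke_pchar V kG).
  apply: (@mx_rsim_dsum _ _ _ _ V _ xpredT (fun W : sV => W : 'M_(rdegree V)) rU 1%:M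
    (fun W => component_mx_module V (socle_base W))).
  - by rewrite -S1; exact: eqmx_refl.
  - exact: Socle_direct.
  move=> W; apply: mx_rsim_socle.
  exact: (rsim_irr_comp_pchar sG kG (socle_irr W)).
split=> [R|g].
  rewrite (cls_rsim R rsV) cls_big (partition_big c xpredT) //=.
  apply: eq_bigr => i _; rewrite -sumrMnr; apply: eq_bigr => W /eqP <-.
  by rewrite /rU /muln_grepr cls_big sumr_const card_ord.
rewrite (chi_rsim g rsV) chi_big (partition_big c xpredT) //=.
apply: eq_bigr => i _; rewrite -sumrMnr; apply: eq_bigr => W /eqP <-.
by rewrite /rU /muln_grepr chi_big sumr_const card_ord.
Qed.

Lemma natr_inj_char0 : injective (fun n : nat => n%:R : k).
Proof.
have E := (pcharf0P k).1 k0; move=> m n /=.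
wlog le_mn : m n / (m <= n)%N => [hw|] mn.
  by case/orP: (leq_total m n) => /hw h; [exact: h|exact/esym/h/esym].
move/eqP: mn; rewrite eq_sym -subr_eq0 -natrB // E subn_eq0 => nm.
by apply/eqP; rewrite eqn_leq le_mn.
Qed.

Lemma natr_neq0_char0 n : (0 < n)%N -> n%:R != 0 :> k.
Proof. by rewrite ((pcharf0P k).1 k0) lt0n. Qed.

Section Consequences.
Variables (I : finType) (b : I -> rep k gT).
Hypothesis bP : irr_system b.

Lemma irr_rdegree V : @mx_irreducible k gT [set: gT] _ (V : rep k gT) -> (rdegree V)%:R != 0 :> k.
Proof. by case/mx_irrP => /natr_neq0_char0. Qed.

(** Pairing the relation with the idempotent of [b i] leaves [c i] times the degree of [b i], and
    degrees are nonzero in characteristic 0. *)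
Lemma irr_chi_free (c : I -> k) :
  (forall g, \sum_i c i * chi (b i) g = 0) -> forall i, c i = 0.
Proof.
have [irrb sepb _ _] := bP => c0 i; have [e eP] := sepb i.
have : \sum_g e g * \sum_j c j * chi (b j) g = 0.
  by rewrite big1 // => g _; rewrite c0 mulr0.
under eq_bigr => g _ do rewrite mulr_sumr.
rewrite exchange_big /= (bigD1 i) //= [X in _ + X]big1 => [|j ji].
  rewrite addr0 => h.
  have : c i * \tr (\sum_g e g *: b i g) = 0.
    rewrite linear_sum mulr_sumr -[RHS]h; apply: eq_bigr => g _.
    by rewrite linearZ /= mulrCA.
  rewrite eP eqxx mxtrace1 => /eqP; rewrite mulf_eq0.
  by rewrite (negPf (irr_rdegree (irrb i))) orbF => /eqP.
transitivity (c j * \tr (\sum_g e g *: b j g)).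
  rewrite linear_sum mulr_sumr; apply: eq_bigr => g _.
  by rewrite linearZ /= mulrCA.
by rewrite eP eq_sym (negPf ji) -scalemx1 scale0r linear0 mulr0.
Qed.

(** Both sides expand over [b] with natural multiplicities. Characters determine these
    multiplicities in k, hence as natural numbers, so the classes agree over any R. *)
Lemma eq_cls_sum R (J J' : Type) (r : seq J) (r' : seq J')
    (V : J -> rep k gT) (W : J' -> rep k gT) :
  (forall g, \sum_(j <- r) chi (V j) g = \sum_(j <- r') chi (W j) g) ->
  \sum_(j <- r) cls R (V j) = \sum_(j <- r') cls R (W j).
Proof.
have [_ _ _ decb] := bP.
have dec (L : Type) (s : seq L) (X : L -> rep k gT) : exists m : I -> nat,
    \sum_(j <- s) cls R (X j) = \sum_i cls R (b i) *+ m i /\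
    (forall g, \sum_(j <- s) chi (X j) g = \sum_i chi (b i) g *+ m i).
  elim: s => [|j s [m [Em Cm]]].
    by exists (fun=> 0%N); split=> [|g]; rewrite big_nil big1.
  have [m' [Em' Cm']] := decb (X j); exists (fun i => m' i + m i)%N.
  split=> [|g]; rewrite big_cons ?Em ?Em' ?Cm ?Cm' -big_split /=;
    by apply: eq_bigr => i _; rewrite mulrnDr.
have [m [-> Cm]] := dec _ r V; have [m' [-> Cm']] := dec _ r' W => eqVW.
suff mm' i : m i = m' i by apply: eq_bigr => i _; rewrite mm'.
apply: natr_inj_char0; apply/eqP; rewrite -subr_eq0; apply/eqP; move: i.
apply: irr_chi_free => g.
transitivity (\sum_i chi (b i) g *+ m i - \sum_i chi (b i) g *+ m' i).
  rewrite -sumrB; apply: eq_bigr => i _.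
  by rewrite mulrBl !mulr_natl.
by rewrite -Cm -Cm' eqVW subrr.
Qed.
End Consequences.

Lemma cls_chi_add R (V U W : rep k gT) :
  (forall g, chi V g = chi U g + chi W g) -> cls R V = cls R U + cls R W.
Proof.
move=> VUW; have [I [b bP]] := exists_irr_system.
have := @eq_cls_sum I b bP R _ _ [:: V] [:: U; W] id id.
rewrite !big_cons !big_nil !addr0; apply=> g.
by rewrite !big_cons !big_nil !addr0.
Qed.
End IrrSystem.

(** * Class functions and induced characters *)

Section Trivial.
Variables (k : fieldType) (gT : finGroupType).

Fact triv_mx_repr : mx_repr [set: gT] (fun=> 1%:M : 'M[k]_1).
Proof. by split=> // x y _ _; rewrite mulmx1. Qed.

Definition triv_rep : rep k gT :=
  @Representation k gT [set: gT]%G _ (MxRepresentation triv_mx_repr).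

Lemma chi_triv g : chi triv_rep g = 1.
Proof. by rewrite /chi mxtrace1. Qed.
End Trivial.

Section IndChar.
Variables (k : fieldType) (k0 : [pchar k] =i pred0) (gT hT : finGroupType).
Variables (f : {morphism [set: hT] >-> gT}) (injf : 'injm f) (W : rep k hT).

Definition ind_term (g x : gT) : k := \sum_(h | f h == (x * g * x^-1)%g) chi W h.

Lemma chi_ind_coset g : chi (ind injf W) g = \sum_i ind_term g (coset_rep (f := f) i).
Proof.
rewrite /chi /= mxtrace_mxblock; apply: eq_bigr => i _.
by rewrite /ind_block linear_sum.
Qed.

Lemma ind_term_mull g u x : ind_term g (f u * x)%g = ind_term g x.
Proof.
rewrite /ind_term (reindex_inj (conjg_inj u^-1%g)) /=.
apply: eq_big => [h|h _]; last by rewrite chiJ.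
rewrite -(inj_eq (conjg_inj (f u))) -morphJ ?inE // conjgKV.
by rewrite !conjgE invMg !mulgA mulVg mul1g mulgKV.
Qed.

(** Frobenius formula: averaging over the whole group removes the coset representatives, because
    [ind_term] is constant on cosets. *)
Lemma chi_ind g :
  chi (ind injf W) g = #|hT|%:R^-1 * \sum_x ind_term g x.
Proof.
have finj := f_inj injf.
have nz : #|hT|%:R != 0 :> k by apply: (natr_neq0_char0 k0); rewrite -cardsT cardG_gt0.
apply: (mulfI nz); rewrite mulVKf // chi_ind_coset mulr_natl -sumr_const.
rewrite exchange_big pair_big /=.
(* Every group element is uniquely an element of the image of [f] times a coset representative. *)
rewrite [RHS](reindex (fun iu : 'I_#|rcosets (f @* [set: hT]) [set: gT]| * hT =>
  (f iu.2 * coset_rep iu.1)%g)) /=; last first.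
  have ex g' : exists iu : 'I_#|rcosets (f @* [set: hT]) [set: gT]| * hT,
      g' = (f iu.2 * coset_rep iu.1)%g.
    have [i [u E]] := coset_rep_ex f g'; exists (i, u); by rewrite /= E mulgKV.
  have [h hP] := choice ex; exists h => [[i u] _|g' _] /=; last by rewrite -hP.
  have := hP (f u * coset_rep i)%g; case: (h _) => j v /= E.
  have Eu : f u = (f u * coset_rep i * (coset_rep i)^-1)%g by rewrite mulgK.
  have Ev : f v = (f u * coset_rep i * (coset_rep j)^-1)%g by rewrite E mulgK.
  have ij := coset_rep_uniq Eu Ev; subst j; congr (_, _).
  by apply: finj; rewrite Ev mulgK.
by apply: eq_bigr => -[i u] _; rewrite ind_term_mull.
Qed.
End IndChar.

Section ClassFunctions.
Variables (k : fieldType) (k0 : [pchar k] =i pred0) (gT : finGroupType).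

Definition class_function (f : gT -> k) := forall x y, f (x ^ y)%g = f x.

Hypothesis powJ : forall (x : gT) m, coprime #[x] m -> exists y, (x ^+ m = x ^ y)%g.
Variables (I : finType) (b : I -> rep k gT).
Hypothesis bP : irr_system b.

Definition chi_span (f : gT -> k) := exists a : I -> k, forall g, f g = \sum_i a i * chi (b i) g.

Lemma chi_span_chi V : chi_span (chi V).
Proof.
have [_ _ _ /(_ V)[m [_ mP]]] := bP; exists (fun i => (m i)%:R) => g.
by rewrite mP; apply: eq_bigr => i _; rewrite mulr_natl.
Qed.

Lemma chi_span_ext f f' : f =1 f' -> chi_span f -> chi_span f'.
Proof. by move=> ff' [a aP]; exists a => g; rewrite -ff'. Qed.

Lemma chi_spanZ c f : chi_span f -> chi_span (fun g => c * f g).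
Proof.
move=> [a aP]; exists (fun i => c * a i) => g; rewrite aP mulr_sumr.
by apply: eq_bigr => i _; rewrite mulrA.
Qed.

Lemma chi_spanD f f' : chi_span f -> chi_span f' -> chi_span (fun g => f g + f' g).
Proof.
move=> [a aP] [a' aP']; exists (fun i => a i + a' i) => g; rewrite aP aP' -big_split.
by apply: eq_bigr => i _; rewrite mulrDl.
Qed.

Lemma chi_span_sum (J : Type) (r : seq J) (P : pred J) (f : J -> gT -> k) :
  (forall j, P j -> chi_span (f j)) -> chi_span (fun g => \sum_(j <- r | P j) f j g).
Proof.
move=> fP; elim: r => [|j r IH].
  by exists (fun=> 0) => g; rewrite big_nil big1 // => i _; rewrite mul0r.
case Pj: (P j).
  apply: chi_span_ext (chi_spanD (fP j Pj) IH) => g /=.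
  by rewrite big_cons Pj.
by apply: chi_span_ext IH => g; rewrite big_cons Pj.
Qed.

Definition class_ind (y g : gT) : k := (g \in y ^: [set: gT])%:R.

Lemma class_function_expand f : class_function f -> forall g,
  f g = \sum_y f y / #|y ^: [set: gT]|%:R * class_ind y g.
Proof.
move=> fJ g; rewrite (bigID (mem (g ^: [set: gT]))) /= [X in _ + X]big1 ?addr0; last first.
  by move=> y; rewrite /class_ind class_sym => /negPf ->; rewrite mulr0.
rewrite (eq_bigr (fun=> f g / #|g ^: [set: gT]|%:R)) => [|y gy]; last first.
  rewrite /class_ind class_sym gy mulr1 (class_eqP gy).
  by case/imsetP: gy => z _ ->; rewrite fJ.
rewrite sumr_const -[_ *+ _]mulr_natr divfK //.
by apply: natr_neq0_char0 => //; apply/card_gt0P; exists g; apply: class_refl.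
Qed.

(** Induction on the order of [y]. The trivial character induced from the cyclic group of [y] is
    nonzero at [y]; elsewhere its support consists of conjugates of powers of [y]. By [powJ] the
    powers of full order are conjugate to [y], and all others have smaller order, so their class
    indicators are already available. *)
Lemma chi_span_class_ind y : chi_span (class_ind y).
Proof.
have [n] := ubnP #[y]; elim: n y => // n IH y; rewrite ltnS => ny.
pose C := <[y]>%G; pose s := sgval_morphism C.
have injs : 'injm s by apply: injm_sgval.
pose F := chi (ind injs (triv_rep k _)).
have FE g : F g = #|subg_of C|%:R^-1 *
    #|[set x | (x * g * x^-1)%g \in C]|%:R.
  rewrite /F (chi_ind k0); congr (_ * _); rewrite -sum1_card natr_sum.
  rewrite [RHS]big_mkcond; apply: eq_bigr => x _; rewrite inE /ind_term.
  case: ifP => [xy|nxy].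
    rewrite (big_pred1 (subg _ (x * g * x^-1)%g)) ?chi_triv // => h /=.
    by rewrite -(inj_eq val_inj) /= -[val _]/(sgval _) subgK.
  rewrite big_pred0 // => h; apply: contraFF nxy => /eqP <-.
  exact: subgP.
have nzF : F y != 0.
  rewrite FE mulf_neq0 ?invr_neq0 // natr_neq0_char0 //; apply/card_gt0P.
    by exists 1%g.
  by exists 1%g; rewrite inE mul1g invg1 mulg1 cycle_id.
have FJ : class_function F by move=> u v; apply: chiJ.
have low z : z \notin y ^: [set: gT] -> F z != 0 -> (#[z] < n)%N.
  move=> nyz; rewrite FE mulf_eq0 negb_or => /andP[_].
  rewrite (pcharf0P k).1 // -lt0n => /card_gt0P[x]; rewrite inE => Cz.
  pose z' := (x * z * x^-1)%g; have Ez : z' = (z ^ x^-1)%g.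
    by rewrite conjgE invgK mulgA.
  have /cycleP[m] := Cz; rewrite -/z' => zm; apply: leq_trans (_ : #[y] <= n)%N => //.
  rewrite -(orderJ z x^-1) -Ez ltn_neqAle (dvdn_leq _ (order_dvdG Cz)) ?order_gt0 // andbT.
  (* If [z] had the order of [y], then [m] would be prime to that order and [z] would be conjugate
     to [y]. *)
  apply: contra nyz => /eqP ozy.
  have [|u yu] := @powJ y m.
    rewrite /coprime; move: ozy; rewrite zm orderXgcd => /(congr1 (muln (gcdn #[y] m))).
    rewrite mulnC divnK ?dvdn_gcdl // -[LHS]mul1n => /eqP.
    by rewrite eqn_pmul2r ?order_gt0 // eq_sym.
  apply/imsetP; exists (u * x)%g; rewrite ?inE // conjgM -yu -zm Ez conjgKV //.
(* Removing the values of [F] off the class of [y] leaves [F y] times the indicator of that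
   class. *)
have [a aP] : chi_span (fun g => F g + -1 * \sum_(z | z \notin y ^: [set: gT])
    F z / #|z ^: [set: gT]|%:R * class_ind z g).
  apply: chi_spanD; first exact: chi_span_chi.
  apply/chi_spanZ/chi_span_sum => z nyz; have [->|Fz] := eqVneq (F z) 0.
    by exists (fun=> 0) => g; rewrite !mul0r big1 // => i _; rewrite mul0r.
  exact/chi_spanZ/IH/low.
exists (fun i => (F y)^-1 * a i) => g.
under eq_bigr => i _ do rewrite -mulrA.
rewrite -mulr_sumr -aP (class_function_expand FJ g) mulN1r.
rewrite (bigID (mem (y ^: [set: gT]))) /= addrK.
rewrite (eq_bigr (fun=> F y / #|y ^: [set: gT]|%:R * class_ind y g)).
  rewrite sumr_const -[X in _ = _ * X]mulr_natl [X in _ = _ * X]mulrA [_%:R * _]mulrC divfK ?mulKf //.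
  by apply: natr_neq0_char0 => //; apply/card_gt0P; exists y; apply: class_refl.
move=> z yz; rewrite /class_ind -(class_eqP yz); congr (_ / _ * _).
by case/imsetP: yz => u _ ->; rewrite FJ.
Qed.

Lemma class_function_span f : class_function f -> chi_span f.
Proof.
move=> fJ; apply: chi_span_ext (fun g => esym (class_function_expand fJ g)) _.
by apply: chi_span_sum => y _; apply/chi_spanZ/chi_span_class_ind.
Qed.
End ClassFunctions.

(** * Scalar commutants *)

Section Enveloping.
Variables (k : fieldType) (gT : finGroupType) (V : rep k gT).
Local Notation n := (rdegree V).

(** The action on [V] of the group algebra element with coefficients [a]. *)
Definition gop (a : gT -> k) : 'M[k]_n := \sum_g a g *: V g.

Lemma gopV g : V g = gop (fun x => (x == g)%:R).
Proof.
rewrite /gop (bigD1 g) //= eqxx scale1r big1 ?addr0 // => x /negPf->.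
by rewrite scale0r.
Qed.

Lemma gopM a c : exists d, gop a *m gop c = gop d.
Proof.
exists (fun g => \sum_x a x * c (x^-1 * g)%g).
rewrite /gop mulmx_suml; under eq_bigr => x _.
  rewrite mulmx_sumr (reindex_inj (mulgI x^-1%g)) /=.
  under eq_bigr => y _ do rewrite -scalemxAl -scalemxAr -repr_mxM ?inE // mulKVg scalerA.
  over.
by rewrite exchange_big; apply: eq_bigr => g _; rewrite scaler_suml.
Qed.

Lemma gop_comm d a : (forall g, d *m V g = V g *m d) -> d *m gop a = gop a *m d.
Proof.
move=> dV; rewrite mulmx_sumr mulmx_suml; apply: eq_bigr => g _.
by rewrite -scalemxAl -scalemxAr dV.
Qed.

Lemma irr_gop (irrV : mx_irreducible V) (v w : 'rV[k]_n) : v != 0 -> exists a, w = v *m gop a.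
Proof.
move=> nzv; have /mx_irrP[_ minV] := irrV.
have full : row_full (cyclic_mx V v).
  by apply: minV; rewrite ?cyclic_mx_module // cyclic_mx_eq0.
have /cyclic_mxP[A /envelop_mxP[a ->] ->] : (w <= cyclic_mx V v)%MS by apply: submx_full.
exists a; congr (_ *m _); apply: eq_bigl => g; exact: in_setT.
Qed.

(** A full-rank factorization [e = C B] of an idempotent satisfies [B C = 1], so cyclicity of the
    trace gives the rank. *)
Lemma mxtrace_idem (e : 'M[k]_n) : e *m e = e -> \tr e = (\rank e)%:R.
Proof.
have := mulmx_base e; have [B' BB'] := row_freeP (row_base_free e).
have [C' C'C] := row_fullP (col_base_full e).
move: (col_base e) (row_base e) BB' C'C => C B BB' C'C CB ee.
have BC : B *m C = 1%:M.
  have : C *m B *m (C *m B) = C *m B by rewrite CB.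
  move/(congr1 (fun M => C' *m M *m B')).
  by rewrite !mulmxA C'C mul1mx -!mulmxA BB' mulmx1.
by rewrite -[in LHS]CB mxtrace_mulC BC mxtrace1.
Qed.
End Enveloping.

Section ScalarCommutant.
Variables (k : fieldType) (k0 : [pchar k] =i pred0) (gT : finGroupType).
Variables (I : finType) (b : I -> rep k gT).
Hypothesis bP : irr_system b.
Hypothesis spanb : forall f : gT -> k, class_function f -> chi_span b f.

Definition scalar_commutant (V : rep k gT) :=
  forall d : 'M_(rdegree V), (forall g, d *m V g = V g *m d) -> is_scalar_mx d.

(** The function [g |-> tr (d g)] is a class function, hence a combination of irreducible
    characters. Inserting the idempotent of the isotypic component of [V] keeps only the character
    of [V]. *)
Lemma trace_commutant (V : rep k gT) (d : 'M_(rdegree V)) :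
    mx_irreducible V -> (forall g, d *m V g = V g *m d) ->
  exists a, forall x, \tr (d *m gop V x) = a * \tr (gop V x).
Proof.
move=> irrV dV; have [irrb sepb isob _] := bP.
have [j [B EB fB hB]] := isob V irrV; have [e eP] := sepb j.
have [|a aP] := @spanb (fun g => \tr (d *m V g)).
  move=> x y; rewrite conjgE !repr_mxM ?inE // mulmxA dV -mulmxA mxtrace_mulC.
  by rewrite -!mulmxA -repr_mxM ?inE // mulgV repr_mx1 mulmx1.
have Ve : gop V e = 1%:M.
  have [B' BB'] := row_freeP fB.
  rewrite -[LHS]mulmx1 -BB' mulmxA /gop mulmx_suml.
  under eq_bigr => g _ do rewrite -scalemxAl hB ?inE // scalemxAr.
  by rewrite -mulmx_sumr eP eqxx mulmx1 BB'.
have trV g : \tr (d *m V g) = a j * chi V g.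
  rewrite -[V g]mul1mx -Ve /gop mulmx_suml mulmx_sumr linear_sum /=.
  under eq_bigr => h _.
    rewrite -scalemxAl -scalemxAr linearZ /= -repr_mxM ?inE // aP mulr_sumr.
    over.
  rewrite exchange_big (bigD1 j) //= [X in _ + X]big1 => [|i ij].
    rewrite addr0; transitivity (a j * \tr ((\sum_h e h *: b j h) *m b j g)).
      rewrite mulmx_suml linear_sum mulr_sumr; apply: eq_bigr => h _.
      by rewrite -scalemxAl linearZ /= -repr_mxM ?inE // mulrCA.
    rewrite eP eqxx mul1mx; congr (_ * _); apply/esym/(@chi_rsim k gT V (b j)).
    by exists B.
  transitivity (a i * \tr ((\sum_h e h *: b i h) *m b i g)).
    rewrite mulmx_suml linear_sum mulr_sumr; apply: eq_bigr => h _.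
    by rewrite -scalemxAl linearZ /= -repr_mxM ?inE // mulrCA.
  by rewrite eP eq_sym (negPf ij) -scalemx1 scale0r mul0mx linear0 mulr0.
exists (a j) => x; rewrite /gop mulmx_sumr !linear_sum mulr_sumr /=.
by apply: eq_bigr => g _; rewrite -scalemxAr !linearZ /= trV mulrCA.
Qed.

(* [e A e] is a commutative corner of the enveloping algebra [A] of [V], over *)
(* which the row space of [e] is simple, so a nonzero [d'] in the commutant   *)
(* is inverted on [e] by some [c] in [A].  Then [e = e c d'] has trace 0.     *)
Lemma scalar_commutant_corner (V : rep k gT) (e : gT -> k) (E := gop V e) :
    mx_irreducible V -> E != 0 -> E *m E = E ->
    (forall x y, E *m gop V x *m E *m (E *m gop V y *m E) =
                 E *m gop V y *m E *m (E *m gop V x *m E)) ->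
  scalar_commutant V.
Proof.
move=> irrV nzE EE comE d dV; have [a aP] := trace_commutant irrV dV.
apply/is_scalar_mxP; exists a; apply/eqP; rewrite -subr_eq0.
set d' := d - _; apply/idPn => nzd.
have d'V g : d' *m V g = V g *m d'.
  by rewrite mulmxBl mulmxBr dV scalar_mxC.
have d'tr x : \tr (d' *m gop V x) = 0.
  by rewrite mulmxBl mul_scalar_mx linearB /= linearZ /= aP subrr.
have ud : d' \in unitmx by apply: mx_Schur irrV _ _ nzd; apply/centgmxP => g _.
have [i nzi] : exists i, row i E != 0.
  apply/existsP; apply: contraNT nzE => /existsPn h; apply/eqP/row_matrixP => i.
  by rewrite row0; apply/eqP; have := h i; rewrite negbK.
set v := row i E in nzi; have vE : v *m E = v by rewrite -row_mul EE.
have [y yP] := irr_gop irrV (v *m invmx d') nzi.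
have dE : invmx d' *m E = E *m invmx d'.
  have cdE : d' *m E = E *m d' := gop_comm e d'V.
  rewrite -[LHS]mulmx1 -(mulmxV ud) mulmxA -[_ *m E *m d']mulmxA -cdE.
  by rewrite [_ *m (d' *m E)]mulmxA mulVmx // mul1mx.
pose c := E *m gop V y *m E.
have vc : v *m c = v *m invmx d' by rewrite /c !mulmxA vE -yP -mulmxA dE mulmxA vE.
(* Each row [w] of [E] is [v] times a corner element, which commutes with [c]; thus the behaviour of
   [c] on [v] carries over to [w]. *)
have key : E *m c *m d' = E.
  apply/row_matrixP => j; rewrite !row_mul; set w := row j E.
  have wE : w *m E = w by rewrite -row_mul EE.
  have [x xP] := irr_gop irrV w nzi.
  have wx : w = v *m (E *m gop V x *m E) by rewrite !mulmxA vE -xP wE.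
  rewrite {1}wx -[v *m _ *m c]mulmxA comE mulmxA vc.
  rewrite -!mulmxA [gop V x *m _]mulmxA.
  have [z zP] := gopM V e x; have [z' zP'] := gopM V z e.
  have -> : E *m (gop V x *m E *m d') = gop V z' *m d' by rewrite !mulmxA zP zP'.
  rewrite -(gop_comm z' d'V) [invmx _ *m _]mulmxA mulVmx // mul1mx.
  by rewrite -zP' -zP mulmxA mulmxA vE -xP wE.
have [z zP] := gopM V e y; have [z' zP'] := gopM V z e; have [z2 zP2] := gopM V e z'.
have := mxtrace_idem EE; rewrite -{1}key /c zP zP' zP2 mxtrace_mulC d'tr.
move/eqP; rewrite eq_sym (negPf (natr_neq0_char0 k0 _)) //.
by rewrite lt0n mxrank_eq0.
Qed.
End ScalarCommutant.

(** * Matrix units coming from a subgroup, and commutativity of the corner *)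

Section MatrixUnits.
Variables (k : fieldType) (k0 : [pchar k] =i pred0) (gT hT : finGroupType).
Variables (f : {morphism [set: hT] >-> gT}) (V : rep k gT).

Section Units.
Variables (U : rep k hT) (B : 'M[k]_(rdegree U, rdegree V)).
Hypotheses (irrU : mx_irreducible U) (scU : scalar_commutant U).
Hypotheses (fB : row_free B) (hB : forall h, U h *m B = B *m V (f h)).
Local Notation d := (rdegree U).

Let c : k := d%:R / #|hT|%:R.

Let d_neq0 : d%:R != 0 :> k.
Proof. exact: (irr_rdegree k0 irrU). Qed.

Let h_neq0 : #|hT|%:R != 0 :> k.
Proof. by apply: (natr_neq0_char0 k0); rewrite -cardsT cardG_gt0. Qed.

Let reprM (W : rep k hT) x y : W (x * y)%g = W x *m W y.
Proof. by rewrite repr_mxM ?inE. Qed.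

(** The average [X] of an elementary matrix over conjugation by [U] commutes with [U], so it is
    scalar; its trace gives the scalar. *)
Lemma schur_orthogonality i j l m :
  c * \sum_h U h^-1%g j i * U h m l = ((i == m) && (j == l))%:R.
Proof.
pose X := \sum_h U h^-1%g *m delta_mx i m *m U h.
have XE : X j l = \sum_h U h^-1%g j i * U h m l.
  rewrite summxE; apply: eq_bigr => h _.
  rewrite mxE (bigD1 m) //= big1 => [|m' nm].
    rewrite addr0 mxE (bigD1 i) //= big1 => [|i' ni].
      by rewrite addr0 !mxE !eqxx mulr1.
    by rewrite !mxE (negPf ni) mulr0.
  by rewrite mxE big1 ?mul0r // => i' _; rewrite !mxE (negPf nm) andbF mulr0.
have /is_scalar_mxP[a Xa] : is_scalar_mx X.
  apply: scU => g; rewrite /X mulmx_suml mulmx_sumr (reindex_inj (mulIg g^-1%g)) /=.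
  apply: eq_bigr => h _; rewrite invMg invgK !reprM -!mulmxA.
  by rewrite -reprM mulVg repr_mx1 mulmx1.
have : \tr X = #|hT|%:R * (i == m)%:R.
  rewrite /X linear_sum /= (eq_bigr (fun=> (i == m)%:R)) => [|h _].
    by rewrite sumr_const -[LHS]mulr_natl.
  rewrite mxtrace_mulC mulmxA -reprM mulgV repr_mx1 mul1mx.
  rewrite /mxtrace (bigD1 i) //= big1 ?mxE ?eqxx ?addr0 // => i' ni.
  by rewrite !mxE (negPf ni).
rewrite -XE Xa mxtrace_scalar mxE -[a *+ d]mulr_natl => ad.
have {ad} -> : a = c^-1 * (i == m)%:R.
  by apply: (mulfI d_neq0); rewrite ad /c invf_div mulrA mulrCA divff // mulr1.
rewrite -mulrnAr mulVKf; last by rewrite mulf_neq0 ?invr_neq0.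
by case: (i == m); case: (j == l).
Qed.

(** The group algebra element of [hT] acting on [U] as the elementary matrix [delta_mx i j], made to
    act on [V] through [f]. *)
Definition munit i j : 'M_(rdegree V) := c *: \sum_h U h^-1%g j i *: V (f h).

Lemma munit_mull h i j : V (f h) *m munit i j = \sum_l U h l i *: munit l j.
Proof.
rewrite /munit -scalemxAr mulmx_sumr.
under [RHS]eq_bigr => l _ do rewrite scalerA mulrC -scalerA.
rewrite -scaler_sumr; congr (_ *: _).
under [RHS]eq_bigr => l _ do rewrite scaler_sumr.
rewrite exchange_big [RHS](reindex_inj (mulgI h)) /=; apply: eq_bigr => g _.
rewrite morphM ?inE // repr_mxM ?inE // -scalemxAr.
under eq_bigr => l _ do rewrite scalerA.
rewrite -scaler_suml; congr (_ *: _).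
have -> : g^-1%g = ((h * g)^-1 * h)%g by rewrite invMg mulgKV.
by rewrite [U _]reprM mxE; apply: eq_bigr => l _; rewrite mulrC.
Qed.

Lemma munit_mulr h i j : munit i j *m V (f h) = \sum_l U h j l *: munit i l.
Proof.
rewrite /munit -scalemxAl mulmx_suml.
under [RHS]eq_bigr => l _ do rewrite scalerA mulrC -scalerA.
rewrite -scaler_sumr; congr (_ *: _).
under [RHS]eq_bigr => l _ do rewrite scaler_sumr.
rewrite exchange_big [RHS](reindex_inj (mulIg h)) /=; apply: eq_bigr => g _.
rewrite morphM ?inE // repr_mxM ?inE // -scalemxAl.
under eq_bigr => l _ do rewrite scalerA.
rewrite -scaler_suml; congr (_ *: _).
have -> : g^-1%g = (h * (g * h)^-1)%g by rewrite invMg mulKVg.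
by rewrite [U _]reprM mxE; apply: eq_bigr => l _.
Qed.

Lemma munitM i j l m : munit i j *m munit l m = (j == l)%:R *: munit i m.
Proof.
rewrite {1}/munit -scalemxAl mulmx_suml.
under eq_bigr => h _ do rewrite -scalemxAl munit_mull scaler_sumr.
rewrite exchange_big scaler_sumr (bigD1 i) //= [X in _ + X]big1 => [|i' ni].
  rewrite addr0; under eq_bigr => h _ do rewrite scalerA.
  by rewrite -scaler_suml scalerA schur_orthogonality eqxx.
under eq_bigr => h _ do rewrite scalerA.
by rewrite -scaler_suml scalerA schur_orthogonality eq_sym (negPf ni) scale0r.
Qed.

(** On the copy of [U] given by the rows of [B], [munit i j] acts as [delta_mx i j]. *)
Lemma munit_neq0 i j : munit i j != 0.
Proof.
have E : B *m munit i j = delta_mx i j *m B.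
  rewrite /munit -scalemxAr mulmx_sumr.
  under eq_bigr => h _ do rewrite -scalemxAr -hB scalemxAl.
  rewrite -mulmx_suml scalemxAl; congr (_ *m _); apply/matrixP => m l.
  rewrite !mxE summxE [m == i]eq_sym [l == j]eq_sym -(schur_orthogonality i j l m).
  by congr (_ * _); apply: eq_bigr => h _; rewrite !mxE.
apply: contraTneq fB => E0; rewrite E0 mulmx0 in E.
apply/negP => /row_freeP[B' BB']; have := congr1 (fun M => (M *m B') i j) E.
by rewrite mul0mx -mulmxA BB' mulmx1 !mxE !eqxx => /eqP; rewrite eq_sym oner_eq0.
Qed.

Lemma munit_gop i j : exists a, munit i j = gop V a.
Proof.
exists (fun g => \sum_(h | f h == g) c * U h^-1%g j i).
rewrite /munit scaler_sumr (partition_big f xpredT) //=; apply: eq_bigr => g _.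
by rewrite scaler_suml; apply: eq_bigr => h /eqP <-; rewrite scalerA.
Qed.

Lemma gop_sum (J : Type) (r : seq J) (M : J -> 'M_(rdegree V)) :
  (forall j, exists a, M j = gop V a) -> exists a, \sum_(j <- r) M j = gop V a.
Proof.
move=> Ma; elim: r => [|j r [a IH]].
  by exists (fun=> 0); rewrite big_nil /gop big1 // => g _; rewrite scale0r.
have [a' aE] := Ma j; exists (fun g => a' g + a g); rewrite big_cons IH aE.
by rewrite /gop -big_split; apply: eq_bigr => g _; rewrite scalerDl.
Qed.

Hypothesis invJ : forall g : gT, exists h, (g^-1 = g ^ f h)%g.

(** Gelfand's trick: inversion reverses products, yet by [invJ] it fixes every coefficient function
    invariant under conjugation by the image of [f]. *)
Lemma gop_inv_comm a a' :
    (forall g h, a (g ^ f h)%g = a g) -> (forall g h, a' (g ^ f h)%g = a' g) ->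
  gop V a *m gop V a' = gop V a' *m gop V a.
Proof.
have half b b' : gop V b *m gop V b' = \sum_g (\sum_x b x * b' (x^-1 * g)%g) *: V g.
  rewrite /gop mulmx_suml; under eq_bigr => x _.
    rewrite mulmx_sumr (reindex_inj (mulgI x^-1%g)) /=.
    under eq_bigr => y _ do rewrite -scalemxAl -scalemxAr -repr_mxM ?inE // mulKVg scalerA.
    over.
  by rewrite exchange_big; apply: eq_bigr => g _; rewrite scaler_suml.
move=> aJ aJ'; rewrite !half; apply: eq_bigr => g _; congr (_ *: _).
have inv (b : gT -> k) : (forall g h, b (g ^ f h)%g = b g) -> forall x, b x^-1%g = b x.
  by move=> bJ x; have [h ->] := invJ x.
transitivity (\sum_y a' y * a (y^-1 * g^-1)%g).
  rewrite [RHS](reindex_inj (mulgI g^-1%g)) /=; apply: eq_bigr => x _.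
  rewrite mulrC invMg invgK -mulgA mulgV mulg1 inv //; congr (_ * _).
  by rewrite -inv // invMg invgK.
have [h ->] := invJ g; rewrite (reindex_inj (conjg_inj (f h))) /=.
by apply: eq_bigr => y _; rewrite -conjVg -conjMg aJ aJ'.
Qed.

(** An operator commuting with the subgroup equals the average of its conjugates, so its
    coefficients may be averaged too. *)
Lemma gop_centralizer a : (forall h, gop V a *m V (f h) = V (f h) *m gop V a) ->
  exists a', (forall g h, a' (g ^ f h)%g = a' g) /\ gop V a = gop V a'.
Proof.
move=> aV; exists (fun g => #|hT|%:R^-1 * \sum_h a (g ^ f h)%g); split=> [g h|].
  congr (_ * _); rewrite [RHS](reindex_inj (mulgI h)) /=; apply: eq_bigr => h' _.
  by rewrite morphM ?inE // conjgM.
apply: (scalerI h_neq0); rewrite scaler_nat -sumr_const /gop.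
under [in X in _ = _ *: X]eq_bigr => g _ do rewrite -scalerA.
rewrite -scaler_sumr scalerA divff // scale1r.
under [RHS]eq_bigr => g _ do rewrite scaler_suml.
rewrite [RHS]exchange_big /=; apply: eq_bigr => h _.
have fV : V (f h) *m V (f h)^-1%g = 1%:M by rewrite -repr_mxM ?inE // mulgV repr_mx1.
rewrite -[LHS]mulmx1 -fV mulmxA aV [RHS](reindex_inj (conjg_inj (f h)^-1%g)) /=.
rewrite mulmx_sumr mulmx_suml; apply: eq_bigr => g _.
rewrite conjgKV -scalemxAr -scalemxAl; congr (_ *: _).
by rewrite conjgE invgK !repr_mxM ?inE // mulmxA.
Qed.

(** Spreading [E a E] over all the matrix units gives [z a], which centralizes the subgroup and
    compresses back to [E a E]. Commutativity of the centralizer, by [gop_inv_comm], thus passes to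
    the corner. *)
Lemma munit_corner_comm i x y (E := munit i i) :
  E *m gop V x *m E *m (E *m gop V y *m E) = E *m gop V y *m E *m (E *m gop V x *m E).
Proof.
pose z a := \sum_l munit l i *m gop V a *m munit i l.
have zV a h : z a *m V (f h) = V (f h) *m z a.
  rewrite /z mulmx_suml mulmx_sumr.
  under eq_bigr => l _ do rewrite -mulmxA munit_mulr mulmx_sumr.
  under [RHS]eq_bigr => l _ do rewrite !mulmxA munit_mull !mulmx_suml.
  rewrite exchange_big; apply: eq_bigr => l _; apply: eq_bigr => m _.
  by rewrite -scalemxAr -!scalemxAl.
have zgop a : exists a', (forall g h, a' (g ^ f h)%g = a' g) /\ z a = gop V a'.
  have [|a' a'E] := @gop_sum _ (index_enum _) (fun l => munit l i *m gop V a *m munit i l).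
    move=> l; have [u ->] := munit_gop l i; have [v ->] := munit_gop i l.
    by have [w ->] := gopM V u a; apply: gopM.
  have [h|a'' [aJ E'']] := @gop_centralizer a'; first by rewrite -a'E zV.
  by exists a''; split; rewrite // -E''.
have zE a : z a *m E = E *m gop V a *m E.
  rewrite /z mulmx_suml (bigD1 i) //= [X in _ + X]big1 => [|l li].
    by rewrite addr0 -mulmxA munitM eqxx scale1r.
  by rewrite -mulmxA munitM (negPf li) scale0r mulmx0.
have Ez a : E *m z a = E *m gop V a *m E.
  rewrite /z mulmx_sumr (bigD1 i) //= [X in _ + X]big1 => [|l li].
    by rewrite addr0 !mulmxA munitM eqxx scale1r.
  by rewrite !mulmxA munitM eq_sym (negPf li) scale0r !mul0mx.
have EE : E *m E = E by rewrite munitM eqxx scale1r.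
have [x' [xJ zx]] := zgop x; have [y' [yJ zy]] := zgop y.
rewrite -!zE -[_ *m E *m _]mulmxA [E *m (z y *m E)]mulmxA Ez -zE -[_ *m E *m E]mulmxA EE.
rewrite -[RHS]mulmxA [E *m (z x *m E)]mulmxA Ez -zE -[_ *m E *m E]mulmxA EE.
by rewrite !mulmxA zx zy gop_inv_comm.
Qed.
End Units.

Lemma irr_sub_rep (irrV : mx_irreducible V) :
  exists (U : rep k hT) (B : 'M[k]_(rdegree U, rdegree V)),
    [/\ mx_irreducible U, row_free B & forall h, U h *m B = B *m V (f h)].
Proof.
pose Vf := res f V; have nz1 : (1%:M : 'M[k]_(rdegree Vf)) != 0.
  by rewrite -mxrank_eq0 mxrank1 -lt0n; case/mx_irrP: irrV.
have [M simM] : exists M, mxsimple Vf M.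
  apply: contrapT => nM; apply: notF.
  apply: (mxsimple_exists (mxmodule1 Vf) nz1) => -[M simM _].
  by case: nM; exists M.
have modM := mxsimple_module simM.
exists (Representation (submod_repr modM)), (val_submod 1%:M); split.
- by apply/submod_mx_irr.
- by rewrite /row_free val_submod1.
move=> h; have := val_submodJ modM 1%:M (in_setT h).
by rewrite mul1mx => <-; rewrite [RHS]val_submodE.
Qed.

Lemma scalar_commutant_ext (I : finType) (b : I -> rep k gT) :
    irr_system b -> (forall F : gT -> k, class_function F -> chi_span b F) ->
    (forall g : gT, exists h, (g^-1 = g ^ f h)%g) ->
    (forall U : rep k hT, mx_irreducible U -> scalar_commutant U) ->
  mx_irreducible V -> scalar_commutant V.
Proof.
move=> bP spanb invJ scH irrV; have [U [B [irrU fB hB]]] := irr_sub_rep irrV.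
have scU := scH U irrU; have [U0 _] := (mx_irrP _).1 irrU.
pose i : 'I_(rdegree U) := Ordinal U0; have [e eE] := munit_gop i i.
apply: (scalar_commutant_corner k0 bP spanb (e := e)) => //; rewrite -?eE.
- exact: (munit_neq0 irrU scU fB hB).
- by rewrite (munitM irrU scU) eqxx scale1r.
by move=> x y; apply: (munit_corner_comm irrU scU invJ).
Qed.
End MatrixUnits.

(** * Irreducible representations of symmetric groups *)

Section PermConj.
Variable T : finType.
Implicit Types s t : {perm T}.

(* On each orbit, with base point [r], the conjugating permutation sends      *)
(* [s^i r] to [t^i r]; choosing [x0] as a base point makes it fix [x0].       *)
Lemma porbit_conj s t (x0 : T) : (forall x, porbit s x = porbit t x) ->
  exists h : {perm T}, h x0 = x0 /\ (s ^ h = t)%g.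
Proof.
move=> st.
pose r x := if x \in porbit s x0 then x0 else odflt x [pick y in porbit s x].
have rP x : r x \in porbit s x.
  rewrite /r; case: ifP => [|_]; first by rewrite porbit_sym.
  by case: pickP => [y|] //= _; apply: porbit_id.
have r_eq x y : x \in porbit s y -> r x = r y.
  move=> xy; have E : porbit s x = porbit s y by apply/eqP; rewrite eq_porbit_mem.
  rewrite /r ![_ \in porbit s x0]porbit_sym -!eq_porbit_mem E; case: ifP => // _.
  by case: pickP => // /(_ y); rewrite porbit_id.
pose n x := #|porbit s (r x)|.
pose i x := index x (traject s (r x) (n x)).
have xtr x : x \in traject s (r x) (n x) by rewrite -porbit_traject porbit_sym rP.
have i_lt x : (i x < n x)%N by rewrite -(size_traject s (r x) (n x)) index_mem.
have iP x : iter (i x) s (r x) = x.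
  by rewrite -(nth_traject s (i_lt x)) nth_index.
pose h x := iter (i x) t (r x).
have hr x : r (h x) = r x.
  have tr : h x \in porbit s (r x).
    rewrite st /h -permX; exact: mem_porbit.
  by rewrite (r_eq _ _ tr) (r_eq _ _ (rP x)).
have itr x m : (m < n x)%N -> nth x (traject t (r x) (n x)) m = iter m t (r x).
  by move=> mn; rewrite (set_nth_default (r x)) ?size_traject // nth_traject.
have h_inj : injective h.
  move=> x y hxy; have rxy : r x = r y by rewrite -hr hxy hr.
  have nxy : n x = n y by rewrite /n rxy.
  suff ixy : i x = i y by rewrite -(iP x) ixy rxy iP.
  have U : uniq (traject t (r x) (n x)) by rewrite /n st uniq_traject_porbit.
  have iy : (i y < n x)%N by rewrite nxy.
  apply/eqP; rewrite -(nth_uniq x _ _ U) ?size_traject // !itr //.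
  by rewrite -/(h x) hxy /h rxy.
exists (perm h_inj); rewrite permE; split.
  have r0 : r x0 = x0 by rewrite /r porbit_id.
  rewrite /h /i r0; have := i_lt x0; rewrite /i r0 /n r0.
  by case: #|_| => // m _ /=; rewrite eqxx.
apply/permP => y; rewrite conjgE !permM -{2}(permKV (perm h_inj) y).
move: ((perm h_inj)^-1%g y) => x; rewrite !permE.
have rs : r (s x) = r x by apply: r_eq; rewrite -{1}[s]expg1 mem_porbit.
have ns : n (s x) = n x by rewrite /n rs.
have sx : s x = iter (i x).+1 s (r x) by rewrite iterS iP.
have Us : uniq (traject s (r x) (n x)) by rewrite uniq_traject_porbit.
rewrite /h rs -iterS.
(* Before the end of the cycle the index goes up by one; at its last point both [s] and [t] return
   to the base point. *)
have [lt|] := ltnP (i x).+1 (n x).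
  suff -> : i (s x) = (i x).+1 by [].
  by rewrite /i rs ns sx -(nth_traject s lt) index_uniq ?size_traject.
rewrite leq_eqVlt ltnNge i_lt orbF => /eqP En.
have sxr : s x = r x by rewrite sx -En iter_porbit.
have -> : i (s x) = 0%N.
  by rewrite /i rs ns sxr; case: (n x) (i_lt x) => // m _ /=; rewrite eqxx.
by rewrite -En /n st iter_porbit.
Qed.

(** A power prime to the order generates the same cyclic group, so it has the same orbits. *)
Lemma perm_expJ s m : coprime #[s] m -> exists h, (s ^+ m = s ^ h)%g.
Proof.
move=> co; have gs : <[s]>%g = <[s ^+ m]>%g.
  by apply/eqP; rewrite -[_ == _]/(generator <[s]> (s ^+ m)) generator_coprime.
have [x0|T0] := pickP T; last first.
  by exists 1%g; apply/permP => x; have := T0 x.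
have [x|h [_ sh]] := @porbit_conj s (s ^+ m)%g x0; last by exists h.
by rewrite porbit.unlock -gs.
Qed.

Lemma perm_invJ s (x0 : T) : exists h : {perm T}, h x0 = x0 /\ (s^-1 = s ^ h)%g.
Proof.
have [x|h [h0 sh]] := @porbit_conj s s^-1%g x0; first by rewrite porbitV.
by exists h.
Qed.
End PermConj.

(** * Induction from S_n to S_(n+1) *)

Section SymSplit.
Variables (k : fieldType) (k0 : [pchar k] =i pred0).

Definition fix_last n (s : 'S_n) : 'S_n.+1 := lift_perm ord_max ord_max s.

Fact fix_lastM n : {in [set: 'S_n] &, {morph @fix_last n : x y / (x * y)%g}}.
Proof. by move=> x y _ _; rewrite /fix_last lift_permM. Qed.
Canonical fix_last_morphism n := Morphism (@fix_lastM n).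

Lemma fix_last_ex n (h : 'S_n.+1) : h ord_max = ord_max -> exists s, h = fix_last s.
Proof.
move=> hm.
have hl j : exists i, h (lift ord_max j) = lift ord_max i.
  case: (unliftP ord_max (h (lift ord_max j))) => [i E|E]; first by exists i.
  have := perm_inj (etrans E (esym hm)) => /eqP.
  by rewrite eq_sym (negPf (neq_lift _ _)).
have [g gP] := choice hl.
have g_inj : injective g.
  move=> i j gij; apply: (@lift_inj _ ord_max); apply: (@perm_inj _ h).
  by rewrite !gP gij.
exists (perm g_inj); apply/permP => i; rewrite /fix_last.
case: (unliftP ord_max i) => [j ->|->].
  by rewrite lift_perm_lift permE gP.
by rewrite lift_perm_id.
Qed.

(** Induction along the stabilizer of the last point: [perm_invJ] conjugates a permutation to its
    inverse by an element of that stabilizer, as [scalar_commutant_ext] demands. For S_0 the whole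
    enveloping algebra is scalar, so the identity serves as corner idempotent. *)
Lemma sym_scalar_commutant n (V : rep k 'S_n) : mx_irreducible V -> scalar_commutant V.
Proof.
have [I [b bP]] := exists_irr_system k0 'S_n.
have spanb := class_function_span k0 (@perm_expJ _) bP.
elim: n V I b bP spanb => [|n IH] V I b bP spanb irrV.
  have one (g : 'S_0) : g = 1%g by apply/permP => -[].
  have [V0 _] := (mx_irrP _).1 irrV.
  pose e := fun x : 'S_0 => (x == 1%g)%:R : k.
  have e1 : gop V e = 1%:M by rewrite -gopV repr_mx1.
  apply: (scalar_commutant_corner k0 bP spanb (e := e)); rewrite // e1 ?mulmx1 //.
    by rewrite -mxrank_eq0 mxrank1 -lt0n.
  have sc a : gop V a = (a 1%g)%:M.
    rewrite /gop (big_pred1 1%g) => [|g]; first by rewrite repr_mx1 scalemx1.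
    by rewrite [g]one; apply/esym/eqP.
  by move=> x y; rewrite !mul1mx !sc !mulmx1 -!scalar_mxM mulrC.
have [I' [b' bP']] := exists_irr_system k0 'S_n.
have {}IH (U : rep k 'S_n) : mx_irreducible U -> scalar_commutant U.
  exact: IH (class_function_span k0 (@perm_expJ _) bP').
apply: (scalar_commutant_ext (f := fix_last_morphism n) k0 bP spanb _ IH irrV) => g.
have [h [hm gh]] := perm_invJ g ord_max.
by have [s hs] := fix_last_ex hm; exists s; rewrite gh hs.
Qed.
End SymSplit.

(** * Outer tensor products *)

Section TensorEntries.
Variable k : fieldType.

(** It follows the recursion of [tprod], so that entries of a Kronecker product can be addressed by
    pairs of indices. *)
Fixpoint tidx m1 m2 : 'I_m1 -> 'I_m2 -> 'I_(m1 * m2) :=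
  if m1 is m'.+1 return 'I_m1 -> 'I_m2 -> 'I_(m1 * m2) then
    fun i1 i2 => match split (i1 : 'I_(1 + m')) with
    | inl _ => lshift (m' * m2) i2
    | inr i => rshift m2 (tidx i i2)
    end
  else fun i1 _ => False_rect _ (notF (ltn_ord i1)).

Lemma tidx_surj m1 m2 (l : 'I_(m1 * m2)) : exists i1 i2, l = tidx i1 i2.
Proof.
elim: m1 l => [[] //|m1 IH] /= l.
case: (split_ordP (l : 'I_(m2 + m1 * m2))) => j ->.
  exists (lshift m1 ord0 : 'I_(1 + m1)), j.
  by rewrite (unsplitK (inl _)).
have [i1 [i2 ->]] := IH j; exists (rshift 1 i1 : 'I_(1 + m1)), i2.
by rewrite (unsplitK (inr _)).
Qed.

Lemma trowE n1 (A : 'rV[k]_n1) m2 n2 (B : 'M[k]_(m2, n2)) i j1 j2 :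
  trow A B i (tidx j1 j2) = A 0 j1 * B i j2.
Proof.
elim: n1 A j1 => [A []//|n1 IH] /= A j1.
case: (split_ordP (j1 : 'I_(1 + n1))) => j ->.
  by rewrite row_mxEl !mxE [j]ord1.
by rewrite row_mxEr IH !mxE.
Qed.

Lemma tprod_tidx m1 n1 (A : 'M[k]_(m1, n1)) m2 n2 (B : 'M[k]_(m2, n2)) i1 i2 j1 j2 :
  tprod A B (tidx i1 i2) (tidx j1 j2) = A i1 j1 * B i2 j2.
Proof.
elim: m1 n1 A i1 j1 => [n1 A []//|m1 IH] n1 A i1 j1 /=.
case: (split_ordP (i1 : 'I_(1 + m1))) => i ->.
  by rewrite col_mxEu trowE !mxE [i]ord1.
by rewrite col_mxEd IH !mxE.
Qed.

Lemma tprod_lincomb m1 n1 m2 n2 (I J : finType) (a : I -> k) (a' : J -> k)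
    (A : I -> 'M[k]_(m1, n1)) (B : J -> 'M[k]_(m2, n2)) :
  tprod (\sum_i a i *: A i) (\sum_j a' j *: B j) =
  \sum_ij (a ij.1 * a' ij.2) *: tprod (A ij.1) (B ij.2).
Proof.
apply/matrixP => l l'; have [i1 [i2 ->]] := tidx_surj l.
have [j1 [j2 ->]] := tidx_surj l'; rewrite tprod_tidx !summxE.
rewrite big_distrlr pair_big /=; apply: eq_bigr => -[i j] _ /=.
by rewrite !mxE tprod_tidx mulrACA.
Qed.
End TensorEntries.

(** Burnside's theorem: scalar commutant means absolutely irreducible, hence the enveloping algebra
    is the full matrix algebra. *)
Lemma scalar_commutant_full (k : fieldType) (gT : finGroupType) (V : rep k gT) :
    mx_irreducible V -> scalar_commutant V ->
  forall A : 'M_(rdegree V), exists a, A = \sum_g a g *: V g.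
Proof.
move=> irrV scV A.
have : mx_absolutely_irreducible V.
  apply: cent_mx_scalar_abs_irr => //.
  apply: leq_trans (mxrankS (_ : _ <= mxvec (1%:M : 'M[k]_(rdegree V)))%MS) (rank_leq_row _).
  apply/memmx_subP => C; rewrite memmx_cent_envelop => /centgmxP cC.
  have /is_scalar_mxP[a ->] : is_scalar_mx C by apply: scV => g; rewrite cC ?inE.
  by rewrite -[a%:M]scalemx1 linearZ; exact: scalemx_sub (submx_refl _).
case/mx_abs_irrP => _ [a aP]; exists (a^~ A); rewrite {1}[A]aP.
by apply: eq_bigl => g; rewrite inE.
Qed.

Section OuterIrr.
Variables (k : fieldType) (gT hT : finGroupType).

Lemma chi_outer (V : rep k gT) (W : rep k hT) x :
  chi (outer V W) x = chi V x.1 * chi W x.2.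
Proof. exact: mxtrace_prod. Qed.

(** By fullness in each factor, an invariant subspace is stable under all [tprod A B]. Elementary
    matrices then move one nonzero entry to every basis vector. *)
Lemma outer_irr (V : rep k gT) (W : rep k hT) :
    mx_irreducible V -> scalar_commutant V -> mx_irreducible W -> scalar_commutant W ->
  mx_irreducible (outer V W).
Proof.
move=> irrV scV irrW scW; apply/mx_irrP; split.
  by rewrite muln_gt0 ((mx_irrP _).1 irrV).1 ((mx_irrP _).1 irrW).1.
move=> U modU nzU.
have Ut A B : (U *m tprod A B <= U)%MS.
  have [a ->] := scalar_commutant_full irrV scV A.
  have [a' ->] := scalar_commutant_full irrW scW B.
  rewrite tprod_lincomb mulmx_sumr summx_sub // => x _.
  rewrite -scalemxAr scalemx_sub //.
  exact: (mxmoduleP modU x (in_setT _)).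
have [r [l nzrl]] : exists r l, U r l != 0.
  apply: contrapT => nU; case/eqP: nzU; apply/matrixP => r l; rewrite mxE.
  by apply: contrapT => /eqP Url; case: nU; exists r, l.
have [i1 [i2 El]] := tidx_surj l; rewrite {l}El in nzrl.
rewrite -sub1mx; apply/row_subP => l; have [j1 [j2 ->]] := tidx_surj l.
apply: submx_trans (Ut (delta_mx i1 j1) (delta_mx i2 j2)).
suff <- : (U r (tidx i1 i2))^-1 *: row r (U *m tprod (delta_mx i1 j1) (delta_mx i2 j2)) =
    row (tidx j1 j2) 1%:M by rewrite scalemx_sub ?row_sub.
apply/rowP => l'; have [m1 [m2 ->]] := tidx_surj l'.
rewrite [RHS]mxE -tprod1 tprod_tidx [LHS]mxE [X in _ * X]mxE [X in _ * X]mxE.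
rewrite (bigD1 (tidx i1 i2)) //= [X in _ + X]big1 => [|s].
  by rewrite tprod_tidx addr0 mulKf // !mxE !eqxx /= [_ == j1]eq_sym [_ == j2]eq_sym.
have [s1 [s2 ->]] := tidx_surj s; move=> ns; rewrite tprod_tidx !mxE.
have [e1|_] := eqVneq s1 i1; last by rewrite mul0r mulr0.
have [e2|_] := eqVneq s2 i2; last by rewrite !mulr0.
by rewrite e1 e2 eqxx in ns.
Qed.
End OuterIrr.

Lemma conj_pair (gT hT : finGroupType) (x z : gT) (y w : hT) :
  ((x, y) ^ (z, w) = (x ^ z, y ^ w))%g.
Proof. by rewrite !conjgE. Qed.

(** * Irreducible characters of a product group *)

Section ProductBasis.
Variables (k : fieldType) (k0 : [pchar k] =i pred0) (gT hT : finGroupType).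
Variables (I J : finType) (b : I -> rep k gT) (b' : J -> rep k hT).
Hypotheses (bP : irr_system b) (bP' : irr_system b').
Hypothesis spanb : forall f, class_function f -> chi_span b f.
Hypothesis spanb' : forall f, class_function f -> chi_span b' f.
Hypothesis scb : forall i, scalar_commutant (b i).
Hypothesis scb' : forall j, scalar_commutant (b' j).

Lemma chi_outer_free (c : I * J -> k) :
  (forall x y, \sum_ij c ij * (chi (b ij.1) x * chi (b' ij.2) y) = 0) ->
  forall ij, c ij = 0.
Proof.
move=> c0 [i j]; move: j; apply: (irr_chi_free k0 bP' (c := fun j => c (i, j))) => y.
move: i; apply: (irr_chi_free k0 bP) => x; rewrite -[RHS](c0 x y).
under eq_bigr => i _ do rewrite mulr_suml.
by rewrite pair_big; apply: eq_bigr => -[i j] _ /=; rewrite -mulrA [chi _ y * _]mulrC.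
Qed.

(** Expand in the first variable with the second one fixed; independence of the characters makes the
    coefficients class functions of the second variable. *)
Lemma chi_outer_span (f : gT * hT -> k) : class_function f ->
  exists a, forall x, f x = \sum_ij a ij * (chi (b ij.1) x.1 * chi (b' ij.2) x.2).
Proof.
move=> fJ.
have ex y : exists c : I -> k, forall x, f (x, y) = \sum_i c i * chi (b i) x.
  by apply: spanb => x z; rewrite -(fJ (x, y) (z, 1%g)) conj_pair conjg1.
have [c cP] := choice ex.
have cJ i : class_function (c^~ i).
  move=> y z; apply/eqP; rewrite -subr_eq0; apply/eqP; move: i.
  apply: (irr_chi_free k0 bP) => x.
  under eq_bigr => i _ do rewrite mulrBl.
  rewrite sumrB -!cP -(fJ (x, y) (1%g, z)); apply/eqP; rewrite subr_eq0; apply/eqP.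
  by rewrite conj_pair conjg1.
have [a aP'] := choice (fun i => spanb' (cJ i)).
have aP i y : c y i = \sum_j a i j * chi (b' j) y by exact: aP'.
exists (fun ij => a ij.1 ij.2) => -[x y] /=; rewrite cP.
under [LHS]eq_bigr => i _ do rewrite aP mulr_suml.
by rewrite pair_big; apply: eq_bigr => -[i j] _ /=; rewrite -mulrA [chi _ y * _]mulrC.
Qed.

(** Outer products are irreducible and their characters span the class functions. An irreducible
    character different from all of them would be a combination of other irreducible characters,
    against independence. *)
Lemma irr_outer (X : rep k (gT * hT)%type) :
  mx_irreducible X -> exists ij, forall x, chi X x = chi (b ij.1) x.1 * chi (b' ij.2) x.2.
Proof.
move=> irrX; apply: contrapT => nX.
have [irrb _ _ _] := bP; have [irrb' _ _ _] := bP'.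
have [L [c cP]] := exists_irr_system k0 (gT * hT)%type.
have [_ _ isoc _] := cP; have [l Xl] := isoc X irrX.
have chiX x : chi X x = chi (c l) x by apply: chi_rsim.
have ex ij : exists m, forall x, chi (b ij.1) x.1 * chi (b' ij.2) x.2 = chi (c m) x.
  have [m om] := isoc _ (outer_irr (irrb ij.1) (@scb _) (irrb' ij.2) (@scb' _)).
  by exists m => x; rewrite -chi_outer; apply: chi_rsim.
have [m mP] := choice ex.
have ml ij : m ij != l.
  by apply/eqP => E; case: nX; exists ij => x; rewrite mP E chiX.
have [a aP] := @chi_outer_span (chi (c l)) (@chiJ _ _ _).
pose d l' : k := (l' == l)%:R - \sum_(ij | m ij == l') a ij.
have : d l = 0.
  apply: (irr_chi_free k0 cP) => x.
  under eq_bigr => l' _ do rewrite mulrBl.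
  rewrite sumrB (bigD1 l) //= eqxx mul1r [X in _ + X - _]big1 => [|l' /negPf->]; last by rewrite mul0r.
  rewrite addr0 aP (partition_big m xpredT) //= -sumrB big1 // => l' _.
  rewrite mulr_suml -sumrB big1 // => ij /eqP <-.
  by rewrite mP subrr.
move/eqP; rewrite /d eqxx big1 ?subr0 ?oner_eq0 // => ij /eqP E.
by have := ml ij; rewrite E eqxx.
Qed.

Lemma outer_coef (X : rep k (gT * hT)%type) : exists m : I * J -> nat,
  forall x, chi X x = \sum_ij (m ij)%:R * (chi (b ij.1) x.1 * chi (b' ij.2) x.2).
Proof.
have [L [c cP]] := exists_irr_system k0 (gT * hT)%type.
have [irrc _ _ decc] := cP; have [n [_ nP]] := decc X.
have [o oP] := choice (fun l => irr_outer (irrc l)).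
exists (fun ij => \sum_(l | o l == ij) n l)%N => x.
rewrite nP (partition_big o xpredT) //=; apply: eq_bigr => ij _.
by rewrite natr_sum mulr_suml; apply: eq_bigr => l /eqP <-; rewrite -oP mulr_natl.
Qed.

Lemma eq_outer_coef (m m' : I * J -> nat) :
  (forall x, \sum_ij (m ij)%:R * (chi (b ij.1) x.1 * chi (b' ij.2) x.2) =
             \sum_ij (m' ij)%:R * (chi (b ij.1) x.1 * chi (b' ij.2) x.2) :> k) ->
  m =1 m'.
Proof.
move=> mm' ij; apply: (natr_inj_char0 k0); apply/eqP; rewrite -subr_eq0; apply/eqP.
move: ij; apply: chi_outer_free => x y.
under eq_bigr => ij _ do rewrite mulrBl.
by rewrite sumrB (mm' (x, y)) subrr.
Qed.
End ProductBasis.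

(** * Linear maps out of presented modules *)

Section LinearMaps.
Variables (R : comNzRingType).

Section One.
Variables (M N : lmodType R) (f : M -> N).
Hypothesis lf : linear f.

Lemma lin0 : f 0 = 0.
Proof. by have := lf (-1) 0 0; rewrite !scaleN1r addr0 addNr oppr0. Qed.

Lemma linD x y : f (x + y) = f x + f y.
Proof. by have := lf 1 x y; rewrite !scale1r. Qed.

Lemma linZ a x : f (a *: x) = a *: f x.
Proof. by have := lf a x 0; rewrite lin0 !addr0. Qed.

Lemma linMn x n : f (x *+ n) = f x *+ n.
Proof. by elim: n => [|n IH]; rewrite ?lin0 // !mulrS linD IH. Qed.

Lemma lin_sum (J : Type) (r : seq J) (P : pred J) (F : J -> M) :
  f (\sum_(j <- r | P j) F j) = \sum_(j <- r | P j) f (F j).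
Proof. exact: (big_morph f linD lin0). Qed.
End One.

Lemma linear_comp (M N P : lmodType R) (f : M -> N) (g : N -> P) :
  linear f -> linear g -> linear (g \o f).
Proof. by move=> lf lg a x y /=; rewrite lf lg. Qed.

Lemma linear_id (M : lmodType R) : linear (@id M).
Proof. by []. Qed.

Lemma linear_sum_fun (M N : lmodType R) (J : Type) (r : seq J) (F : J -> M -> N) :
  (forall j, linear (F j)) -> linear (fun x => \sum_(j <- r) F j x).
Proof.
move=> lF a x y; elim: r => [|j r IH]; first by rewrite !big_nil scaler0 addr0.
by rewrite !big_cons IH lF scalerDr addrACA.
Qed.

Section Tensors.
Variables M N : lmodType R.

Lemma tensDl (x x' : M) (y : N) : tens (x + x') y = tens x y + tens x' y.
Proof. exact: (linD ((tens_bilinear M N).1 y)). Qed.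
Lemma tensDr (x : M) (y y' : N) : tens x (y + y') = tens x y + tens x y'.
Proof. exact: (linD ((tens_bilinear M N).2 x)). Qed.
Lemma tensZl a (x : M) (y : N) : tens (a *: x) y = a *: tens x y.
Proof. exact: (linZ ((tens_bilinear M N).1 y)). Qed.
Lemma tensZr a (x : M) (y : N) : tens x (a *: y) = a *: tens x y.
Proof. exact: (linZ ((tens_bilinear M N).2 x)). Qed.

Lemma tensor_ind (P : tensor M N -> Prop) :
  P 0 -> (forall x y t, P t -> P (tens x y + t)) -> forall t, P t.
Proof.
move=> P0 PS; apply: presented_ind => // a [x y] t Pt.
by rewrite -[_ *: _]/(a *: tens x y) -tensZl; apply: PS.
Qed.

Lemma tensor_ext (P : lmodType R) (f g : tensor M N -> P) :
  linear f -> linear g -> (forall x y, f (tens x y) = g (tens x y)) -> f =1 g.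
Proof.
move=> lf lg fg; elim/tensor_ind => [|x y t IH]; first by rewrite !lin0.
by rewrite !linD // fg IH.
Qed.
End Tensors.

Section TensorMaps.
Variables M M' N N' : lmodType R.

Lemma tmap_bilinear (f : M -> M') (g : N -> N') : linear f -> linear g ->
  bilinear_map (fun x y => tens (f x) (g y)).
Proof.
move=> lf lg; split=> [y a x x'|x a y y'].
  by rewrite lf tensDl tensZl.
by rewrite lg tensDr tensZr.
Qed.

Lemma tmap_linear (f : M -> M') (g : N -> N') : linear f -> linear g -> linear (tmap f g).
Proof. by move=> lf lg; apply/tlift_linear/tmap_bilinear. Qed.

Lemma tmap_tens (f : M -> M') (g : N -> N') x y : linear f -> linear g ->
  tmap f g (tens x y) = tens (f x) (g y).
Proof. by move=> lf lg; rewrite /tmap tlift_tens //; apply: tmap_bilinear. Qed.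

Lemma tswap_bilinear : bilinear_map (fun (x : M) (y : N) => tens y x).
Proof.
by split=> [y a x x'|x a y y']; rewrite ?(tensDl, tensDr) ?(tensZl, tensZr).
Qed.

Lemma tassoc_inner_bilinear (P : lmodType R) (z : P) :
  bilinear_map (fun (x : M) (y : N) => tens x (tens y z)).
Proof.
split=> [y a x x'|x a y y']; first by rewrite tensDl tensZl.
by rewrite tensDl tensZl tensDr tensZr.
Qed.

Lemma tassoc_bilinear (P : lmodType R) : bilinear_map
  (fun (t : tensor M N) (z : P) => tlift (fun x y => tens x (tens y z)) t).
Proof.
split=> [z|t a z z']; first exact: tlift_linear (tassoc_inner_bilinear z).
have L (w : P) := tlift_linear (tassoc_inner_bilinear w).
elim/tensor_ind: t => [|x y t IH]; first by rewrite !(lin0 (L _)) scaler0 addr0.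
rewrite !(linD (L _)) IH !tlift_tens; try exact: tassoc_inner_bilinear.
by rewrite !tensDr !tensZr scalerDr addrACA.
Qed.

Lemma tassoc_linear (P : lmodType R) : linear (@tassoc R M N P).
Proof. exact/tlift_linear/tassoc_bilinear. Qed.

Lemma tassoc_tens (P : lmodType R) (x : M) (y : N) (z : P) :
  tassoc (tens (tens x y) z) = tens x (tens y z).
Proof.
rewrite /tassoc tlift_tens; last exact: tassoc_bilinear.
by rewrite tlift_tens //; apply: tassoc_inner_bilinear.
Qed.
End TensorMaps.

Lemma fglift_fgen (S : Type) (M : lmodType R) (f : S -> M) (s : S) :
  fglift (f : {classic S} -> M) (fgen R s) = f s.
Proof. by rewrite /fgen liftU scale1r. Qed.

Lemma fglift_fgenZ (S : Type) (M : lmodType R) (f : S -> M) a (s : S) :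
  fglift (f : {classic S} -> M) (a *: fgen R s) = a *: f s.
Proof.
have -> : a *: fgen R s = << a *g (s : {classic S}) >>.
  by apply/eqP/freeg_eqP => t; rewrite coeffZ !coeffU mul1r.
by rewrite liftU.
Qed.

Section DirectSums.
Variables (T : nat -> lmodType R) (M : lmodType R).

Lemma dsum_ind (P : dsum T -> Prop) :
  P 0 -> (forall n x t, P t -> P (dinj T n x + t)) -> forall t, P t.
Proof.
move=> P0 PS; apply: presented_ind => // a [n x] t Pt.
rewrite -[_ *: _]/(a *: dinj T n x) -(linZ (@dinj_linear _ T n)); exact: PS.
Qed.

Definition dlift (f : forall n, T n -> M) : dsum T -> M :=
  plift (fun s : {n : nat & T n} => f (projT1 s) (projT2 s)).

Variable f : forall n, T n -> M.
Hypothesis lf : forall n, linear (@f n).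

Fact dlift_rel y : dsum_rel y ->
  fglift ((fun s : {n : nat & T n} => f (projT2 s)) : {classic {n : nat & T n}} -> M) y = 0.
Proof.
case=> n a u v; rewrite raddfB raddfD /= fglift_fgenZ !fglift_fgen /=.
by rewrite lf subrr.
Qed.

Lemma dlift_linear : linear (dlift f).
Proof. exact: plift_linear dlift_rel. Qed.

Lemma dlift_dinj n x : dlift f (dinj T n x) = f x.
Proof. exact: (plift_gen dlift_rel (existT T n x)). Qed.

End DirectSums.

Section GrothLift.
Variables (k : fieldType) (gT : finGroupType) (M : lmodType R).

Lemma groth_ind (P : groth R k gT -> Prop) :
  P 0 -> (forall a V t, P t -> P (a *: cls R V + t)) -> forall t, P t.
Proof. exact: presented_ind. Qed.

Definition glift (f : rep k gT -> M) : groth R k gT -> M := plift f.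

Variable f : rep k gT -> M.
Hypothesis fD : forall V U W : rep k gT, mx_rsim V (dadd_grepr U W) -> f V = f U + f W.

Fact glift_rel y : groth_rel y -> fglift (f : {classic rep k gT} -> M) y = 0.
Proof.
by case=> V U W VUW; rewrite raddfB raddfD /= !fglift_fgen (fD VUW) subrr.
Qed.

Lemma glift_linear : linear (glift f).
Proof. exact: plift_linear glift_rel. Qed.

Lemma glift_cls V : glift f (cls R V) = f V.
Proof. exact: plift_gen glift_rel V. Qed.

End GrothLift.

Lemma groth_ext (k : fieldType) (gT : finGroupType) (M : lmodType R) (f g : groth R k gT -> M) :
  linear f -> linear g -> (forall V, f (cls R V) = g (cls R V)) -> f =1 g.
Proof.
move=> lf lg fg; elim/groth_ind => [|a V t IH]; first by rewrite !lin0.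
by rewrite lf lg fg IH.
Qed.

Lemma dsum_ext (T : nat -> lmodType R) (M : lmodType R) (f g : dsum T -> M) :
  linear f -> linear g -> (forall n x, f (dinj T n x) = g (dinj T n x)) -> f =1 g.
Proof.
move=> lf lg fg; elim/dsum_ind => [|n x t IH]; first by rewrite !lin0.
by rewrite !linD // fg IH.
Qed.

End LinearMaps.

(** * Evaluation of class functions on finite permutations *)

Section Average.
Variables (k : fieldType) (k0 : [pchar k] =i pred0) (D T : finType).
Implicit Types (Phi : {ffun D -> T} -> k) (a : {ffun D -> T}) (A : {set T}).

Definition precomp a (s : {perm D}) : {ffun D -> T} := [ffun i => a (s i)].

Lemma precompK s : cancel (precomp^~ s) (precomp^~ s^-1%g).
Proof. by move=> a; apply/ffunP => i; rewrite !ffunE permKV. Qed.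

Lemma precompKV s : cancel (precomp^~ s^-1%g) (precomp^~ s).
Proof. by move=> a; apply/ffunP => i; rewrite !ffunE permK. Qed.

Lemma precomp_inj a s : injective a -> injective (precomp a s).
Proof. by move=> ia i j; rewrite !ffunE => /ia/perm_inj. Qed.

Lemma precomp_injb a s : injectiveb (precomp a s) = injectiveb a.
Proof.
apply/injectiveP/injectiveP => [h|]; last exact: precomp_inj.
by rewrite -[a](precompK s); apply: precomp_inj.
Qed.

Lemma imset_precomp a s : precomp a s @: [set: D] = a @: [set: D].
Proof.
apply/setP => x; apply/imsetP/imsetP => -[i _ ->].
  by exists (s i); rewrite ?ffunE.
by exists (s^-1%g i); rewrite ?ffunE ?permKV.
Qed.

(** An injection is a subset of [T] labelled by [D]. The factor makes each subset count once when
    [Phi] does not depend on the labelling; see [setavgE]. *)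
Definition avg Phi : k := #|D|`!%:R^-1 * \sum_(a : {ffun D -> T} | injectiveb a) Phi a.

Definition setavg Phi A : k :=
  #|D|`!%:R^-1 * \sum_(a : {ffun D -> T} | injectiveb a && (a @: [set: D] == A)) Phi a.

Lemma avg_set Phi : avg Phi = \sum_A setavg Phi A.
Proof.
rewrite /avg (partition_big (fun a : {ffun D -> T} => a @: [set: D]) xpredT) //= mulr_sumr.
by apply: eq_bigr.
Qed.

Lemma setavg0 Phi A : #|A| != #|D| -> setavg Phi A = 0.
Proof.
move=> nA; rewrite /setavg big_pred0 ?mulr0 // => a.
apply/andP => -[/injectiveP ia /eqP E]; case/negP: nA.
by rewrite -E card_imset // cardsT.
Qed.

Lemma same_image a a' : injective a -> injective a' -> a @: [set: D] = a' @: [set: D] ->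
  exists s, a = precomp a' s.
Proof.
move=> ia ia' E.
have ex i : exists j, a i = a' j.
  have : a i \in a' @: [set: D] by rewrite -E imset_f.
  by case/imsetP => j _ ->; exists j.
have [s sP] := choice ex.
have is_ : injective s by move=> i j sij; apply: ia; rewrite !sP sij.
by exists (perm is_); apply/ffunP => i; rewrite !ffunE permE.
Qed.

Lemma card_perm_fact : #|{perm D}| = #|D|`!.
Proof.
rewrite -[in RHS]cardsT -card_perm; apply: eq_card => s; rewrite !inE.
by apply/esym/subsetP => x; rewrite inE.
Qed.

(** Permutations of [D] act simply transitively on the injections with a given image. *)
Lemma sum_same_image Phi a : injective a ->
  \sum_(a' : {ffun D -> T} | injectiveb a' && (a' @: [set: D] == a @: [set: D])) Phi a' =
  \sum_(s : {perm D}) Phi (precomp a s).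
Proof.
move=> ia; have ex (a' : {ffun D -> T}) : exists s : {perm D},
    injectiveb a' && (a' @: [set: D] == a @: [set: D]) -> a' = precomp a s.
  case: (boolP (_ && _)) => [/andP[/injectiveP ia' /eqP E]|_]; last by exists 1%g.
  by have [s ->] := same_image ia' ia E; exists s.
have [h hP] := choice ex.
rewrite (reindex_onto (precomp a) h) => [|a' /hP <-//].
apply: eq_bigl => s; rewrite precomp_injb (introT (injectiveP _) ia) imset_precomp eqxx /=.
apply/eqP/permP => i; apply: (ia).
have /hP : injectiveb (precomp a s) && (precomp a s @: [set: D] == a @: [set: D]).
  by rewrite precomp_injb (introT (injectiveP _) ia) imset_precomp eqxx.
by move/ffunP/(_ i); rewrite !ffunE => ->.
Qed.

Lemma fact_neq0 : #|D|`!%:R != 0 :> k.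
Proof. by apply: (natr_neq0_char0 k0); apply: fact_gt0. Qed.

Lemma setavgE Phi a A : (forall a s, Phi (precomp a s) = Phi a) ->
  injective a -> a @: [set: D] = A -> setavg Phi A = Phi a.
Proof.
move=> PhiJ ia <-; rewrite /setavg sum_same_image // (eq_bigr (fun=> Phi a)) => [|s _] //.
by rewrite sumr_const card_perm_fact -[Phi a *+ _]mulr_natl mulKf // fact_neq0.
Qed.

Lemma image_ex A : #|A| = #|D| -> exists a, injective a /\ a @: [set: D] = A.
Proof.
move=> AD.
pose F (i : D) := enum_val (cast_ord (esym AD) (enum_rank i)).
have iF : injective F by move=> i j /enum_val_inj/cast_ord_inj/enum_rank_inj.
exists (finfun F); split; first by move=> i j; rewrite !ffunE => /iF.
apply/eqP; rewrite eqEcard card_imset; last by move=> i j; rewrite !ffunE => /iF.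
rewrite cardsT AD leqnn andbT; apply/subsetP => x /imsetP[i _ ->].
by rewrite ffunE enum_valP.
Qed.

Lemma avg_reindex Phi s : avg (fun a => Phi (precomp a s)) = avg Phi.
Proof.
rewrite /avg [in RHS](reindex (precomp^~ s)) /=; last first.
  by exists (precomp^~ s^-1%g) => a _; rewrite ?precompK ?precompKV.
by congr (_ * _); apply: eq_bigl => a; rewrite precomp_injb.
Qed.

End Average.

Section Local.
Variables (k : fieldType) (k0 : [pchar k] =i pred0).

(* For injective [a] the sum has at most one term: the permutation induced by *)
(* [g] on the image of [a], if that is g-stable.                              *)
Definition loc (D T : finType) (f : {perm D} -> k) (g : {perm T}) (a : D -> T) : k :=
  \sum_(s : {perm D} | [forall i, g (a i) == a (s i)]) f s.

Definition ev (D T : finType) (f : {perm D} -> k) (g : {perm T}) : k :=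
  avg (fun a : {ffun D -> T} => loc f g a).

Lemma loc_precomp (D T : finType) (f : {perm D} -> k) (g : {perm T}) a s :
  class_function f -> loc f g (precomp a s) = loc f g a.
Proof.
move=> fJ; rewrite /loc [RHS](reindex_inj (conjg_inj s)) /=.
apply: eq_big => [r|r _]; last by rewrite fJ.
apply/forallP/forallP => h i; have := h.
  move/(_ (s^-1%g i)); rewrite !ffunE permKV => /eqP->.
  by rewrite conjgE !permM.
move/(_ (s i)); rewrite !ffunE => /eqP->.
by rewrite conjgE !permM permK.
Qed.

Lemma loc_ext (D T : finType) (f : {perm D} -> k) (g : {perm T}) (a a' : D -> T) :
  a =1 a' -> loc f g a = loc f g a'.
Proof. by move=> aa; apply: eq_bigl => s; apply: eq_forallb => i; rewrite !aa. Qed.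

Lemma ev_transport (D T T' : finType) (f : {perm D} -> k) (g : {perm T}) (g' : {perm T'})
    (h : T -> T') (h' : T' -> T) : cancel h h' -> cancel h' h ->
  (forall x, g' (h x) = h (g x)) -> ev f g' = ev f g.
Proof.
move=> hK hK' gh; rewrite /ev /avg; congr (_ * _).
rewrite (reindex (fun a : {ffun D -> T} => [ffun i => h (a i)])) /=; last first.
  exists (fun a : {ffun D -> T'} => [ffun i => h' (a i)]) => a _;
    by apply/ffunP => i; rewrite !ffunE ?hK ?hK'.
apply: eq_big => [a|a _].
  apply/injectiveP/injectiveP => ia i j.
    by move=> aij; apply: ia; rewrite !ffunE aij.
  by rewrite !ffunE => /(can_inj hK)/ia.
rewrite /loc; apply: eq_bigl => s; apply: eq_forallb => i.
by rewrite !ffunE gh (can_eq hK).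
Qed.

Lemma ev_card_lt (D T : finType) (f : {perm D} -> k) (g : {perm T}) :
  (#|T| < #|D|)%N -> ev f g = 0.
Proof.
move=> lt; rewrite /ev /avg big_pred0 ?mulr0 // => a.
by apply/injectiveP => /leq_card; rewrite leqNgt lt.
Qed.

(** Only the full subset has [#|D|] elements. With [ev_card_lt], this is the unitriangularity of
    evaluation. *)
Lemma ev_self (D : finType) (f : {perm D} -> k) (g : {perm D}) :
  class_function f -> ev f g = f g.
Proof.
move=> fJ; pose i0 : {ffun D -> D} := [ffun i => i].
have ii : injective i0 by move=> i j; rewrite !ffunE.
have im : i0 @: [set: D] = [set: D].
  by apply/setP => x; rewrite inE; apply/imsetP; exists x; rewrite ?ffunE.
rewrite /ev avg_set (bigD1 [set: D]) //= [X in _ + X]big1 => [|A nA].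
  rewrite addr0 (setavgE k0 _ ii im) => [|a s]; last exact: loc_precomp.
  rewrite /loc (big_pred1 g) // => s; rewrite /= eq_sym.
  apply/forallP/eqP => [h|-> i]; last by rewrite !ffunE.
  by apply/permP => i; have := h i; rewrite !ffunE => /eqP.
apply: setavg0; apply: contra nA => /eqP cA.
by rewrite eqEcard subsetT cardsT cA leqnn.
Qed.

Lemma ev_empty (D T : finType) (f : {perm D} -> k) (g : {perm T}) :
  #|D| = 0%N -> ev f g = f 1%g.
Proof.
move=> D0; have noD (i : D) : False by have := max_card (pred1 i); rewrite card1 D0.
rewrite /ev /avg D0 invr1 mul1r (big_pred1 (ffun0 D0)) => [|a]; last first.
  rewrite /= (introT (injectiveP _)) => [|i]; last by case: (noD i).
  by apply/esym/eqP/ffunP => i; case: (noD i).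
rewrite /loc (big_pred1 1%g) // => s /=.
have -> : s = 1%g by apply/permP => i; case: (noD i).
by rewrite eqxx; apply/forallP => i; case: (noD i).
Qed.

End Local.

(** * Evaluation on a disjoint sum *)

(** Reindexing along an injection that covers the support, with the inverse obtained by choice. An
    empty [J] is treated apart because choice needs a default value. *)
Lemma reindex_ex (k : nmodType) (I J : finType) (h : J -> I) (P : pred I) (F : I -> k) :
    injective h -> (forall i, P i -> exists j, i = h j) ->
  \sum_(i | P i) F i = \sum_(j | P (h j)) F (h j).
Proof.
move=> ih hP; have [[j0]|noJ] := pselect (inhabited J); last first.
  rewrite !big_pred0 // => [j|i]; first by case: noJ.
  by apply/negP => /hP[j]; case: noJ.
have ex i : exists j, P i -> i = h j.
  by case: (boolP (P i)) => [/hP[j ->]|_]; [exists j|exists j0].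
have [h' h'P] := choice ex.
rewrite (reindex_onto h h') => [|i /h'P <-//].
apply: eq_bigl => j; apply: andb_idr => Pj.
by apply/eqP/ih; rewrite -h'P.
Qed.

Section BlockPerm.
Variables p q : nat.

Lemma block_perm_lshift (s : 'S_p) (t : 'S_q) i :
  block_perm s t (lshift q i) = lshift q (s i).
Proof. by rewrite permE block_fun_lshift. Qed.

Lemma block_perm_rshift (s : 'S_p) (t : 'S_q) i :
  block_perm s t (rshift p i) = rshift p (t i).
Proof. by rewrite permE block_fun_rshift. Qed.

Lemma lrshiftF (i : 'I_p) (j : 'I_q) : lshift q i = rshift p j -> False.
Proof. by move/eqP; rewrite eq_lrshift. Qed.

(** The left block is finite, so being mapped into itself it is mapped onto itself, and the right
    block cannot meet its image. *)
Lemma block_perm_ex (r : 'S_(p + q)) : (forall i, exists j, r (lshift q i) = lshift q j) ->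
  exists s t, r = block_perm s t.
Proof.
move=> /choice[s sP].
have is_ : injective s.
  by move=> i j sij; apply: (@lshift_inj _ q); apply: (@perm_inj _ r); rewrite !sP sij.
have /choice[t tP] : forall j, exists j', r (rshift p j) = rshift p j'.
  move=> j; case: (split_ordP (r (rshift p j))) => [i E|j' E]; last by exists j'.
  have : r (lshift q ((perm is_)^-1%g i)) = r (rshift p j).
    by rewrite sP E -[s _](permE is_) permKV.
  by move/perm_inj/lrshiftF.
have it : injective t.
  by move=> i j tij; apply: (@rshift_inj p); apply: (@perm_inj _ r); rewrite !tP tij.
exists (perm is_), (perm it); apply/permP => i.
case: (split_ordP i) => j ->.
  by rewrite block_perm_lshift permE sP.
by rewrite block_perm_rshift permE tP.
Qed.

Lemma block_perm_ex_r (r : 'S_(p + q)) : (forall i, exists j, r (rshift p i) = rshift p j) ->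
  exists s t, r = block_perm s t.
Proof.
move=> /choice[t tP].
have it : injective t.
  by move=> i j tij; apply: (@rshift_inj p); apply: (@perm_inj _ r); rewrite !tP tij.
apply: block_perm_ex => i; case: (split_ordP (r (lshift q i))) => [j E|j E]; first by exists j.
have : r (rshift p ((perm it)^-1%g j)) = r (lshift q i).
  by rewrite tP E -[t _](permE it) permKV.
by move/perm_inj/esym/lrshiftF.
Qed.
End BlockPerm.

Section SetEv.
Variables (k : fieldType) (k0 : [pchar k] =i pred0).

Definition setev (D T : finType) (f : {perm D} -> k) (g : {perm T}) (A : {set T}) : k :=
  setavg (fun a : {ffun D -> T} => loc f g a) A.

Section Basics.
Variables D T : finType.
Implicit Types (f : {perm D} -> k) (g : {perm T}) (A : {set T}).

Lemma ev_setev f g : ev f g = \sum_A setev f g A.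
Proof. exact: avg_set. Qed.

Lemma setev0 f g A : #|A| != #|D| -> setev f g A = 0.
Proof. exact: setavg0. Qed.

Lemma setevE f g (a : {ffun D -> T}) A : class_function f ->
  injective a -> a @: [set: D] = A -> setev f g A = loc f g a.
Proof.
move=> fJ ia imA; apply: (setavgE k0 (Phi := fun a : {ffun D -> T} => loc f g a)) ia imA.
by move=> a' s; apply: loc_precomp.
Qed.

Lemma eq_setev f f' g A : f =1 f' -> setev f g A = setev f' g A.
Proof.
move=> ff'; rewrite /setev /setavg; congr (_ * _); apply: eq_bigr => a _.
by rewrite /loc; apply: eq_bigr => s _.
Qed.

Lemma eq_ev f f' g : f =1 f' -> ev f g = ev f' g.
Proof. by move=> ff'; rewrite !ev_setev; apply: eq_bigr => A _; apply: eq_setev. Qed.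

Lemma setev_sum (J : Type) (r : seq J) (c : J -> k) (F : J -> {perm D} -> k) g A :
  setev (fun s => \sum_(j <- r) c j * F j s) g A = \sum_(j <- r) c j * setev (F j) g A.
Proof.
rewrite /setev /setavg; under eq_bigr => a _.
  rewrite /loc exchange_big; under eq_bigr => j _ do rewrite -mulr_sumr; over.
rewrite exchange_big mulr_sumr; apply: eq_bigr => j _.
by rewrite -mulr_sumr mulrCA.
Qed.

Lemma setev_sum1 (J : Type) (r : seq J) (F : J -> {perm D} -> k) g A :
  setev (fun s => \sum_(j <- r) F j s) g A = \sum_(j <- r) setev (F j) g A.
Proof.
under [RHS]eq_bigr => j _ do rewrite -[setev _ _ _]mul1r.
by rewrite -setev_sum; apply: eq_setev => s; apply: eq_bigr => j _; rewrite mul1r.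
Qed.

Lemma setev_eq0 f g A : (forall s, f s = 0) -> setev f g A = 0.
Proof.
move=> f0; rewrite /setev /setavg big1 ?mulr0 // => a _.
by rewrite /loc big1 // => s _.
Qed.

Lemma ev_sum (J : Type) (r : seq J) (c : J -> k) (F : J -> {perm D} -> k) g :
  ev (fun s => \sum_(j <- r) c j * F j s) g = \sum_(j <- r) c j * ev (F j) g.
Proof.
rewrite ev_setev; under eq_bigr => A _ do rewrite setev_sum.
rewrite exchange_big; apply: eq_bigr => j _.
by rewrite -mulr_sumr ev_setev.
Qed.
End Basics.

Definition ev2 (D D' T T' : finType) (F : {perm D} * {perm D'} -> k) (g : {perm T}) (h : {perm T'}) : k :=
  ev (fun s => ev (fun t => F (s, t)) h) g.

Section Psum.
Variables T1 T2 : finType.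

Definition psum_fun (g : {perm T1}) (h : {perm T2}) (x : T1 + T2) : T1 + T2 :=
  match x with inl y => inl (g y) | inr z => inr (h z) end.

Fact psum_inj g h : injective (psum_fun g h).
Proof. by case=> [x|x] [y|y] //= [/perm_inj->]. Qed.

Definition psum g h : {perm T1 + T2} := perm (@psum_inj g h).

Lemma psum_inl g h x : psum g h (inl x) = inl (g x).
Proof. by rewrite permE. Qed.
Lemma psum_inr g h x : psum g h (inr x) = inr (h x).
Proof. by rewrite permE. Qed.

Definition usum (A : {set T1} * {set T2}) : {set T1 + T2} :=
  [set x | match x with inl y => y \in A.1 | inr z => z \in A.2 end].

Lemma card_usum A : #|usum A| = (#|A.1| + #|A.2|)%N.
Proof.
rewrite -!sum1_card big_mkcond big_sumType /=; congr (_ + _)%N;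
  by rewrite [RHS]big_mkcond; apply: eq_bigr => x _; rewrite inE.
Qed.

Lemma usum_bij : bijective usum.
Proof.
exists (fun A : {set T1 + T2} => ([set x | inl x \in A], [set x | inr x \in A])) => [[A B]|A].
  by congr (_, _); apply/setP => x; rewrite !inE.
by apply/setP => -[x|x]; rewrite !inE.
Qed.

Variables (g : {perm T1}) (h : {perm T2}).

(** [psum g h] preserves the two summands, so a permutation induced by it through [c] must preserve
    the two blocks of indices. *)
Lemma loc_psum p q (f : 'S_(p + q) -> k) (a : 'I_p -> T1) (b : 'I_q -> T2) (c : 'I_(p + q) -> T1 + T2) :
    injective a -> injective b ->
    (forall i, c (lshift q i) = inl (a i)) -> (forall j, c (rshift p j) = inr (b j)) ->
  loc f (psum g h) c = loc (fun s => loc (fun t => f (block_perm s t)) h b) g a.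
Proof.
move=> ia ib cl cr; rewrite /loc pair_big /=.
rewrite (reindex_ex (h := fun x : 'S_p * 'S_q => block_perm x.1 x.2)) => [||r].
- apply: eq_bigl => -[s t] /=; apply/forallP/andP => [H|[/forallP Ha /forallP Hb] i].
    split; apply/forallP => i.
      have := H (lshift q i); rewrite block_perm_lshift !cl psum_inl => /eqP[->] //.
    by have := H (rshift p i); rewrite block_perm_rshift !cr psum_inr => /eqP[->].
  case: (split_ordP i) => j ->.
    by rewrite block_perm_lshift !cl psum_inl (eqP (Ha j)).
  by rewrite block_perm_rshift !cr psum_inr (eqP (Hb j)).
- by move=> [s t] [s' t'] /block_perm_inj[/= -> ->].
move=> /forallP H; have [i|s [t ->]] := @block_perm_ex p q r; last by exists (s, t).
have := H (lshift q i); rewrite cl psum_inl.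
case: (split_ordP (r (lshift q i))) => j ->; first by exists j.
by rewrite cr => /eqP.
Qed.

Lemma ev2_psum_set n (f : 'S_n -> k) (i : 'I_n.+1) (A : {set T1} * {set T2}) :
    class_function f -> (#|A.1| = i) -> (#|A.2| = n - i)%N ->
  setev f (psum g h) (usum A) =
  setev (fun s => setev (fun t => f (parabolic (split_eq i) (s, t))) h A.2) g A.1.
Proof.
move: (split_eq i); move: (nat_of_ord i) (n - i)%N => {i} p q e.
subst n; move=> fJ cA1 cA2.
have [a [ia imA]] := @image_ex ('I_p : finType) T1 A.1 (etrans cA1 (esym (card_ord p))).
have [b [ib imB]] := @image_ex ('I_q : finType) T2 A.2 (etrans cA2 (esym (card_ord q))).
pose c : {ffun 'I_(p + q) -> T1 + T2} :=
  [ffun i => match split i with inl i => inl (a i) | inr j => inr (b j) end].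
have cl i : c (lshift q i) = inl (a i) by rewrite ffunE (unsplitK (inl i)).
have cr i : c (rshift p i) = inr (b i) by rewrite ffunE (unsplitK (inr i)).
have ic : injective c.
  move=> i j; case: (split_ordP i) => i' ->; case: (split_ordP j) => j' ->;
    by rewrite ?cl ?cr //; case; first [move/ia->|move/ib->].
have imc : c @: [set: 'I_(p + q)] = usum A.
  apply/eqP; rewrite eqEcard card_usum card_imset // cardsT card_ord cA1 cA2 leqnn andbT.
  apply/subsetP => x /imsetP[i _ ->]; case: (split_ordP i) => j ->.
    by rewrite cl inE -imA imset_f.
  by rewrite cr inE -imB imset_f.
have blockJ (s u : 'S_p) (t v : 'S_q) :
    f (block_perm (s ^ u)%g (t ^ v)%g) = f (block_perm s t).
  rewrite -(fJ (block_perm s t) (block_perm u v)); congr f.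
  rewrite !conjgE !block_permM; congr (_ * _)%g.
  apply/eqP; rewrite eq_sym eq_invg_mul -block_permM !mulgV; apply/eqP/permP => i.
  by rewrite perm1; case: (split_ordP i) => j ->; rewrite ?block_perm_lshift ?block_perm_rshift perm1.
have par s t : f (parabolic (erefl (p + q)%N) (s, t)) = f (block_perm s t).
  by rewrite /parabolic cast_perm_id.
rewrite (setevE (psum g h) fJ ic imc) (loc_psum f ia ib cl cr).
have inner s : setev (fun t => f (parabolic (erefl (p + q)%N) (s, t))) h A.2 =
    loc (fun t => f (block_perm s t)) h b.
  rewrite -(setevE h _ ib imB) => [|x y]; last by rewrite -{1}[s]conjg1 blockJ.
  by apply: eq_setev => t; rewrite par.
rewrite (eq_setev _ _ inner) (setevE g _ ia imA) // => x y.
by apply: eq_bigr => t _; rewrite -{1}[t]conjg1 blockJ.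
Qed.

(** A subset of [T1 + T2] with n elements is a pair of subsets, and it contributes only to the index
    [i] equal to the size of the first one. *)
Lemma ev_psum n (f : 'S_n -> k) : class_function f ->
  ev f (psum g h) = \sum_(i < n.+1) ev2 (fun x => f (parabolic (split_eq i) x)) g h.
Proof.
move=> fJ; rewrite ev_setev (reindex usum) /=; last exact/onW_bij/usum_bij.
have ev2E (i : 'I_n.+1) : ev2 (fun x => f (parabolic (split_eq i) x)) g h =
    \sum_A setev (fun s => setev (fun t => f (parabolic (split_eq i) (s, t))) h A.2) g A.1.
  rewrite /ev2 ev_setev -(pair_bigA _ (fun A1 A2 =>
    setev (fun s => setev (fun t => f (parabolic (split_eq i) (s, t))) h A2) g A1)) /=.
  apply: eq_bigr => A1 _; rewrite -setev_sum1.
  by apply: eq_setev => s; rewrite ev_setev.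
under [RHS]eq_bigr => i _ do rewrite ev2E.
rewrite exchange_big; apply: eq_bigr => A _ /=.
pose E (i : 'I_n.+1) := setev (fun s => setev (fun t => f (parabolic (split_eq i) (s, t))) h A.2) g A.1.
rewrite -/(\sum_(i < n.+1) E i).
have E0 (i : 'I_n.+1) : ~ (#|A.1| = i /\ #|A.2| = n - i)%N -> E i = 0.
  move=> ni; have [c1|c1] := eqVneq #|A.1| i; last by rewrite /E setev0 // card_ord.
  rewrite /E setev_eq0 // => s; apply: setev0; rewrite card_ord.
  by apply/eqP => c2; apply: ni.
have [cA|ncA] := eqVneq (#|A.1| + #|A.2|)%N n; last first.
  rewrite setev0 ?card_usum ?card_ord // big1 // => i _; apply: E0 => -[c1 c2].
  by rewrite c1 c2 split_eq eqxx in ncA.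
have lt : (#|A.1| < n.+1)%N by rewrite ltnS -cA leq_addr.
rewrite (bigD1 (Ordinal lt)) //= big1 => [|i ni].
  by rewrite addr0; apply: ev2_psum_set; rewrite //= -cA addKn.
by apply: E0 => -[c1 _]; case/eqP: ni; apply: val_inj; rewrite /= c1.
Qed.
End Psum.
End SetEv.

(** * Evaluation of the smash product *)

Section Smash.
Variables (k : fieldType) (k0 : [pchar k] =i pred0).

Lemma loc_conj (D T : finType) (f : {perm D} -> k) (g : {perm T}) (a : {ffun D -> T}) s :
  loc f g a = loc (fun r => f (r ^ s)%g) g (precomp a s).
Proof.
rewrite /loc (reindex_inj (conjg_inj s)) /=; apply: eq_bigl => r.
apply/forallP/forallP => h i; have := h.
  by move/(_ (s i)); rewrite conjgE !ffunE !permM permK.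
by move/(_ (s^-1%g i)); rewrite conjgE !ffunE !permM permKV.
Qed.

(** The conjugators in the Frobenius formula can be absorbed into the labellings, so they all
    contribute equally and cancel the factorial in [ev]. *)
Lemma ev_ind (hT : finGroupType) (D T : finType) (e : {morphism [set: hT] >-> {perm D}})
    (inje : 'injm e) (W : rep k hT) (g : {perm T}) :
  ev (chi (ind inje W)) g = #|hT|%:R^-1 *
    \sum_(c : {ffun D -> T} | injectiveb c) \sum_(h | [forall i, g (c i) == c (e h i)]) chi W h.
Proof.
pose Psi (u : {perm D}) := \sum_(h | e h == u) chi W h.
(* Conjugating by [x] amounts to relabelling the injections by [x], which leaves the average
   unchanged. *)
have E x : ev (fun r => ind_term e W r x) g = ev Psi g.
  rewrite /ev -[RHS](avg_reindex _ x) /avg; congr (_ * _); apply: eq_bigr => c _.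
  rewrite [RHS](loc_conj _ _ _ x^-1%g) precompK; apply: eq_bigr => r _.
  by rewrite /ind_term conjgE invgK mulgA.
rewrite (eq_ev g (chi_ind k0 inje W)).
transitivity (ev (fun r => \sum_x #|hT|%:R^-1 * ind_term e W r x) g).
  by apply: eq_ev => r; rewrite mulr_sumr.
rewrite ev_sum (eq_bigr (fun=> #|hT|%:R^-1 * ev Psi g)) => [|x _]; last by rewrite E.
rewrite sumr_const card_perm_fact -[_ * ev _ _]/(_ * (_ * _)) -mulrnAr; congr (_ * _).
rewrite -mulr_natl mulVKf ?fact_neq0 //; apply: eq_bigr => c _.
rewrite /loc /Psi; under eq_bigr => r _ do rewrite big_mkcond.
rewrite exchange_big [RHS]big_mkcond; apply: eq_bigr => h _ /=.
rewrite -big_mkcondr /=; case: ifP => [gc|ngc].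
  rewrite (big_pred1 (e h)) // => r /=; rewrite [e h == r]eq_sym.
  by apply: andb_idl => /eqP ->.
rewrite big_pred0 // => r; apply: contraFF ngc => /andP[H /eqP E'].
by rewrite E'.
Qed.

Section Blocks.
Variables a b c : nat.
Local Notation K := ('S_a * 'S_b * 'S_c)%type.

Definition lblock (i : 'I_(a + b)) : 'I_(a + b + c) := lshift c i.
(** The last [b + c] points, as labels for the second factor; they share the middle [b] points with
    [lblock]. *)
Definition rblock (j : 'I_(b + c)) : 'I_(a + b + c) :=
  match split j with inl x => lshift c (rshift a x) | inr y => rshift (a + b) y end.

Lemma rblock_l x : rblock (lshift c x) = lshift c (rshift a x).
Proof. by rewrite /rblock (unsplitK (inl x)). Qed.
Lemma rblock_r y : rblock (rshift b y) = rshift (a + b) y.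
Proof. by rewrite /rblock (unsplitK (inr y)). Qed.

Lemma lblock_inj : injective lblock.
Proof. exact: lshift_inj. Qed.

Lemma rblock_inj : injective rblock.
Proof.
move=> i j; case: (split_ordP i) => i' ->; case: (split_ordP j) => j' ->;
  rewrite ?rblock_l ?rblock_r.
- by move/lshift_inj/rshift_inj->.
- by move/lrshiftF.
- by move/esym/lrshiftF.
by move/rshift_inj->.
Qed.

Lemma bl_cover i : (exists j, i = lblock j) \/ (exists j, i = rblock j).
Proof.
case: (split_ordP i) => j ->; first by left; exists j.
by right; exists (rshift b j); rewrite rblock_r.
Qed.

Definition emb (h : K) : 'S_(a + b + c) := block_perm (block_perm h.1.1 h.1.2) h.2.

Lemma emb_lblock h i : emb h (lblock i) = lblock (block_perm h.1.1 h.1.2 i).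
Proof. exact: block_perm_lshift. Qed.

Lemma emb_rblock h j : emb h (rblock j) = rblock (block_perm h.1.2 h.2 j).
Proof.
rewrite /emb; case: (split_ordP j) => j' ->.
  by rewrite rblock_l !block_perm_lshift block_perm_rshift rblock_l.
by rewrite rblock_r !block_perm_rshift rblock_r.
Qed.

Lemma emb_inj : injective emb.
Proof. by move=> [[x y] z] [[x' y'] z'] /block_perm_inj[/block_perm_inj[/= -> ->] /= ->]. Qed.

Lemma emb_ex (r : 'S_(a + b + c)) : (forall i, exists i', r (lblock i) = lblock i') ->
  (forall j, exists j', r (rblock j) = rblock j') -> exists h, r = emb h.
Proof.
move=> r1 r2; have [s [z rs]] := block_perm_ex r1.
have [j|x [y sxy]] := @block_perm_ex_r a b s.
  have := r2 (lshift c j); rewrite rblock_l rs block_perm_lshift => -[j'].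
  case: (split_ordP j') => j'' ->; rewrite ?rblock_l ?rblock_r.
    by move/lshift_inj => ->; exists j''.
  by move/lrshiftF.
by exists (x, y, z); rewrite rs sxy.
Qed.

Variables (T : finType) (g : {perm T}).

(** Permutations induced by [g] on the two overlapping blocks agree on the overlap, because [w] is
    injective; they glue to a unique element of [K]. *)
Lemma loc_smash (f : 'S_(a + b) -> k) (f' : 'S_(b + c) -> k) (w : 'I_(a + b + c) -> T) :
    injective w ->
  \sum_(h : K | [forall i, g (w i) == w (emb h i)])
     f (block_perm h.1.1 h.1.2) * f' (block_perm h.1.2 h.2) =
  loc f g (w \o lblock) * loc f' g (w \o rblock).
Proof.
move=> iw; rewrite /loc big_distrlr pair_big /=.
rewrite [RHS](reindex_ex
  (h := fun h : K => (block_perm h.1.1 h.1.2, block_perm h.1.2 h.2))) /=.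
- apply: eq_bigl => h /=; apply/forallP/andP => [H|[/forallP H1 /forallP H2] i].
    by split; apply/forallP => i; rewrite (eqP (H _)) ?emb_lblock ?emb_rblock.
  case: (bl_cover i) => -[j ->]; rewrite ?emb_lblock ?emb_rblock; first exact: H1.
  exact: H2.
- by move=> [[x y] z] [[x' y'] z'] [] /block_perm_inj[-> _] /block_perm_inj[-> ->].
move=> [s t] /= /andP[/forallP H1 /forallP H2].
have ex i : exists j, g (w i) = w j.
  by case: (bl_cover i) => -[j ->]; [rewrite (eqP (H1 j))|rewrite (eqP (H2 j))]; eexists.
have [r rP] := choice ex.
have ir : injective r by move=> i j rij; apply: iw; apply: (@perm_inj _ g); rewrite !rP rij.
have r1 i : r (lblock i) = lblock (s i) by apply: iw; rewrite -rP (eqP (H1 i)).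
have r2 i : r (rblock i) = rblock (t i) by apply: iw; rewrite -rP (eqP (H2 i)).
have [i|i|h hr] := @emb_ex (perm ir).
- by exists (s i); rewrite permE r1.
- by exists (t i); rewrite permE r2.
exists h; congr (_, _); apply/permP => i.
  by apply: lblock_inj; rewrite -emb_lblock -hr permE r1.
by apply: rblock_inj; rewrite -emb_rblock -hr permE r2.
Qed.

Lemma imset_bl (w : 'I_(a + b + c) -> T) :
  w @: [set: 'I_(a + b + c)] = (w \o lblock) @: [set: 'I_(a + b)] :|: (w \o rblock) @: [set: 'I_(b + c)].
Proof.
apply/setP => x; rewrite inE; apply/imsetP/orP => [[i _ ->]|].
  by case: (bl_cover i) => -[j ->]; [left|right]; apply/imsetP; exists j.
by case=> /imsetP[j _ ->]; eexists.
Qed.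

(** The cardinalities force the sizes of [A :\: B], [A :&: B] and [B :\: A], which are labelled
    separately. *)
Lemma glue_ex (A B : {set T}) : #|A| = (a + b)%N -> #|B| = (b + c)%N ->
    #|A :|: B| = (a + b + c)%N ->
  exists w : {ffun 'I_(a + b + c) -> T}, [/\ injective w,
    (w \o lblock) @: [set: 'I_(a + b)] = A & (w \o rblock) @: [set: 'I_(b + c)] = B].
Proof.
move=> cA cB cU; have := cardsUI A B; rewrite cA cB cU => cI.
have {}cI : #|A :&: B| = b by lia.
have cAB : #|A :\: B| = a by rewrite cardsD cA cI addnK.
have cBA : #|B :\: A| = c by rewrite cardsD setIC cB cI addKn.
have [w1 [i1 m1]] := @image_ex ('I_a : finType) T _ (etrans cAB (esym (card_ord a))).
have [w2 [i2 m2]] := @image_ex ('I_b : finType) T _ (etrans cI (esym (card_ord b))).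
have [w3 [i3 m3]] := @image_ex ('I_c : finType) T _ (etrans cBA (esym (card_ord c))).
have M1 i : w1 i \in A :\: B by rewrite -m1 imset_f.
have M2 i : w2 i \in A :&: B by rewrite -m2 imset_f.
have M3 i : w3 i \in B :\: A by rewrite -m3 imset_f.
pose w : {ffun 'I_(a + b + c) -> T} := [ffun i => match split i with
  | inl j => match split j with inl x => w1 x | inr y => w2 y end | inr z => w3 z end].
have W1 i : w (lshift c (lshift b i)) = w1 i by rewrite ffunE (unsplitK (inl _)) (unsplitK (inl _)).
have W2 i : w (lshift c (rshift a i)) = w2 i by rewrite ffunE (unsplitK (inl _)) (unsplitK (inr _)).
have W3 i : w (rshift (a + b) i) = w3 i by rewrite ffunE (unsplitK (inr _)).
have wA i : w (lblock i) \in A.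
  rewrite /lblock; case: (split_ordP i) => j ->; rewrite ?W1 ?W2.
    by have := M1 j; rewrite inE => /andP[].
  by have := M2 j; rewrite inE => /andP[].
have wB i : w (rblock i) \in B.
  case: (split_ordP i) => j ->; rewrite ?rblock_l ?rblock_r ?W2 ?W3.
    by have := M2 j; rewrite inE => /andP[].
  by have := M3 j; rewrite inE => /andP[].
have im1 : (w \o lblock) @: [set: 'I_(a + b)] \subset A.
  by apply/subsetP => x /imsetP[i _ ->]; apply: wA.
have im2 : (w \o rblock) @: [set: 'I_(b + c)] \subset B.
  by apply/subsetP => x /imsetP[i _ ->]; apply: wB.
have sur : A :|: B \subset w @: [set: 'I_(a + b + c)].
  apply/subsetP => x; rewrite inE; case xA: (x \in A); case xB: (x \in B) => //= _.
  - have : x \in A :&: B by rewrite inE xA xB.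
    by rewrite -m2 => /imsetP[i _ ->]; rewrite -W2 imset_f.
  - have : x \in A :\: B by rewrite inE xA xB.
    by rewrite -m1 => /imsetP[i _ ->]; rewrite -W1 imset_f.
  have : x \in B :\: A by rewrite inE xA xB.
  by rewrite -m3 => /imsetP[i _ ->]; rewrite -W3 imset_f.
have iw : injective w.
  have /imset_injP iw : #|w @: [set: 'I_(a + b + c)]| == #|[set: 'I_(a + b + c)]|.
    rewrite eqn_leq leq_imset_card [#|[set: _]|]cardsT card_ord.
    by apply: leq_trans (subset_leq_card sur); rewrite cU.
  by move=> i j; apply: iw; rewrite inE.
have iw1 : injective (w \o lblock) := inj_comp iw lblock_inj.
have iw2 : injective (w \o rblock) := inj_comp iw rblock_inj.
exists w; split=> //; apply/eqP.
  by rewrite eqEcard im1 (card_imset _ iw1) cardsT card_ord cA leqnn.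
by rewrite eqEcard im2 (card_imset _ iw2) cardsT card_ord cB leqnn.
Qed.

(** The labellings adapted to [A] and [B] are permuted simply transitively by [K]; their number
    cancels the factor of [ev_ind]. *)
Lemma card_glue (A B : {set T}) : #|[set w : {ffun 'I_(a + b + c) -> T} | injectiveb w &&
     ((w \o lblock) @: [set: 'I_(a + b)] == A) && ((w \o rblock) @: [set: 'I_(b + c)] == B)]| =
  (if [&& #|A| == a + b, #|B| == b + c & #|A :|: B| == a + b + c]%N then #|{: K}| else 0%N).
Proof.
case: ifP => [/and3P[/eqP cA /eqP cB /eqP cU]|nAB]; last first.
  apply: eq_card0 => w; rewrite inE; apply/negP => /andP[/andP[/injectiveP iw /eqP mA] /eqP mB].
  case/negP: (negbT nAB); rewrite -mA -mB -imset_bl (card_imset _ iw).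
  rewrite (card_imset _ (inj_comp iw lblock_inj)) (card_imset _ (inj_comp iw rblock_inj)).
  by rewrite !cardsT !card_ord !eqxx.
have [w [iw mA mB]] := glue_ex cA cB cU.
rewrite -sum1_card (@reindex_ex nat _ _ (fun h => precomp w (emb h))).
- rewrite -sum1_card; apply: eq_bigl => h; rewrite !inE precomp_injb (introT (injectiveP _) iw) /=.
  apply/andP; split; apply/eqP; [rewrite -mA|rewrite -mB].
    have E : precomp [ffun i => w (lblock i)] (block_perm h.1.1 h.1.2) =1 precomp w (emb h) \o lblock.
      by move=> i; rewrite /= !ffunE emb_lblock.
    rewrite -(eq_imset _ E) imset_precomp; apply: eq_imset => i.
    by rewrite !ffunE.
  have E : precomp [ffun i => w (rblock i)] (block_perm h.1.2 h.2) =1 precomp w (emb h) \o rblock.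
    by move=> i; rewrite /= !ffunE emb_rblock.
  by rewrite -(eq_imset _ E) imset_precomp; apply: eq_imset => i; rewrite !ffunE.
- move=> h h' /ffunP E; apply: emb_inj; apply/permP => i; apply: iw.
  by have := E i; rewrite !ffunE.
move=> w'; rewrite inE => /andP[/andP[/injectiveP iw' /eqP mA'] /eqP mB'].
have mU : w' @: [set: 'I_(a + b + c)] = w @: [set: 'I_(a + b + c)].
  by rewrite !imset_bl mA mB mA' mB'.
have [r wr] := same_image iw' iw mU.
have [i|i|h rh] := @emb_ex r.
- have : w' (lblock i) \in (w \o lblock) @: [set: 'I_(a + b)] by rewrite mA -mA'; apply/imsetP; exists i.
  by rewrite wr ffunE => /imsetP[j _ /iw ->]; exists j.
- have : w' (rblock i) \in (w \o rblock) @: [set: 'I_(b + c)] by rewrite mB -mB'; apply/imsetP; exists i.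
  by rewrite wr ffunE => /imsetP[j _ /iw ->]; exists j.
by exists h; rewrite wr rh.
Qed.
End Blocks.

Lemma ev_smash_component a b c p q n (ep : (a + b)%N = p) (eq : (b + c)%N = q)
    (en : (a + b + c)%N = n) (V : rep k 'S_p) (W : rep k 'S_q) (T : finType) (g : {perm T}) :
  ev (chi (smash_component ep eq en V W)) g =
  \sum_(A : {set T}) \sum_(B : {set T}) if [&& #|A| == p, #|B| == q & #|A :|: B| == n]
                 then setev (chi V) g A * setev (chi W) g B else 0.
Proof.
subst p q n; rewrite /smash_component ev_ind.
have nzK : #|{: 'S_a * 'S_b * 'S_c}|%:R != 0 :> k.
  by apply: natr_neq0_char0 => //; rewrite -cardsT cardG_gt0.
have diag h : chi (res (smash_diag_morphism (erefl (a + b)%N) (erefl (b + c)%N)) (outer V W)) h =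
    chi V (block_perm h.1.1 h.1.2) * chi W (block_perm h.1.2 h.2).
  by rewrite -[LHS]/(chi (outer V W) _) chi_outer.
pose m (w : {ffun 'I_(a + b + c) -> T}) :=
  ((w \o @lblock a b c) @: [set: 'I_(a + b)], (w \o @rblock a b c) @: [set: 'I_(b + c)]).
have term (w : {ffun 'I_(a + b + c) -> T}) : injectiveb w ->
   \sum_(h | [forall i, g (w i) == w (smash_emb (erefl (a + b + c)%N) h i)])
     chi (res (smash_diag_morphism (erefl (a + b)%N) (erefl (b + c)%N)) (outer V W)) h =
   setev (chi V) g (m w).1 * setev (chi W) g (m w).2.
  move/injectiveP => iw.
  have lE (l : nat) (X : rep k 'S_l) (u : 'I_l -> 'I_(a + b + c)) : injective u ->
      setev (chi X) g ((w \o u) @: [set: 'I_l]) = loc (chi X) g (w \o u).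
    move=> iu; rewrite (setevE k0 g (a := [ffun i => w (u i)])).
    - by apply: loc_ext => i; rewrite ffunE.
    - by move=> x y; apply: chiJ.
    - by move=> i j; rewrite !ffunE => /iw/iu.
    by apply: eq_imset => i; rewrite ffunE.
  rewrite !lE; [|exact: rblock_inj|exact: lblock_inj].
  rewrite -loc_smash //; apply: eq_big => [h|h _]; last exact: diag.
  by apply: eq_forallb => i; rewrite /smash_emb cast_perm_id.
rewrite (eq_bigr _ term) (partition_big m xpredT) //= pair_big mulr_sumr /=.
apply: eq_bigr => -[A B] _ /=.
rewrite (eq_bigr (fun=> setev (chi V) g A * setev (chi W) g B)) => [|w]; last first.
  by case/andP => _; rewrite /m xpair_eqE => /andP[/eqP <- /eqP <-].
rewrite sumr_const; have := card_glue a b c A B; set X := [set _ | _] => cX.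
have -> : #|[pred w : {ffun 'I_(a + b + c) -> T} | injectiveb w & m w == (A, B)]| = #|X|.
  by apply: eq_card => w; rewrite !inE xpair_eqE andbA.
rewrite cX; case: ifP => _; last by rewrite mulr0.
by rewrite -[X in _ * X]mulr_natl mulKf.
Qed.

(** Each pair of subsets with p and q elements occurs for exactly one n, the size of its union, so
    the sum over n factors. *)
Lemma ev_smash_rep p q (V : rep k 'S_p) (W : rep k 'S_q) (T : finType) (g : {perm T}) :
  \sum_(n : smash_range p q) ev (chi (smash_rep n V W)) g = ev (chi V) g * ev (chi W) g.
Proof.
rewrite !ev_setev big_distrlr /=.
under [LHS]eq_bigr => n _ do rewrite /smash_rep ev_smash_component.
rewrite exchange_big; apply: eq_bigr => A _; rewrite exchange_big; apply: eq_bigr => B _ /=.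
have [cA|ncA] := eqVneq #|A| p; last first.
  by rewrite setev0 ?card_ord // mul0r big1.
have [cB|ncB] := eqVneq #|B| q; last first.
  by rewrite [setev _ _ B]setev0 ?card_ord // mulr0 big1.
have cU : (#|A :|: B| < (p + q).+1)%N by rewrite ltnS -cA -cB -cardsUI leq_addr.
have cM : (maxn p q <= Ordinal cU)%N.
  by rewrite /= geq_max -cA -cB !subset_leq_card ?subsetUl ?subsetUr.
pose n0 : smash_range p q := exist _ (Ordinal cU) cM.
rewrite (bigD1 n0) //= eqxx [X in _ + X]big1 ?addr0 // => n nn0.
case: eqP => // E; case/eqP: nn0; apply: val_inj; apply: val_inj; exact: esym E.
Qed.
End Smash.

(** * Integral forms *)

Lemma sum_copies (A : nmodType) (J : finType) (L : Type) (h : J -> L) (F : L -> A) (n : J -> nat) :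
  \sum_(i <- [seq h j | j <- index_enum J, _ <- nseq (n j) tt]) F i = \sum_j F (h j) *+ n j.
Proof.
rewrite big_allpairs_dep; apply: eq_bigr => j _.
elim: (n j) => [|m IH] /=; first by rewrite big_nil.
by rewrite big_cons IH mulrS.
Qed.

Section Forms.
Variable k : fieldType.

(* [nspan G x f]: the pair [(x, f)] is an N-combination of generators.  [f] is *)
(* the evaluation of [x]; it is carried along as a relation because no map    *)
(* from [A] to functions computes it when R does not map to k.                *)
Inductive nspan (A : nmodType) (X : Type) (G : A -> (X -> k) -> Prop) : A -> (X -> k) -> Prop :=
| Nspan0 f : f =1 (fun=> 0) -> nspan G 0 f
| NspanS x f y f' f'' : G x f -> nspan G y f' -> f'' =1 (fun t => f t + f' t) ->
    nspan G (x + y) f''.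

Section Nspan.
Variables (A : nmodType) (X : Type) (G : A -> (X -> k) -> Prop).

Lemma nspan_ext x f f' : f =1 f' -> nspan G x f -> nspan G x f'.
Proof.
move=> ff' P; case: P ff' => [g g0|y g z h h' Gy Pz hE] ff'.
  by apply: Nspan0 => t; rewrite -ff' g0.
by apply: NspanS Gy Pz _ => t; rewrite -ff' hE.
Qed.

Lemma nspan_gen x f : G x f -> nspan G x f.
Proof.
move=> Gx; rewrite -[x]addr0; apply: (NspanS Gx (@Nspan0 _ _ _ (fun=> 0) _)) => // t.
by rewrite addr0.
Qed.

Lemma nspanD x f y f' : nspan G x f -> nspan G y f' -> nspan G (x + y) (fun t => f t + f' t).
Proof.
move=> Px Py; elim: Px => [g g0|u g v h h' Gu _ IH hE].
  by rewrite add0r; apply: nspan_ext Py => t; rewrite g0 add0r.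
by rewrite -addrA; apply: NspanS Gu IH _ => t; rewrite hE addrA.
Qed.

Lemma nspan_sum (J : Type) (r : seq J) (x : J -> A) (f : J -> X -> k) :
  (forall j, nspan G (x j) (f j)) ->
  nspan G (\sum_(j <- r) x j) (fun t => \sum_(j <- r) f j t).
Proof.
move=> P; elim: r => [|j r IH].
  by rewrite big_nil; apply: Nspan0 => t; rewrite big_nil.
rewrite big_cons; apply: nspan_ext (nspanD (P j) IH) => t.
by rewrite big_cons.
Qed.

Lemma nspanMn x f n : nspan G x f -> nspan G (x *+ n) (fun t => n%:R * f t).
Proof.
move=> P; elim: n => [|n IH]; first by apply: Nspan0 => t; rewrite mul0r.
rewrite mulrS; apply: nspan_ext (nspanD P IH) => t.
by rewrite -[in RHS]natr1 mulrDl mul1r addrC.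
Qed.
End Nspan.

Lemma nspan_map (A B : nmodType) (X Y : Type) (G : A -> (X -> k) -> Prop)
    (G' : B -> (Y -> k) -> Prop) (F : A -> B) (Phi : (X -> k) -> Y -> k) :
    F 0 = 0 -> {morph F : x y / x + y} ->
    (forall f, f =1 (fun=> 0) -> Phi f =1 (fun=> 0)) ->
    (forall f f' f'', f'' =1 (fun t => f t + f' t) -> Phi f'' =1 (fun t => Phi f t + Phi f' t)) ->
    (forall x f, G x f -> nspan G' (F x) (Phi f)) ->
  forall x f, nspan G x f -> nspan G' (F x) (Phi f).
Proof.
move=> F0 FD P0 PD GG' x f; elim=> [g g0|y g z h h' Gy _ IH hE].
  by rewrite F0; apply: Nspan0; apply: P0.
rewrite FD; apply: nspan_ext (nspanD (GG' _ _ Gy) IH) => t.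
by rewrite (PD _ _ _ hE).
Qed.

Definition free_family (I : eqType) (X : Type) (v : I -> X -> k) :=
  forall (s : seq I) (c : I -> k), uniq s ->
    (forall t, \sum_(i <- s) c i * v i t = 0) -> forall i, i \in s -> c i = 0.

(** One list [s], with repetitions, records the multiplicities of [x] and [f] simultaneously; this
    is what links the ring R to the field k. *)
Definition expands (A : nmodType) (X : Type) (I : Type) (u : I -> A) (v : I -> X -> k) x f :=
  exists s : seq I, x = \sum_(i <- s) u i /\ forall t, f t = \sum_(i <- s) v i t.

Definition based (A : nmodType) (X : Type) (P : A -> (X -> k) -> Prop) :=
  exists (I : choiceType) (u : I -> A) (v : I -> X -> k),
    free_family v /\ forall x f, P x f -> expands u v x f.

Lemma expands_nspan (A : nmodType) (X I : Type) (u : I -> A) (v : I -> X -> k) G :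
  (forall x f, G x f -> expands u v x f) -> forall x f, nspan G x f -> expands u v x f.
Proof.
move=> GE x f; elim=> [g g0|y g z h h' /GE[s [-> sE]] _ [s' [-> sE']] hE].
  by exists [::]; split=> [|t]; rewrite big_nil.
by exists (s ++ s'); split=> [|t]; rewrite big_cat // hE sE sE'.
Qed.

Lemma sum_count (A : nmodType) (I : eqType) (r s : seq I) (F : I -> A) :
  uniq r -> {subset s <= r} -> \sum_(i <- s) F i = \sum_(i <- r) F i *+ count_mem i s.
Proof.
move=> Ur; elim: s => [_|j s IH sr].
  by rewrite big_nil big1.
rewrite big_cons IH => [|i si]; last by apply: sr; rewrite inE si orbT.
under [RHS]eq_bigr => i _ do rewrite /= mulrnDr.
rewrite big_split /=; congr (_ + _).
rewrite (bigD1_seq j) //=; last by apply: sr; rewrite inE eqxx.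
by rewrite eqxx big1 ?addr0 // => i; rewrite eq_sym => /negPf->.
Qed.

Hypothesis k0 : [pchar k] =i pred0.

(** Independence of the functions [v] determines the multiplicities in k, and characteristic 0
    determines them as natural numbers; they determine the element. Independence of [u] is not
    assumed. *)
Lemma based_inj (A : nmodType) (X : Type) (P : A -> (X -> k) -> Prop) x y f f' :
  based P -> P x f -> P y f' -> f =1 f' -> x = y.
Proof.
case=> I [u [v [vfree PE]]] /PE[s [-> sE]] /PE[s' [-> sE']] ff'.
pose r := undup (s ++ s'); have Ur : uniq r := undup_uniq _.
have sr : {subset s <= r} by move=> i si; rewrite mem_undup mem_cat si.
have sr' : {subset s' <= r} by move=> i si; rewrite mem_undup mem_cat si orbT.
rewrite (sum_count _ Ur sr) (sum_count _ Ur sr').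
apply: eq_big_seq => i ir; congr (_ *+ _); apply: (natr_inj_char0 k0).
apply/eqP; rewrite -subr_eq0; apply/eqP; move: i ir.
apply: (vfree r (fun i => (count_mem i s)%:R - (count_mem i s')%:R)) => // t.
under eq_bigr => i _ do rewrite mulrBl !mulr_natl.
by rewrite sumrB -(sum_count _ Ur sr) -(sum_count _ Ur sr') -sE -sE' ff' subrr.
Qed.

Lemma free_family_prod (I J : choiceType) (X Y : Type) (v : I -> X -> k) (w : J -> Y -> k) :
  free_family v -> free_family w ->
  free_family (fun (ij : I * J) (t : X * Y) => v ij.1 t.1 * w ij.2 t.2).
Proof.
move=> fv fw r c Ur c0 [i j] ijr.
pose r1 := undup (unzip1 r); pose r2 := undup (unzip2 r).
(* Extending [c] by 0 to a rectangle allows independence to be applied one variable at a time. *)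
pose c' ij := if ij \in r then c ij else 0.
have mem1 ij : ij \in r -> ij.1 \in r1 by move=> h; rewrite mem_undup map_f.
have mem2 ij : ij \in r -> ij.2 \in r2 by move=> h; rewrite mem_undup map_f.
have S F : \sum_(ij <- r) F ij = \sum_(i <- r1) \sum_(j <- r2) if (i, j) \in r then F (i, j) else 0 :> k.
  transitivity (\sum_(ij <- [seq (i, j) | i <- r1, j <- r2]) if ij \in r then F ij else 0); last first.
    by rewrite big_allpairs_dep.
  rewrite -big_mkcond -[RHS]big_filter; apply: perm_big; apply: uniq_perm => //.
    by rewrite filter_uniq // allpairs_uniq ?undup_uniq // => -[? ?] [? ?].
  move=> [i' j']; rewrite mem_filter; case rij: (_ \in r) => //=.
  by apply/esym/allpairsP; exists (i', j'); rewrite (mem1 _ rij) (mem2 _ rij).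
suff : c' (i, j) = 0 by rewrite /c' ijr.
have j2 : j \in r2 := mem2 _ ijr; have i1 : i \in r1 := mem1 _ ijr; move: j j2 {ijr}.
apply: (fw r2 (fun j => c' (i, j))); first exact: undup_uniq.
move=> t'; move: i i1; apply: (fv r1); first exact: undup_uniq.
move=> t; rewrite -[RHS](c0 (t, t')) S; apply: eq_bigr => i _.
rewrite mulr_suml; apply: eq_bigr => j _; rewrite /c'.
by case: ifP => _; rewrite ?mul0r //= -mulrA [w _ _ * _]mulrC.
Qed.

Section TensorForms.
Variables (R : comNzRingType) (M N : lmodType R) (X Y : Type).
Variables (P : M -> (X -> k) -> Prop) (Q : N -> (Y -> k) -> Prop).

Definition tens_gen (z : tensor M N) (h : X * Y -> k) :=
  exists x f y f', [/\ P x f, Q y f', z = tens x y & h =1 (fun t => f t.1 * f' t.2)].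

Definition ptens := nspan tens_gen.

Lemma ptens_tens x f y f' : P x f -> Q y f' -> ptens (tens x y) (fun t => f t.1 * f' t.2).
Proof. by move=> Px Qy; apply: nspan_gen; exists x, f, y, f'. Qed.

Lemma based_tens : based P -> based Q -> based ptens.
Proof.
case=> I [u [v [fv PE]]] [J [u' [v' [fv' QE]]]].
exists (I * J)%type, (fun ij => tens (u ij.1) (u' ij.2)),
  (fun ij t => v ij.1 t.1 * v' ij.2 t.2); split; first exact: free_family_prod.
apply: expands_nspan => z h [x [f [y [f' [/PE[s [xE sE]] /QE[s' [yE sE']] -> hE]]]]].
exists [seq (i, j) | i <- s, j <- s']; split=> [|t].
  rewrite big_allpairs_dep xE (lin_sum ((tens_bilinear M N).1 y)); apply: eq_bigr => i _.
  by rewrite yE (lin_sum ((tens_bilinear M N).2 _)).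
rewrite hE sE sE' big_distrlr /=; rewrite big_allpairs_dep; apply: eq_bigr => i _.
by apply: eq_bigr.
Qed.
End TensorForms.
End Forms.

(** * The structure maps *)

Section Structure.
Variables (k : fieldType) (k0 : [pchar k] =i pred0).

Definition sym_index n : finType := sval (cid (exists_irr_system k0 'S_n)).
Definition sym_irr n : sym_index n -> rep k 'S_n := sval (cid (svalP (cid (exists_irr_system k0 'S_n)))).

Lemma sym_irrP n : irr_system (@sym_irr n).
Proof. exact: (svalP (cid (svalP (cid (exists_irr_system k0 'S_n))))). Qed.

Lemma sym_irr_span n (f : 'S_n -> k) : class_function f -> chi_span (@sym_irr n) f.
Proof. exact: (class_function_span k0 (@perm_expJ _) (@sym_irrP n)). Qed.

Lemma sym_irr_scalar n (i : sym_index n) : scalar_commutant (sym_irr i).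
Proof. by apply: (sym_scalar_commutant k0); have [irrb _ _ _] := @sym_irrP n. Qed.

Definition outer_chi p q (ij : sym_index p * sym_index q) (x : 'S_p * 'S_q) : k :=
  chi (sym_irr ij.1) x.1 * chi (sym_irr ij.2) x.2.

Lemma coef_ex p q (X : rep k ('S_p * 'S_q)%type) : exists m : sym_index p * sym_index q -> nat,
  forall x, chi X x = \sum_ij (m ij)%:R * outer_chi ij x.
Proof.
exact: (outer_coef k0 (@sym_irrP p) (@sym_irrP q) (@sym_irr_span p) (@sym_irr_span q)
  (@sym_irr_scalar p) (@sym_irr_scalar q)).
Qed.

Definition coef p q (X : rep k ('S_p * 'S_q)%type) := sval (cid (coef_ex X)).

Lemma coefP p q (X : rep k ('S_p * 'S_q)%type) x :
  chi X x = \sum_ij (coef X ij)%:R * outer_chi ij x.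
Proof. exact: (svalP (cid (coef_ex X))). Qed.

Lemma coef_uniq p q (m m' : sym_index p * sym_index q -> nat) :
  (forall x, \sum_ij (m ij)%:R * outer_chi ij x = \sum_ij (m' ij)%:R * outer_chi ij x) ->
  m =1 m'.
Proof. exact: (eq_outer_coef k0 (@sym_irrP p) (@sym_irrP q)). Qed.

Variable R : comNzRingType.
Local Notation RepS := (RepS R k).
Local Notation Lam := (Lambda R k).
Local Notation iota := (dinj RepS).

Lemma cls_add (gT : finGroupType) (V U W : rep k gT) :
  (forall g, chi V g = chi U g + chi W g) -> cls R V = cls R U + cls R W.
Proof. exact: cls_chi_add. Qed.

Lemma chi_rel (gT : finGroupType) (V U W : rep k gT) g :
  mx_rsim V (dadd_grepr U W) -> chi V g = chi U g + chi W g.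
Proof. by move=> /chi_rsim ->; rewrite chi_dadd. Qed.

Lemma eq_cls (gT : finGroupType) (J J' : Type) (r : seq J) (r' : seq J')
    (V : J -> rep k gT) (W : J' -> rep k gT) :
  (forall g, \sum_(j <- r) chi (V j) g = \sum_(j <- r') chi (W j) g) ->
  \sum_(j <- r) cls R (V j) = \sum_(j <- r') cls R (W j).
Proof. by have [I [b bP]] := exists_irr_system k0 gT; apply: eq_cls_sum bP _ _ _ _ _ _ _. Qed.

Lemma cls_expand (gT : finGroupType) (J : finType) (X : rep k gT) (V : J -> rep k gT)
    (n : J -> nat) : (forall g, chi X g = \sum_j (n j)%:R * chi (V j) g) ->
  cls R X = \sum_j cls R (V j) *+ n j.
Proof.
(* Each [V j] is repeated [n j] times, turning multiplicities into a plain sum of characters for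
   [eq_cls]. *)
pose r := [seq j | j <- index_enum J, _ <- nseq (n j) tt].
have S (A : nmodType) (F : J -> A) : \sum_(j <- r) F j = \sum_j F j *+ n j by apply: sum_copies.
move=> XV; rewrite -S -[cls R X]addr0 -(big_seq1 +%R X (cls R)).
rewrite addr0; apply: eq_cls => g; rewrite S big_seq1 XV.
by apply: eq_bigr => j _; rewrite mulr_natl.
Qed.

(** Expansion over outer products of irreducible representations; uniqueness of the multiplicities
    makes it additive, so it descends to the Grothendieck group. The inverse [psi] is the outer
    product. *)
Definition phi_gen p q (X : rep k ('S_p * 'S_q)%type) : tensor (RepS p) (RepS q) :=
  \sum_ij tens (cls R (sym_irr ij.1) : RepS p) (cls R (sym_irr ij.2) : RepS q) *+ coef X ij.

Definition phi p q : RepSS R k p q -> tensor (RepS p) (RepS q) := glift (@phi_gen p q).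

Lemma phi_genD p q (V U W : rep k ('S_p * 'S_q)%type) : mx_rsim V (dadd_grepr U W) ->
  phi_gen V = phi_gen U + phi_gen W.
Proof.
move=> VUW; rewrite -big_split; apply: eq_bigr => ij _ /=.
rewrite -mulrnDr; congr (_ *+ _); move: ij; apply: coef_uniq => x.
rewrite -coefP (chi_rel x VUW) !coefP -big_split; apply: eq_bigr => ij _ /=.
by rewrite natrD mulrDl.
Qed.

Lemma phi_linear p q : linear (@phi p q).
Proof. exact/glift_linear/phi_genD. Qed.

Lemma phi_cls p q X : phi (cls R X : RepSS R k p q) = phi_gen X.
Proof. exact/glift_cls/phi_genD. Qed.

Lemma phi_outer p q (V : rep k 'S_p) (W : rep k 'S_q) :
  phi (cls R (outer V W)) = tens (cls R V : RepS p) (cls R W : RepS q).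
Proof.
rewrite phi_cls /phi_gen.
have [_ _ _ /(_ V)[m [-> mP]]] := @sym_irrP p.
have [_ _ _ /(_ W)[m' [-> mP']]] := @sym_irrP q.
rewrite (lin_sum ((tens_bilinear (RepS p) (RepS q)).1 _)).
under [RHS]eq_bigr => i _ do rewrite (lin_sum ((tens_bilinear (RepS p) (RepS q)).2 _)).
rewrite pair_big /=; apply: eq_bigr => -[i j] _ /=.
rewrite (linMn ((tens_bilinear (RepS p) (RepS q)).1 _)) (linMn ((tens_bilinear (RepS p) (RepS q)).2 _)).
rewrite -mulrnA; congr (_ *+ _).
have /(_ (i, j)) -> // : coef (outer V W) =1 (fun ij => m' ij.2 * m ij.1)%N.
apply: coef_uniq => x; rewrite -coefP chi_outer mP mP' big_distrlr pair_big /=.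
apply: eq_bigr => -[i' j'] _ /=; rewrite /outer_chi /= natrM.
rewrite -[_ *+ m i']mulr_natl -[_ *+ m' j']mulr_natl mulrACA.
by rewrite [(m i')%:R * _]mulrC.
Qed.

Definition psi_gen p q (V : rep k 'S_p) : RepS q -> RepSS R k p q :=
  glift (fun W => cls R (outer V W)).

Lemma psi_genD p q (V : rep k 'S_p) (W U X : rep k 'S_q) : mx_rsim W (dadd_grepr U X) ->
  cls R (outer V W) = cls R (outer V U) + cls R (outer V X).
Proof. by move=> WUX; apply: cls_add => x; rewrite !chi_outer (chi_rel _ WUX) mulrDr. Qed.

Lemma psi_gen_linear p q V : linear (@psi_gen p q V).
Proof. exact/glift_linear/psi_genD. Qed.

Lemma psi_gen_cls p q (V : rep k 'S_p) (W : rep k 'S_q) :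
  psi_gen V (cls R W) = cls R (outer V W).
Proof. exact: (glift_cls (psi_genD V)). Qed.

Definition psi p q : tensor (RepS p) (RepS q) -> RepSS R k p q :=
  tlift (fun x y => glift (fun V => psi_gen V y) x).

Lemma psi_innerD p q (y : RepS q) (V U X : rep k 'S_p) : mx_rsim V (dadd_grepr U X) ->
  psi_gen V y = psi_gen U y + psi_gen X y :> RepSS R k p q.
Proof.
move=> VUX; move: y; apply: groth_ext => [|a y y'|W].
- exact: psi_gen_linear.
- by rewrite !psi_gen_linear scalerDr addrACA.
by rewrite !psi_gen_cls; apply: cls_add => x; rewrite !chi_outer (chi_rel _ VUX) mulrDl.
Qed.

Lemma psi_bilinear p q : bilinear_map
  (fun (x : RepS p) (y : RepS q) => glift (fun V => psi_gen V y) x : RepSS R k p q).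
Proof.
split=> [y|x a y y']; first exact: (glift_linear (psi_innerD y)).
move: x; apply: groth_ext => [||V]; first exact: (glift_linear (psi_innerD _)).
  move=> c x x'; rewrite !(glift_linear (psi_innerD _)).
  by rewrite !scalerDr !scalerA [a * c]mulrC addrACA.
rewrite !(glift_cls (psi_innerD _)); exact: psi_gen_linear.
Qed.

Lemma psi_linear p q : linear (@psi p q).
Proof. exact/tlift_linear/psi_bilinear. Qed.

Lemma psi_tens p q (V : rep k 'S_p) (W : rep k 'S_q) :
  psi (tens (cls R V : RepS p) (cls R W : RepS q)) = cls R (outer V W).
Proof.
rewrite /psi tlift_tens; last exact: psi_bilinear.
by rewrite (glift_cls (psi_innerD _)) psi_gen_cls.
Qed.

Lemma phiK p q : cancel (@phi p q) (@psi p q).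
Proof.
apply: groth_ext => [a x y| |X]; [by rewrite phi_linear psi_linear|by []|].
rewrite phi_cls /phi_gen (lin_sum (@psi_linear p q)).
under eq_bigr => ij _ do rewrite (linMn (@psi_linear p q)) psi_tens.
by apply/esym/cls_expand => x; rewrite coefP; apply: eq_bigr => ij _; rewrite chi_outer.
Qed.

Lemma psiK p q : cancel (@psi p q) (@phi p q).
Proof.
apply: tensor_ext => [a x y| |x y]; [by rewrite psi_linear phi_linear|by []|].
have lT := tens_bilinear (RepS p) (RepS q).
move: x; apply: groth_ext => [a x x'|a x x'|V].
- by rewrite lT.1 psi_linear phi_linear.
- exact: lT.1.
move: y; apply: groth_ext => [a y y'|a y y'|W].
- by rewrite lT.2 psi_linear phi_linear.
- exact: lT.2.
by rewrite psi_tens phi_outer.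
Qed.

Lemma phi_identification : is_identification phi.
Proof.
move=> p q; split; first exact: phi_linear.
  by exists (@psi p q); [exact: phiK|exact: psiK].
exact: phi_outer.
Qed.

Lemma Lambda_ext (M : lmodType R) (f g : Lam -> M) : linear f -> linear g ->
  (forall n (V : rep k 'S_n), f (iota n (cls R V)) = g (iota n (cls R V))) -> f =1 g.
Proof.
move=> lf lg fg; apply: dsum_ext => // n x; move: x; apply: groth_ext.
- by move=> a x y; rewrite (@dinj_linear _ RepS) lf.
- by move=> a x y; rewrite (@dinj_linear _ RepS) lg.
exact: fg.
Qed.

Lemma chi_indD (gT hT : finGroupType) (f : {morphism [set: hT] >-> gT}) (injf : 'injm f)
    (V U W : rep k hT) : (forall h, chi V h = chi U h + chi W h) ->
  forall g, chi (ind injf V) g = chi (ind injf U) g + chi (ind injf W) g.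
Proof.
move=> VUW g; rewrite !(chi_ind k0) -mulrDr -big_split; congr (_ * _).
apply: eq_bigr => x _ /=; rewrite /ind_term -big_split; apply: eq_bigr => h _.
exact: VUW.
Qed.

Definition smash_gen p q (V : rep k 'S_p) (W : rep k 'S_q) : Lam :=
  \sum_(n : smash_range p q) iota (\val (\val n)) (cls R (smash_rep n V W)).

Lemma smash_genDr p q (V : rep k 'S_p) (W U X : rep k 'S_q) : mx_rsim W (dadd_grepr U X) ->
  smash_gen V W = smash_gen V U + smash_gen V X.
Proof.
move=> WUX; rewrite -big_split; apply: eq_bigr => n _ /=.
rewrite -(linD (@dinj_linear _ RepS _)); congr (iota _ _).
apply: cls_add; apply: chi_indD => h.
rewrite -![LHS]/(chi (outer V W) _) -[X in X + _]/(chi (outer V U) _) -[X in _ + X]/(chi (outer V X) _).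
by rewrite !chi_outer (chi_rel _ WUX) mulrDr.
Qed.

Lemma smash_genDl p q (V U X : rep k 'S_p) (W : rep k 'S_q) : mx_rsim V (dadd_grepr U X) ->
  smash_gen V W = smash_gen U W + smash_gen X W.
Proof.
move=> VUX; rewrite -big_split; apply: eq_bigr => n _ /=.
rewrite -(linD (@dinj_linear _ RepS _)); congr (iota _ _).
apply: cls_add; apply: chi_indD => h.
rewrite -![LHS]/(chi (outer V W) _) -[X in X + _]/(chi (outer U W) _) -[X in _ + X]/(chi (outer X W) _).
by rewrite !chi_outer (chi_rel _ VUX) mulrDl.
Qed.

Definition smash_l p (V : rep k 'S_p) : Lam -> Lam :=
  dlift (fun q : nat => glift (fun W : rep k 'S_q => smash_gen V W) : RepS q -> Lam).

Lemma smash_l_linear p (V : rep k 'S_p) : linear (smash_l V).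
Proof. by apply: dlift_linear => q; apply/glift_linear/smash_genDr. Qed.

Lemma smash_l_cls p q (V : rep k 'S_p) (W : rep k 'S_q) :
  smash_l V (iota q (cls R W)) = smash_gen V W.
Proof.
rewrite /smash_l dlift_dinj => [|n]; last exact/glift_linear/smash_genDr.
exact/glift_cls/smash_genDr.
Qed.

Lemma smash_lD p (V U X : rep k 'S_p) y : mx_rsim V (dadd_grepr U X) ->
  smash_l V y = smash_l U y + smash_l X y.
Proof.
move=> VUX; move: y; apply: Lambda_ext => [|a y y'|q W]; first exact: smash_l_linear.
  by rewrite !smash_l_linear scalerDr addrACA.
by rewrite !smash_l_cls; apply: smash_genDl.
Qed.

Definition smash (x y : Lam) : Lam :=
  dlift (fun p : nat => glift (fun V : rep k 'S_p => smash_l V y) : RepS p -> Lam) x.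

Lemma smash_linear_l y : linear (smash^~ y).
Proof. by apply: dlift_linear => p; apply: glift_linear => V U X; apply: smash_lD. Qed.

Lemma smash_clsl p (V : rep k 'S_p) y : smash (iota p (cls R V)) y = smash_l V y.
Proof.
rewrite /smash dlift_dinj => [|n]; last by apply: glift_linear => U W X; apply: smash_lD.
by apply: glift_cls => U W X; apply: smash_lD.
Qed.

Lemma smash_linear_r x : linear (smash x).
Proof.
move=> a y y'; move: x; apply: Lambda_ext => [|c x x'|p V]; first exact: smash_linear_l.
  by rewrite !smash_linear_l !scalerDr !scalerA [a * c]mulrC addrACA.
by rewrite !smash_clsl smash_l_linear.
Qed.

Lemma smash_cls p q (V : rep k 'S_p) (W : rep k 'S_q) :
  smash (iota p (cls R V)) (iota q (cls R W)) = smash_gen V W.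
Proof. by rewrite smash_clsl smash_l_cls. Qed.

Lemma smash_bilinear : bilinear_map smash.
Proof. by split=> [y|x]; [exact: smash_linear_l|exact: smash_linear_r]. Qed.

Definition res_lin n (i : 'I_n.+1) : RepS n -> RepSS R k i (n - i) :=
  glift (fun V => cls R (res (parabolic_morphism (split_eq i)) V)).

Lemma res_linD n (i : 'I_n.+1) (V U W : rep k 'S_n) : mx_rsim V (dadd_grepr U W) ->
  cls R (res (parabolic_morphism (split_eq i)) V) =
  cls R (res (parabolic_morphism (split_eq i)) U) + cls R (res (parabolic_morphism (split_eq i)) W).
Proof. by move=> VUW; apply: cls_add => x; apply: (chi_rel _ VUW). Qed.

Lemma res_lin_linear n (i : 'I_n.+1) : linear (res_lin i).
Proof. exact/glift_linear/res_linD. Qed.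

Lemma res_lin_cls n (i : 'I_n.+1) V :
  res_lin i (cls R V) = cls R (res (parabolic_morphism (split_eq i)) V).
Proof. exact/glift_cls/res_linD. Qed.

Definition delta_n n (x : RepS n) : tensor Lam Lam :=
  \sum_(i < n.+1) tmap (iota i) (iota (n - i)%N) (phi (res_lin i x)).

Lemma delta_n_linear n : linear (@delta_n n).
Proof.
apply: linear_sum_fun => i a x y; rewrite res_lin_linear phi_linear.
by apply: tmap_linear; apply: dinj_linear.
Qed.

Definition Delta : Lam -> tensor Lam Lam := dlift delta_n.

Lemma Delta_linear : linear Delta.
Proof. exact/dlift_linear/delta_n_linear. Qed.

Lemma Delta_iota n x : Delta (iota n x) = delta_n x.
Proof. exact: (dlift_dinj delta_n_linear). Qed.

Lemma Delta_coproduct : is_restriction_coproduct phi Delta.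
Proof.
split=> [|n V]; first exact: Delta_linear.
by rewrite Delta_iota; apply: eq_bigr => i _; rewrite res_lin_cls.
Qed.

Lemma smash_product : is_smash_product smash.
Proof. by split; [exact: smash_bilinear|exact: smash_cls]. Qed.

Definition lam_one : Lam := iota 0%N (cls R (triv_rep k 'S_0)).

(** The rank in degree 0. The target [R^o] is R as a module over itself. *)
Definition eps_n n : RepS n -> R^o :=
  glift (fun V => if n == 0%N then (rdegree V)%:R else 0).

Lemma eps_nD n (V U W : rep k 'S_n) : mx_rsim V (dadd_grepr U W) ->
  (if n == 0%N then (rdegree V)%:R else 0) =
  (if n == 0%N then (rdegree U)%:R else 0) + (if n == 0%N then (rdegree W)%:R else 0) :> R^o.
Proof. by move/mxrank_rsim => /= ->; case: eqP; rewrite ?addr0 ?natrD. Qed.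

Definition eps : Lam -> R := dlift eps_n.

Lemma eps_n_linear n : linear (@eps_n n).
Proof. exact/glift_linear/eps_nD. Qed.

Lemma eps_linear : scalar eps.
Proof. exact: (dlift_linear eps_n_linear). Qed.

Lemma eps_cls n (V : rep k 'S_n) :
  eps (iota n (cls R V)) = if n == 0%N then (rdegree V)%:R else 0.
Proof.
rewrite /eps (dlift_dinj eps_n_linear).
exact: (glift_cls (@eps_nD n)).
Qed.

End Structure.

(** * Integral forms of the structure maps *)

Section Forms.
Variables (k : fieldType) (k0 : [pchar k] =i pred0) (R : comNzRingType).
Local Notation RepS := (RepS R k).
Local Notation Lam := (Lambda R k).
Local Notation iota := (dinj RepS).
Local Notation smash := (@smash k R).
Local Notation Delta := (@Delta k k0 R).
Local Notation eps := (@eps k R).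
Local Notation one := (@lam_one k R).

Definition fperm := {T : finType & {perm T}}.
Definition fpsum (t t' : fperm) : fperm :=
  existT (fun T : finType => {perm T}) (projT1 t + projT1 t')%type (psum (projT2 t) (projT2 t')).
Definition fp0 : fperm := existT (fun T : finType => {perm T}) void 1%g.

Definition rep_gen (x : Lam) (f : fperm -> k) :=
  exists n (V : rep k 'S_n), x = iota n (cls R V) /\ f =1 (fun t => ev (chi V) (projT2 t)).

Definition form1 := nspan rep_gen.
Definition form2 := ptens form1 form1.
Definition form3 := ptens form1 form2.

Lemma form1_gen n (V : rep k 'S_n) : form1 (iota n (cls R V)) (fun t => ev (chi V) (projT2 t)).
Proof. by apply: nspan_gen; exists n, V. Qed.

Lemma chi_class (gT : finGroupType) (V : rep k gT) : class_function (chi V).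
Proof. by move=> x y; apply: chiJ. Qed.

(** Strong induction on the degree n. Evaluated at permutations of n points, terms of larger degree
    vanish, terms of smaller degree have zero coefficient by induction, and terms of degree n are
    the irreducible characters themselves. *)
Lemma sym_irr_free : free_family
  (fun (i : {n : nat & sym_index k0 n}) (t : fperm) => ev (chi (sym_irr (projT2 i))) (projT2 t)).
Proof.
move=> s c Us c0.
suff : forall n (j : sym_index k0 n), existT (sym_index k0) n j \in s -> c (existT (sym_index k0) n j) = 0.
  by move=> h [n j]; apply: h.
elim/ltn_ind => n IH.
pose c' j := if existT (sym_index k0) n j \in s then c (existT (sym_index k0) n j) else 0.
suff c'0 j : c' j = 0 by move=> j js; have := c'0 j; rewrite /c' js.
move: j; apply: (irr_chi_free k0 (@sym_irrP k k0 n)) => g.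
rewrite -[RHS](c0 (existT (fun T : finType => {perm T}) ('I_n : finType) g)) /=.
transitivity (\sum_(i <- s) \sum_(j : sym_index k0 n | i == existT (sym_index k0) n j)
    c i * ev (chi (sym_irr (projT2 i))) g).
  under [RHS]eq_bigr => i _ do rewrite big_mkcond.
  rewrite [RHS]exchange_big; apply: eq_bigr => j _ /=.
  rewrite -big_mkcond /= /c'; case: ifP => js.
    by rewrite -big_filter filter_pred1_uniq // big_seq1 /= ev_self //; apply: chi_class.
  rewrite mul0r big_seq_cond big_pred0 // => i; apply/andP => -[is_ /eqP E].
  by rewrite -E is_ in js.
apply: eq_big_seq => -[m j] is_ /=.
have [E|nm] := eqVneq m n.
  subst m; rewrite (big_pred1 j) // => j' /=.
  by rewrite -[LHS]/(_ == _) eq_Tagged /= eq_sym.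
rewrite big_pred0 => [|j']; last by apply/eqP => E; case/eqP: nm; exact: (congr1 (@projT1 _ _) E).
have [lt|le] := ltnP m n; first by rewrite IH // mul0r.
by rewrite ev_card_lt ?mulr0 // !card_ord ltn_neqAle le eq_sym nm.
Qed.

Lemma form1_based : based form1.
Proof.
exists {n : nat & sym_index k0 n}, (fun i => iota (projT1 i) (cls R (sym_irr (projT2 i)))),
  (fun i t => ev (chi (sym_irr (projT2 i))) (projT2 t)); split; first exact: sym_irr_free.
apply: expands_nspan => x f [n [V [-> fE]]].
have [_ _ _ /(_ V)[m [mE mP]]] := @sym_irrP k k0 n.
exists [seq existT (sym_index k0) n j | j <- index_enum (sym_index k0 n), _ <- nseq (m j) tt].
split=> [|t]; rewrite sum_copies.
  rewrite mE (lin_sum (@dinj_linear _ RepS n)); apply: eq_bigr => j _.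
  by rewrite (linMn (@dinj_linear _ RepS n)).
rewrite fE; transitivity (ev (fun s => \sum_j (m j)%:R * chi (sym_irr j) s) (projT2 t)).
  by apply: eq_ev => s; rewrite mP; apply: eq_bigr => j _; rewrite mulr_natl.
by rewrite ev_sum; apply: eq_bigr => j _; rewrite mulr_natl.
Qed.

Lemma form2_based : based form2. Proof. exact: based_tens form1_based form1_based. Qed.
Lemma form3_based : based form3. Proof. exact: based_tens form1_based form2_based. Qed.

Lemma form1_smash x y f f' : form1 x f -> form1 y f' -> form1 (smash x y) (fun t => f t * f' t).
Proof.
move=> Lx Ly; have [bl br] := smash_bilinear k0 R.
apply: (nspan_map (F := smash^~ y) (Phi := fun f t => f t * f' t)) Lx.
- exact: (lin0 (bl y)).
- exact: (linD (bl y)).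
- by move=> g g0 t; rewrite g0 mul0r.
- by move=> g g' g'' gE t; rewrite gE mulrDl.
move=> {}x {}f [p [V [-> fE]]].
apply: (nspan_map (F := smash (iota p (cls R V))) (Phi := fun f' t => f t * f' t)) Ly.
- exact: (lin0 (br _)).
- exact: (linD (br _)).
- by move=> g g0 t; rewrite g0 mulr0.
- by move=> g g' g'' gE t; rewrite gE mulrDr.
move=> {}y {}f' [q [W [-> fE']]]; rewrite (smash_cls k0) /smash_gen.
apply: nspan_ext (nspan_sum _ (fun n => form1_gen (smash_rep n V W))) => t.
by rewrite fE fE' -(ev_smash_rep k0).
Qed.

Lemma form1_one : form1 one (fun=> 1).
Proof.
apply: nspan_ext (form1_gen (triv_rep k 'S_0)) => t.
by rewrite ev_empty ?card_ord // chi_triv.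
Qed.

(** The counit takes values in R and the evaluation in k, so the two are compared through a common
    natural number. *)
Lemma form1_eps x f : form1 x f -> exists n : nat, eps x = n%:R /\ f fp0 = n%:R.
Proof.
have le : linear (eps : Lam -> R^o) by apply: eps_linear.
elim=> [g g0|y g z h h' [m [V [-> gE]]] _ [n [zn hn]] hE].
  by exists 0%N; rewrite g0 (lin0 le).
exists ((if m == 0 then rdegree V else 0) + n)%N.
rewrite hE hn (linD le) zn eps_cls gE !natrD; split; first by case: eqP.
congr (_ + _); case: eqVneq => [E|nm].
  by subst m; rewrite ev_empty ?card_ord // chi1.
by rewrite ev_card_lt // card_void card_ord lt0n.
Qed.

(** By [coefP] a character of the product group is the same N-combination of outer characters as its
    image under [phi], and each outer character evaluates to a product. *)
Lemma form2_phi i j (X : rep k ('S_i * 'S_j)%type) :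
  form2 (tmap (iota i) (iota j) (phi k0 (cls R X : RepSS R k i j)))
     (fun t => ev2 (chi X) (projT2 t.1) (projT2 t.2)).
Proof.
have l1 := @dinj_linear _ RepS i; have l2 := @dinj_linear _ RepS j.
have lt := tmap_linear l1 l2.
rewrite phi_cls /phi_gen (lin_sum lt).
under eq_bigr => ij _ do rewrite (linMn lt) tmap_tens //.
have P ij := nspanMn (coef (k0 := k0) X ij)
  (ptens_tens (form1_gen (@sym_irr k k0 i ij.1)) (form1_gen (@sym_irr k k0 j ij.2))).
apply: nspan_ext (nspan_sum _ P) => t /=.
rewrite /ev2; transitivity (ev (fun s => \sum_ij
    (coef (k0 := k0) X ij)%:R * ev (chi (sym_irr ij.2)) (projT2 t.2) * chi (sym_irr ij.1) s) (projT2 t.1)).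
  rewrite ev_sum; apply: eq_bigr => ij _.
  by rewrite -mulrA; congr (_ * _); rewrite mulrC.
apply: eq_ev => s; transitivity (ev (fun u => \sum_ij
    (coef (k0 := k0) X ij)%:R * chi (sym_irr ij.1) s * chi (sym_irr ij.2) u) (projT2 t.2)).
  by rewrite ev_sum; apply: eq_bigr => ij _; rewrite mulrAC.
apply: eq_ev => u; rewrite (coefP k0); apply: eq_bigr => ij _.
by rewrite mulrA.
Qed.

(** The coproduct corresponds to evaluation at a disjoint sum, by [ev_psum] in each degree. *)
Lemma form2_Delta x f : form1 x f -> form2 (Delta x) (fun t => f (fpsum t.1 t.2)).
Proof.
have lD := @Delta_linear k k0 R.
apply: (nspan_map (F := Delta) (Phi := fun f t => f (fpsum t.1 t.2))).
- exact: (lin0 lD).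
- exact: (linD lD).
- by move=> g g0 t; rewrite g0.
- by move=> g g' g'' gE t; rewrite gE.
move=> {}x {}f [n [V [-> fE]]]; rewrite Delta_iota /delta_n.
under eq_bigr => i _ do rewrite (res_lin_cls k0).
apply: nspan_ext (nspan_sum _ (fun i : 'I_n.+1 => form2_phi (res (parabolic_morphism (split_eq i)) V))) => t.
rewrite fE /= ev_psum //; first exact: chi_class.
Qed.

Lemma ptens_map (M N M' : lmodType R) (X Y Z : Type) (P : M -> (X -> k) -> Prop)
    (Q : N -> (Y -> k) -> Prop) (G : M' -> (Z -> k) -> Prop) (F : tensor M N -> M')
    (tau : Z -> X) (tau' : Z -> Y) : linear F ->
    (forall x f y f', P x f -> Q y f' ->
       nspan G (F (tens x y)) (fun t => f (tau t) * f' (tau' t))) ->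
  forall t h, ptens P Q t h -> nspan G (F t) (fun t => h (tau t, tau' t)).
Proof.
move=> lF PQ; apply: (nspan_map (F := F) (Phi := fun h t => h (tau t, tau' t))).
- exact: (lin0 lF).
- exact: (linD lF).
- by move=> g g0 t; rewrite g0.
- by move=> g g' g'' gE t; rewrite gE.
move=> t h [x [f [y [f' [Px Qy -> hE]]]]].
by apply: nspan_ext (PQ _ _ _ _ Px Qy) => u; rewrite hE.
Qed.

Lemma form3_assoc x f y f' z f'' : form1 x f -> form1 y f' -> form1 z f'' ->
  form3 (tens x (tens y z)) (fun t => f t.1 * (f' t.2.1 * f'' t.2.2)).
Proof. by move=> Lx Ly Lz; apply: ptens_tens Lx (ptens_tens Ly Lz). Qed.

Lemma form3_Delta_l t h : form2 t h ->
  form3 (tassoc (tmap Delta id t)) (fun t => h (fpsum t.1 t.2.1, t.2.2)).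
Proof.
have lD := @Delta_linear k k0 R; have lI := @linear_id R Lam.
have lT : linear (fun t => tassoc (tmap Delta id t)) :=
  linear_comp (tmap_linear lD lI) (@tassoc_linear R Lam Lam Lam).
apply: (ptens_map (F := fun t => tassoc (tmap Delta id t))
  (tau := fun t => fpsum t.1 t.2.1) (tau' := fun t => t.2.2)) => // x f y f' Lx Ly.
rewrite (tmap_tens _ _ lD lI).
have lA : linear (fun w : tensor Lam Lam => tassoc (tens w y)).
  by move=> a u v; rewrite /= tensDl tensZl tassoc_linear.
apply: (nspan_map (F := fun w : tensor Lam Lam => tassoc (tens w y))
  (Phi := fun g t => g (t.1, t.2.1) * f' t.2.2)) (form2_Delta Lx).
- exact: (lin0 lA).
- exact: (linD lA).
- by move=> g g0 u; rewrite g0 mul0r.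
- by move=> g g' g'' gE u; rewrite gE mulrDl.
move=> w h'' [u [g [v [g' [Lu Lv -> hE]]]]]; rewrite tassoc_tens.
by apply: nspan_ext (form3_assoc Lu Lv Ly) => t'; rewrite hE mulrA.
Qed.

Lemma form3_Delta_r t h : form2 t h ->
  form3 (tmap id Delta t) (fun t => h (t.1, fpsum t.2.1 t.2.2)).
Proof.
have lD := @Delta_linear k k0 R; have lI := @linear_id R Lam.
apply: (ptens_map (F := tmap id Delta) (tau := fun t => t.1)
  (tau' := fun t => fpsum t.2.1 t.2.2)); first exact: tmap_linear.
move=> x f y f' Lx Ly; rewrite tmap_tens //.
exact: ptens_tens Lx (form2_Delta Ly).
Qed.

Lemma tmul_bilinear_inner (a b : Lam) :
  bilinear_map (fun c d => tens (smash a c) (smash b d)).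
Proof. by apply: tmap_bilinear; apply: smash_linear_r. Qed.

Lemma tmul_bilinear (t : tensor Lam Lam) :
  bilinear_map (fun a b => tlift (fun c d => tens (smash a c) (smash b d)) t).
Proof.
have lt a b := tlift_linear (tmul_bilinear_inner a b).
have lr := smash_linear_l k0 (R := R).
split=> [b c a a'|a c b b'] /=; move: t; apply: tensor_ext.
- exact: lt.
- by move=> e s s'; rewrite !lt !scalerDr !scalerA [c * e]mulrC addrACA.
- move=> x y; rewrite !tlift_tens; try exact: tmul_bilinear_inner.
  by rewrite lr tensDl tensZl.
- exact: lt.
- by move=> e s s'; rewrite !lt !scalerDr !scalerA [c * e]mulrC addrACA.
move=> x y; rewrite !tlift_tens; try exact: tmul_bilinear_inner.
by rewrite lr tensDr tensZr.
Qed.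

Lemma form2_tmul s h t h' : form2 s h -> form2 t h' ->
  form2 (tmul smash s t) (fun t => h t * h' t).
Proof.
move=> Ls Lt; have lt a b := tlift_linear (tmul_bilinear_inner a b).
have ls := tlift_linear (tmul_bilinear t).
apply: (nspan_map (F := fun s => tmul smash s t) (Phi := fun h t => h t * h' t)) Ls.
- exact: (lin0 ls).
- exact: (linD ls).
- by move=> g g0 u; rewrite g0 mul0r.
- by move=> g g' g'' gE u; rewrite gE mulrDl.
move=> {}s {}h [x [f [y [f' [Lx Ly -> hE]]]]].
rewrite /tmul tlift_tens; last exact: tmul_bilinear.
move: ls => _.
apply: (nspan_map (Phi := fun h' t => h t * h' t)) Lt.
- exact: (lin0 (lt _ _)).
- exact: (linD (lt _ _)).
- by move=> g g0 u; rewrite g0 mulr0.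
- by move=> g g' g'' gE u; rewrite gE mulrDr.
move=> {}t {}h' [x' [g [y' [g' [Lx' Ly' -> hE']]]]].
rewrite tlift_tens; last exact: tmul_bilinear_inner.
apply: nspan_ext (ptens_tens (form1_smash Lx Lx') (form1_smash Ly Ly')) => u.
by rewrite hE hE' mulrACA.
Qed.

Lemma form2_swap t h : form2 t h -> form2 (tswap t) (fun t => h (t.2, t.1)).
Proof.
apply: (ptens_map (F := @tswap R Lam Lam) (tau := snd) (tau' := fst)).
  exact/tlift_linear/tswap_bilinear.
move=> x f y f' Lx Ly; rewrite /tswap tlift_tens; last exact: tswap_bilinear.
by apply: nspan_ext (ptens_tens Ly Lx) => u; rewrite mulrC.
Qed.

Lemma counit_bilinear_l : bilinear_map (fun y z : Lam => eps y *: z).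
Proof.
have le : linear (eps : Lam -> R^o) by apply: eps_linear.
split=> [z a y y'|y a z z']; first by rewrite le scalerDl scalerA.
by rewrite scalerDr !scalerA mulrC.
Qed.

Lemma counit_bilinear_r : bilinear_map (fun y z : Lam => eps z *: y).
Proof.
have le : linear (eps : Lam -> R^o) by apply: eps_linear.
split=> [z a y y'|y a z z']; last by rewrite le scalerDl scalerA.
by rewrite scalerDr !scalerA mulrC.
Qed.

Lemma form1_counit_l t h : form2 t h ->
  form1 (tlift (fun y z => eps y *: z) t) (fun t => h (fp0, t)).
Proof.
apply: (ptens_map (tau := fun=> fp0) (tau' := id)).
  exact/tlift_linear/counit_bilinear_l.
move=> x f y f' /form1_eps[n [xn fn]] Ly; rewrite tlift_tens; last exact: counit_bilinear_l.
by rewrite xn fn scaler_nat; apply: nspanMn.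
Qed.

Lemma form1_counit_r t h : form2 t h ->
  form1 (tlift (fun y z => eps z *: y) t) (fun t => h (t, fp0)).
Proof.
apply: (ptens_map (tau := id) (tau' := fun=> fp0)).
  exact/tlift_linear/counit_bilinear_r.
move=> x f y f' Lx /form1_eps[n [yn fn]]; rewrite tlift_tens; last exact: counit_bilinear_r.
rewrite yn fn scaler_nat; apply: nspan_ext (nspanMn n Lx) => u.
by rewrite mulrC.
Qed.
End Forms.

(** * Antipode of a connected coalgebra *)

Section Antipode.
Variables (R : comNzRingType) (T : nat -> lmodType R).
Local Notation H := (dsum T).
Local Notation iota := (dinj T).
Variables (mul : H -> H -> H) (unit : H) (Delta : H -> tensor H H) (eps : H -> R).
Hypotheses (alg : is_algebra mul unit) (coalg : is_coalgebra Delta eps).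
Hypotheses (conn : connected unit Delta eps) (eps1 : eps unit = 1).

Implicit Types f g h : H -> H.

Let mul_l y : linear (mul^~ y). Proof. by case: alg => [[]]. Qed.
Let mul_r x : linear (mul x). Proof. by case: alg => [[]]. Qed.
Let mulA : associative mul. Proof. by case: alg. Qed.
Let mul1 : left_id unit mul. Proof. by case: alg. Qed.
Let mulx1 : right_id unit mul. Proof. by case: alg. Qed.
Let lD : linear Delta. Proof. by case: coalg. Qed.
Let le : linear (eps : H -> R^o). Proof. by case: coalg. Qed.

Definition tconv (f g : H -> H) : tensor H H -> H :=
  @tlift R H H H (fun y z => mul (f y) (g z)).
Definition conv (f g : H -> H) (x : H) : H := tconv f g (Delta x).

Lemma tconv_bilinear f g : linear f -> linear g ->
  bilinear_map (fun y z : H => mul (f y) (g z)).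
Proof.
by move=> lf lg; split=> [z a y y'|y a z z']; rewrite ?lf ?lg ?(mul_l _) ?(mul_r _).
Qed.

Lemma tconv_linear f g : linear f -> linear g -> linear (tconv f g).
Proof. by move=> lf lg; apply/tlift_linear/tconv_bilinear. Qed.

Lemma tconv_tens f g x y : linear f -> linear g -> tconv f g (tens x y) = mul (f x) (g y).
Proof. by move=> lf lg; apply/tlift_tens/tconv_bilinear. Qed.

Lemma conv_linear f g : linear f -> linear g -> linear (conv f g).
Proof. by move=> lf lg; apply: linear_comp lD (tconv_linear lf lg). Qed.

Lemma eq_tconv f f' g g' : linear f -> linear f' -> linear g -> linear g' ->
  f =1 f' -> g =1 g' -> tconv f g =1 tconv f' g'.
Proof.
move=> lf lf' lg lg' ff gg; apply: tensor_ext; [exact: tconv_linear..|move=> x y].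
by rewrite !tconv_tens // ff gg.
Qed.

(** Both sides are the linear map [M3] on the triple tensor product, applied to the two sides of
    coassociativity. *)
Lemma convA f g h : linear f -> linear g -> linear h ->
  conv (conv f g) h =1 conv f (conv g h).
Proof.
move=> lf lg lh x; have lfg := conv_linear lf lg; have lgh := conv_linear lg lh.
have ltgh := tconv_linear lg lh.
have b3 : bilinear_map (fun y w => mul (f y) (tconv g h w)).
  by split=> [z a y y'|y a z z']; rewrite ?lf ?ltgh ?(mul_l _) ?(mul_r _).
pose M3 := tlift (fun y w => mul (f y) (tconv g h w)).
have l3 : linear M3 := tlift_linear b3.
have lI := @linear_id R H; have lA := @tassoc_linear R H H H.
have E1 t : tconv (conv f g) h t = M3 (tassoc (tmap Delta id t)).
  move: t; apply: tensor_ext; first exact: tconv_linear.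
    exact: linear_comp (linear_comp (tmap_linear lD lI) lA) l3.
  move=> y z; rewrite tconv_tens // tmap_tens // /conv.
  move: (Delta y) => w.
  have lw : linear (fun w : tensor H H => tens w z) by move=> a u v; rewrite tensDl tensZl.
  move: w; apply: tensor_ext => [a u v|a u v|u v].
  - by rewrite (tconv_linear lf lg) mul_l.
  - by rewrite lw lA l3.
  by rewrite tassoc_tens /M3 tlift_tens // !tconv_tens // mulA.
have E2 t : tconv f (conv g h) t = M3 (tmap id Delta t).
  move: t; apply: tensor_ext; first exact: tconv_linear.
    exact: linear_comp (tmap_linear lI lD) l3.
  by move=> y z; rewrite tconv_tens // tmap_tens // /M3 tlift_tens.
have [_ _ coA _ _] := coalg.
by rewrite [LHS]E1 [RHS]E2 coA.
Qed.

Definition econv (x : H) : H := eps x *: unit.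

Lemma econv_linear : linear econv.
Proof. by move=> a x y; rewrite /econv le scalerDl scalerA. Qed.

Lemma conv_el f : linear f -> conv econv f =1 f.
Proof.
move=> lf x; have [_ _ _ cl _] := coalg.
have bl : bilinear_map (fun y z : H => eps y *: z).
  by split=> [z a y y'|y a z z']; rewrite ?le ?scalerDl ?scalerDr !scalerA // mulrC.
rewrite -[in RHS](cl x) /conv; move: (Delta x); apply: tensor_ext.
- exact: tconv_linear econv_linear lf.
- exact: linear_comp (tlift_linear bl) lf.
move=> y z; rewrite tlift_tens // tconv_tens //; last exact: econv_linear.
by rewrite (linZ lf) /econv (linZ (mul_l _)) mul1.
Qed.

Lemma conv_er f : linear f -> conv f econv =1 f.
Proof.
move=> lf x; have [_ _ _ _ cr] := coalg.
have bl : bilinear_map (fun y z : H => eps z *: y).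
  by split=> [z a y y'|y a z z']; rewrite ?le ?scalerDl ?scalerDr !scalerA // mulrC.
rewrite -[in RHS](cr x) /conv; move: (Delta x); apply: tensor_ext.
- exact: tconv_linear lf econv_linear.
- exact: linear_comp (tlift_linear bl) lf.
move=> y z; rewrite tlift_tens // tconv_tens //; last exact: econv_linear.
by rewrite (linZ lf) /econv (linZ (mul_r _)) mulx1.
Qed.

Definition redid (x : H) : H := x - econv x.

Lemma redid_linear : linear redid.
Proof. by move=> a x y; rewrite /redid econv_linear opprD addrACA scalerBr. Qed.

Fixpoint redpow n : H -> H := if n is m.+1 then conv redid (redpow m) else econv.

Lemma redpow_linear n : linear (redpow n).
Proof.
by elim: n => [|n IH]; [exact: econv_linear|exact: conv_linear redid_linear IH].
Qed.

Lemma eq_conv f f' g g' : linear f -> linear f' -> linear g -> linear g' ->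
  f =1 f' -> g =1 g' -> conv f g =1 conv f' g'.
Proof. by move=> lf lf' lg lg' ff gg x; apply: eq_tconv. Qed.

Lemma redpowSr n : redpow n.+1 =1 conv (redpow n) redid.
Proof.
have lJ := redid_linear.
elim: n => [|n IH] x; first by rewrite /= conv_er // conv_el.
have l := redpow_linear.
transitivity (conv redid (conv (redpow n) redid) x).
  by apply: eq_conv => //; [exact: (l n.+1)|exact: conv_linear].
by rewrite -convA.
Qed.

Lemma Delta_graded n (x : T n) : exists t : forall i : 'I_n.+1, tensor (T i) (T (n - i)%N),
  Delta (iota n x) = \sum_(i < n.+1) tmap (iota i) (iota (n - i)%N) (t i).
Proof. by case: conn => [[gr _] _]; apply: gr. Qed.

(** On degree n the coproduct involves only degrees at most n, so convolutions can be compared there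
    by their factors. No grading of [mul] is needed. *)
Lemma conv_graded_eq f f' g g' n (x : T n) :
    linear f -> linear f' -> linear g -> linear g' ->
    (forall (i : 'I_n.+1) y z,
       mul (f (iota i y)) (g (iota (n - i)%N z)) = mul (f' (iota i y)) (g' (iota (n - i)%N z))) ->
  conv f g (iota n x) = conv f' g' (iota n x).
Proof.
move=> lf lf' lg lg' fg; have [t tE] := Delta_graded x; rewrite /conv tE.
have ld := @dinj_linear R T.
rewrite !(lin_sum (tconv_linear _ _)) //; apply: eq_bigr => i _.
move: (t i); apply: tensor_ext => [||y z].
- exact: linear_comp (tmap_linear (ld _) (ld _)) (tconv_linear lf lg).
- exact: linear_comp (tmap_linear (ld _) (ld _)) (tconv_linear lf' lg').
by rewrite tmap_tens // !tconv_tens.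
Qed.

Lemma redid0 n (y : T n) : n = 0%N -> redid (iota n y) = 0.
Proof.
move=> n0; subst n; have [_ [u [uE uP]]] := conn; have [a [-> _]] := uP y.
rewrite (linZ (@dinj_linear R T 0%N)) -uE (linZ redid_linear) /redid /econv eps1.
by rewrite scale1r subrr scaler0.
Qed.

(** In each term of the coproduct, either the left factor has degree 0 and is killed by [redid], or
    the right factor has smaller degree and is killed by the preceding power. *)
Lemma redpow_vanish m n (x : T n) : (n < m)%N -> redpow m (iota n x) = 0.
Proof.
elim: m n x => // m IH n x nm; have lm := redpow_linear m.
have [t tE] := Delta_graded x; have ld := @dinj_linear R T.
have lc := tconv_linear redid_linear lm.
rewrite /= /conv tE (lin_sum lc) big1 // => i _.
elim/tensor_ind: (t i) => [|y z w IHw].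
  by rewrite (lin0 (tmap_linear (ld _) (ld _))) (lin0 lc).
rewrite (linD (tmap_linear (ld _) (ld _))) (linD lc) IHw addr0.
rewrite tmap_tens // tconv_tens //; last exact: redid_linear.
have [i0|i0] := posnP i.
  by rewrite redid0 // (lin0 (mul_l _)).
by rewrite IH ?(lin0 (mul_r _)) //; have := ltn_ord i; lia.
Qed.

(** Partial sum of the geometric series for the convolution inverse of [econv] plus [redid], which
    is the identity. *)
Definition trunc_antipode m (x : H) : H := \sum_(j < m.+1) (-1) ^+ j *: redpow j x.

Lemma trunc_linear m : linear (trunc_antipode m).
Proof.
apply: linear_sum_fun => j a x y; rewrite redpow_linear scalerDr !scalerA.
by rewrite [_ * a]mulrC.
Qed.

Lemma trunc_stable n m (x : T n) : (n <= m)%N ->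
  trunc_antipode m (iota n x) = trunc_antipode n (iota n x).
Proof.
move/subnK => <-; elim: (m - n)%N => [|d IH]; first by rewrite add0n.
rewrite addSn {1}/trunc_antipode big_ord_recr -[nat_of_ord ord_max]/(d + n).+1.
rewrite redpow_vanish; last by rewrite ltnS leq_addl.
by rewrite scaler0 /= addr0.
Qed.

Definition antipode : H -> H := dlift (fun n (x : T n) => trunc_antipode n (iota n x)).

Lemma antipode_linear : linear antipode.
Proof.
by apply: dlift_linear => n a x y; rewrite (@dinj_linear R T) trunc_linear.
Qed.

Lemma antipode_iota n m (x : T n) : (n <= m)%N ->
  antipode (iota n x) = trunc_antipode m (iota n x).
Proof.
move=> nm; rewrite trunc_stable // /antipode dlift_dinj // => l a u v.
by rewrite (@dinj_linear R T) trunc_linear.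
Qed.

Lemma conv_suml (J : Type) (r : seq J) (c : J -> R) (F : J -> H -> H) g x :
    linear g -> (forall j, linear (F j)) ->
  conv (fun y => \sum_(j <- r) c j *: F j y) g x = \sum_(j <- r) c j *: conv (F j) g x.
Proof.
move=> lg lF; have lS : linear (fun y => \sum_(j <- r) c j *: F j y).
  by apply: linear_sum_fun => j a y z; rewrite lF scalerDr !scalerA mulrC.
rewrite /conv; move: (Delta x); apply: tensor_ext => [||y z].
- exact: tconv_linear.
- apply: linear_sum_fun => j a y z.
  by rewrite (tconv_linear (lF j) lg) scalerDr !scalerA mulrC.
rewrite tconv_tens // (lin_sum (mul_l _)); apply: eq_bigr => j _.
by rewrite (linZ (mul_l _)) tconv_tens.
Qed.

Lemma conv_sumr (J : Type) (r : seq J) (c : J -> R) (F : J -> H -> H) g x :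
    linear g -> (forall j, linear (F j)) ->
  conv g (fun y => \sum_(j <- r) c j *: F j y) x = \sum_(j <- r) c j *: conv g (F j) x.
Proof.
move=> lg lF; have lS : linear (fun y => \sum_(j <- r) c j *: F j y).
  by apply: linear_sum_fun => j a y z; rewrite lF scalerDr !scalerA mulrC.
rewrite /conv; move: (Delta x); apply: tensor_ext => [||y z].
- exact: tconv_linear.
- apply: linear_sum_fun => j a y z.
  by rewrite (tconv_linear lg (lF j)) scalerDr !scalerA mulrC.
rewrite tconv_tens // (lin_sum (mul_r _)); apply: eq_bigr => j _.
by rewrite (linZ (mul_r _)) tconv_tens.
Qed.

Lemma linear_add f g : linear f -> linear g -> linear (fun y => f y + g y).
Proof. by move=> lf lg a u v; rewrite lf lg scalerDr addrACA. Qed.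

Lemma conv_addl f g h x : linear f -> linear g -> linear h ->
  conv (fun y => f y + g y) h x = conv f h x + conv g h x.
Proof.
move=> lf lg lh; have lc := tconv_linear lf lh; have lc' := tconv_linear lg lh.
have lfg := linear_add lf lg.
rewrite /conv; move: (Delta x); apply: tensor_ext => [|a u v|y z].
- exact: tconv_linear.
- by rewrite lc lc' scalerDr addrACA.
by rewrite !tconv_tens // (linD (mul_l _)).
Qed.

Lemma conv_addr f g h x : linear f -> linear g -> linear h ->
  conv h (fun y => f y + g y) x = conv h f x + conv h g x.
Proof.
move=> lf lg lh; have lc := tconv_linear lh lf; have lc' := tconv_linear lh lg.
have lfg := linear_add lf lg.
rewrite /conv; move: (Delta x); apply: tensor_ext => [|a u v|y z].
- exact: tconv_linear.
- by rewrite lc lc' scalerDr addrACA.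
by rewrite !tconv_tens // (linD (mul_r _)).
Qed.

(** The alternating sum telescopes to the unit plus a power [n.+1] of [redid], which vanishes in
    degree n. *)
Lemma antipode_telescope n (x : T n) :
  \sum_(j < n.+1) (-1) ^+ j *: (redpow j (iota n x) + redpow j.+1 (iota n x)) = econv (iota n x).
Proof.
suff E m : \sum_(j < m.+1) (-1) ^+ j *: (redpow j (iota n x) + redpow j.+1 (iota n x)) =
    econv (iota n x) + (-1) ^+ m *: redpow m.+1 (iota n x).
  by rewrite E redpow_vanish // scaler0 addr0.
elim: m => [|m IH]; first by rewrite big_ord1 expr0 !scale1r.
rewrite big_ord_recr /= IH -addrA; congr (_ + _).
by rewrite scalerDr addrA -scalerDl exprS mulN1r addrN scale0r add0r.
Qed.

Lemma id_split x : x = econv x + redid x.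
Proof. by rewrite /redid addrC subrK. Qed.

Lemma antipodeP : is_antipode mul unit Delta eps antipode.
Proof.
have lI := @linear_id R H; have lS := antipode_linear; have lt := trunc_linear.
have lr := redpow_linear; have lJ := redid_linear; have le' := econv_linear.
have ld := @dinj_linear R T.
have lid := linear_add le' lJ.
have le_n n (i : 'I_n.+1) : (i <= n)%N by rewrite -ltnS.
split=> // [x|x].
  rewrite -[LHS]/(conv antipode id x) -[RHS]/(econv x); move: x.
  apply: dsum_ext => // [|n x]; first exact: conv_linear.
  (* All degrees met in the coproduct are at most n, so a single truncation replaces the
     antipode. *)
  transitivity (conv (trunc_antipode n) id (iota n x)).
    by apply: conv_graded_eq => // i y z; rewrite (antipode_iota _ (le_n n i)).
  rewrite conv_suml // -[RHS]antipode_telescope; apply: eq_bigr => j _; congr (_ *: _).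
  transitivity (conv (redpow j) (fun y => econv y + redid y) (iota n x)).
    by apply: eq_conv => // y; apply: id_split.
  by rewrite conv_addr // conv_er // -redpowSr.
rewrite -[LHS]/(conv id antipode x) -[RHS]/(econv x); move: x.
apply: dsum_ext => // [|n x]; first exact: conv_linear.
transitivity (conv id (trunc_antipode n) (iota n x)).
  apply: conv_graded_eq => // i y z; congr (mul _ _).
  by apply: antipode_iota; apply: leq_subr.
rewrite conv_sumr // -[RHS]antipode_telescope; apply: eq_bigr => j _; congr (_ *: _).
transitivity (conv (fun y => econv y + redid y) (redpow j) (iota n x)).
  by apply: eq_conv => // y; apply: id_split.
by rewrite conv_addl // conv_el.
Qed.
End Antipode.

(** * The Hopf algebra *)

Section Hopf.
Variables (k : fieldType) (k0 : [pchar k] =i pred0) (R : comNzRingType).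
Local Notation RepS := (RepS R k).
Local Notation Lam := (Lambda R k).
Local Notation iota := (dinj RepS).
Local Notation smash := (@smash k R).
Local Notation Delta := (@Delta k k0 R).
Local Notation eps := (@eps k R).
Local Notation one := (@lam_one k R).

Let form1_inj x y f f' : form1 x f -> form1 y f' -> f =1 f' -> x = y :> Lam.
Proof. exact: (based_inj k0 (form1_based k0 R)). Qed.

Let form2_inj x y f f' : form2 x f -> form2 y f' -> f =1 f' -> x = y :> tensor Lam Lam.
Proof. exact: (based_inj k0 (form2_based k0 R)). Qed.

Let form3_inj x y f f' : form3 x f -> form3 y f' -> f =1 f' -> x = y :> tensor Lam (tensor Lam Lam).
Proof. exact: (based_inj k0 (form3_based k0 R)). Qed.

Let sl y : linear (smash^~ y). Proof. exact: smash_linear_l. Qed.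
Let sr x : linear (smash x). Proof. exact: smash_linear_r. Qed.
Let lD : linear Delta. Proof. exact: Delta_linear. Qed.
Let le : linear (eps : Lam -> R^o). Proof. exact: eps_linear. Qed.
Let lI := @linear_id R Lam.

(** By trilinearity it suffices to compare classes of representations, whose evaluations are
    multiplied pointwise in k. *)
Lemma smash_assoc : associative smash.
Proof.
move=> x y z; move: x; apply: Lambda_ext => [|a x x'|p V]; first exact: sl.
  by rewrite !sl.
move: y; apply: Lambda_ext => [a y y'|a y y'|q W]; first by rewrite sl sr.
  by rewrite sr sl.
move: z; apply: Lambda_ext => [a z z'|a z z'|r U]; first by rewrite !sr.
  by rewrite sr.
have [[LV LW] LU] := (form1_gen R V, form1_gen R W, form1_gen R U).
apply: (form1_inj (form1_smash k0 LV (form1_smash k0 LW LU)) (form1_smash k0 (form1_smash k0 LV LW) LU)) => t.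
exact: mulrA.
Qed.

Lemma smash_comm : commutative smash.
Proof.
move=> x y; move: x; apply: Lambda_ext => [||p V]; [exact: sl|exact: sr|].
move: y; apply: Lambda_ext => [||q W]; [exact: sr|exact: sl|].
have [LV LW] := (form1_gen R V, form1_gen R W).
by apply: (form1_inj (form1_smash k0 LV LW) (form1_smash k0 LW LV)) => t; apply: mulrC.
Qed.

Lemma smash_one : left_id one smash.
Proof.
apply: Lambda_ext => [||p V]; [exact: sr|exact: linear_id|].
have LV := form1_gen R V.
by apply: (form1_inj (form1_smash k0 (form1_one k R) LV) LV) => t; rewrite mul1r.
Qed.

Lemma smash_algebra : is_algebra smash one.
Proof.
split; [exact: smash_bilinear|exact: smash_assoc|exact: smash_one|].
by move=> x; rewrite smash_comm smash_one.
Qed.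

Definition fassoc (A B C : Type) (x : (A + B) + C) : A + (B + C) :=
  match x with inl (inl a) => inl a | inl (inr b) => inr (inl b) | inr c => inr (inr c) end.
Definition fassoc' (A B C : Type) (x : A + (B + C)) : (A + B) + C :=
  match x with inl a => inl (inl a) | inr (inl b) => inl (inr b) | inr (inr c) => inr c end.
Definition fswap (A B : Type) (x : A + B) : B + A :=
  match x with inl a => inr a | inr b => inl b end.
Definition fvoid (A : Type) (x : void + A) : A :=
  match x with inl a => match a with end | inr a => a end.

Lemma ev_psumA (D A B C : finType) (f : {perm D} -> k) (g : {perm A}) (h : {perm B}) (l : {perm C}) :
  ev f (psum (psum g h) l) = ev f (psum g (psum h l)).
Proof.
apply/esym/(ev_transport _ (h := @fassoc A B C) (h' := @fassoc' A B C)).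
- by case=> [[a|b]|c].
- by case=> [a|[b|c]].
by case=> [[a|b]|c]; rewrite /= ?(psum_inl, psum_inr) /= ?(psum_inl, psum_inr).
Qed.

Lemma ev_psumC (D A B : finType) (f : {perm D} -> k) (g : {perm A}) (h : {perm B}) :
  ev f (psum g h) = ev f (psum h g).
Proof.
apply/esym/(ev_transport _ (h := @fswap A B) (h' := @fswap B A)); try by case.
by case=> [a|b]; rewrite /= ?(psum_inl, psum_inr).
Qed.

Lemma ev_psum0 (D A : finType) (f : {perm D} -> k) (g : {perm A}) (h : {perm void}) :
  ev f (psum h g) = ev f g.
Proof.
apply/esym/(ev_transport _ (h := @fvoid A) (h' := inr)) => //; first by case=> // -[].
by case=> [[]//|a]; rewrite /= psum_inr.
Qed.

Lemma Delta_coalgebra : is_coalgebra Delta eps.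
Proof.
split; [exact: lD|exact: eps_linear| | |].
- have lA := @tassoc_linear R Lam Lam Lam.
  apply: Lambda_ext => [||n V].
  + exact: linear_comp lD (linear_comp (tmap_linear lD lI) lA).
  + exact: linear_comp lD (tmap_linear lI lD).
  have LD := form2_Delta k0 (form1_gen R V).
  by apply: (form3_inj (form3_Delta_l k0 LD) (form3_Delta_r k0 LD)) => t; apply: ev_psumA.
- apply: Lambda_ext => [||n V]; [|exact: linear_id|].
    exact: linear_comp lD (tlift_linear (counit_bilinear_l k R)).
  have LV := form1_gen R V; have LD := form2_Delta k0 LV.
  by apply: (form1_inj (form1_counit_l LD) LV) => t; apply: ev_psum0.
apply: Lambda_ext => [||n V]; [|exact: linear_id|].
  exact: linear_comp lD (tlift_linear (counit_bilinear_r k R)).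
have LV := form1_gen R V; have LD := form2_Delta k0 LV.
apply: (form1_inj (form1_counit_r LD) LV) => t; rewrite /= ev_psumC; apply: ev_psum0.
Qed.

Lemma Delta_cocomm : cocommutative Delta.
Proof.
apply: Lambda_ext => [||n V]; [|exact: lD|].
  exact: linear_comp lD (tlift_linear (@tswap_bilinear R Lam Lam)).
have LD := form2_Delta k0 (form1_gen R V).
by apply: (form2_inj (form2_swap LD) LD) => t; apply: ev_psumC.
Qed.

(** On classes, both sides evaluate at a pair of permutations to the product of the two evaluations
    at their disjoint sum. *)
Lemma Delta_smash x y : Delta (smash x y) = tmul smash (Delta x) (Delta y).
Proof.
have lt a b := tlift_linear (tmul_bilinear_inner k0 (R := R) a b).
have ls t := tlift_linear (tmul_bilinear k0 (R := R) t).
have ltm (s : tensor Lam Lam) : linear (tmul smash s).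
  move=> a t t'; rewrite /tmul; move: s; apply: tensor_ext => [||u v]; first exact: ls.
    by move=> c s s'; rewrite !ls !scalerDr !scalerA [a * c]mulrC addrACA.
  by rewrite !tlift_tens; [exact: lt|exact: tmul_bilinear..].
move: x; apply: Lambda_ext => [||p V]; first exact: linear_comp (sl y) lD.
  by move=> a x x'; rewrite lD /tmul ls.
move: y; apply: Lambda_ext => [||q W]; first exact: linear_comp (sr _) lD.
  exact: linear_comp lD (ltm _).
have [LV LW] := (form1_gen R V, form1_gen R W).
by apply: (form2_inj (form2_Delta k0 (form1_smash k0 LV LW))
  (form2_tmul k0 (form2_Delta k0 LV) (form2_Delta k0 LW))).
Qed.

Lemma Delta_one : Delta one = tens one one.
Proof.
have L := form1_one k R.
by apply: (form2_inj (form2_Delta k0 L) (ptens_tens L L)) => t; rewrite mulr1.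
Qed.

Lemma eps_smash x y : eps (smash x y) = eps x * eps y.
Proof.
move: x; apply: (@Lambda_ext k R R^o) => [||p V]; first exact: linear_comp (sl y) le.
  by move=> a x x'; rewrite le mulrDl scalerAl.
move: y; apply: (@Lambda_ext k R R^o) => [||q W]; first exact: linear_comp (sr _) le.
  by move=> a y y'; rewrite le mulrDr scalerAr.
have [LV LW] := (form1_gen R V, form1_gen R W).
have [n [-> En]] := form1_eps LV; have [m [-> Em]] := form1_eps LW.
have [l [-> El]] := form1_eps (form1_smash k0 LV LW).
rewrite -natrM; congr (_%:R); apply: (natr_inj_char0 k0).
by rewrite natrM -En -Em El.
Qed.

Lemma eps_one : eps one = 1.
Proof. by rewrite eps_cls. Qed.

Lemma Lambda_connected : connected one Delta eps.
Proof.
split.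
  split=> [n x|n x n0].
    by exists (fun i => phi k0 (res_lin i x)); rewrite Delta_iota.
  have l0 : linear (fun y : RepS n => eps (iota n y) : R^o).
    exact: linear_comp (@dinj_linear R RepS n) le.
  move: x; apply: (@groth_ext R k _ R^o) => // [|V].
    by move=> a u v; rewrite scaler0 addr0.
  by rewrite eps_cls -[n == 0%N]negbK -lt0n n0.
exists (cls R (triv_rep k 'S_0)); split=> // x.
have [a xa] : exists a : R, x = a *: cls R (triv_rep k 'S_0).
  elim/groth_ind: x => [|a V x [b ->]]; first by exists 0; rewrite scale0r.
  exists (a * (rdegree V)%:R + b); rewrite scalerDl -scalerA; congr (_ *: _ + _).
  (* S_0 is trivial, so [V] has the character of [rdegree V] copies of the trivial
     representation. *)
  rewrite scaler_nat (@cls_expand k k0 R _ 'I_1 V (fun=> triv_rep k 'S_0) (fun=> rdegree V)).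
    by rewrite big_ord1.
  move=> g; rewrite big_ord1 chi_triv mulr1 -chi1; congr (chi V _).
  by apply/permP => -[].
(* The counit reads off the coefficient, which gives uniqueness. *)
exists a; split=> // b xb; have := congr1 (fun y => eps (iota 0%N y)) (etrans (esym xa) xb).
have l0 : linear (fun y : RepS 0 => eps (iota 0%N y) : R^o).
  exact: linear_comp (@dinj_linear R RepS 0) le.
by rewrite !(linZ l0) eps_one /GRing.scale /= !mulr1.
Qed.

Lemma smash_hopf : is_hopf_algebra smash one Delta eps.
Proof.
have alg := smash_algebra; have coalg := Delta_coalgebra.
split; last first.
  exact: ex_intro (antipodeP alg coalg Lambda_connected eps_one).
split=> //; first by split; [exact: Delta_smash|exact: Delta_one].
by split; [exact: eps_smash|exact: eps_one].
Qed.
End Hopf.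

Theorem theorem1p2 (R : comNzRingType) (k : fieldType) (k0 : [pchar k] =i pred0) :
  exists (phi : forall p q : nat,
            RepSS R k p q -> tensor (RepS R k p) (RepS R k q))
         (smash : Lambda R k -> Lambda R k -> Lambda R k)
         (Delta : Lambda R k -> tensor (Lambda R k) (Lambda R k))
         (one : Lambda R k) (eps : Lambda R k -> R),
    [/\ is_identification phi,
        is_smash_product smash,
        is_restriction_coproduct phi Delta,
        is_hopf_algebra smash one Delta eps /\ connected one Delta eps
      & commutative smash /\ cocommutative Delta].
Proof.
exists (@phi k k0 R), (@smash k R), (@Delta k k0 R), (@lam_one k R), (@eps k R).
split.
- exact: phi_identification.
- exact: smash_product.
- exact: Delta_coproduct.
- by split; [exact: smash_hopf|exact: Lambda_connected].
by split; [exact: smash_comm|exact: Delta_cocomm].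
Qed.
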